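(* Let $(i,j)\in\mathbb Z_2^2$ and let $P^{ij}=\mathbb O_{K\tau\sigma_W^{1-j},\,K\tau^{-1}\sigma_W^{1-i}}$. The category $\mathcal D_{3,5}^{ij}$ is classified by $\{P^{ij}\}$ if $(i,j)\neq(1,1)$, and $\mathcal D_{3,5}^{11}=\emptyset$.
   Context: Algebras are not assumed associative or unital. $\mathbb O$ denotes the real octonions, with standard involution $K:x\mapsto\overline x$ and Euclidean norm. For linear orthogonal operators $f,g$ on $\mathbb O$, the isotope $\mathbb O_{f,g}$ is the vector space $\mathbb O$ with multiplication $x\cdot y=f(x)g(y)$. $\mathcal A_8$ is the category of 8-dimensional real division composition algebras (equivalently, 8-dimensional absolute valued real algebras, i.e. those with a norm satisfying $\|xy\|=\|x\|\,\|y\|$), with non-zero algebra homomorphisms as morphisms (these are all isomorphisms). The double sign of $A\in\mathcal A_8$ is $(\operatorname{sgn}\det L_a,\operatorname{sgn}\det R_a)$ for any $a\in A\setminus\{0\}$ (it does not depend on $a$), where $L_a,R_a$ are left and right multiplication by $a$. $\mathcal D$ is the full subcategory of $\mathcal A_8$ of all $A$ whose derivation Lie algebra $\operatorname{Der}(A)$ is non-abelian; each such $A$ is a completely reducible $\operatorname{Der}(A)$-module. $\mathcal D_{3,5}$ is the full subcategory of those $A\in\mathcal D$ which are the direct sum of an irreducible 3-dimensional and an irreducible 5-dimensional $\operatorname{Der}(A)$-module, and $\mathcal D_{3,5}^{ij}$ is its full subcategory of objects with double sign $((-1)^i,(-1)^j)$; elements of $\mathbb Z_2$ are treated as $0,1$.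 A Cayley triple is an orthonormal triple $(u,v,z)$ of octonions orthogonal to $1$ with $z\perp uv$; $G_2=\operatorname{Aut}(\mathbb O)$ acts simply transitively on Cayley triples. Fix a Cayley triple $(u,v,z)$. $\tau\in G_2$ is the automorphism with $(u,v,z)\mapsto(u,v,z(\sqrt3u-1)/2)$. $W=\langle v,z,vz\rangle$ (linear span), and $\sigma_W$ is the linear map acting as $-1$ on $W$ and as the identity on $W^\perp$. A subclass of objects classifies a category if every object is isomorphic to one in the subclass and distinct objects of the subclass are non-isomorphic. *)

(* Defs.v *)
From HB Require Import structures.
From mathcomp Require Import all_boot all_order all_algebra.
From mathcomp Require Import reals.

Set Implicit Arguments.
Unset Strict Implicit.
Unset Printing Implicit Defensive.

Import Order.TTheory GRing.Theory Num.Theory.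
Local Open Scope ring_scope.

(* A finite-dimensional real algebra, not assumed associative or unital. *)
Record algebra (R : realType) := Algebra {
  alg_car :> vectType R;
  alg_mul : {bilinear alg_car -> alg_car -> alg_car}
}.

Definition left_mul (R : realType) (A : algebra R) (a : A) : 'End(A) :=
  linfun (fun x : A => alg_mul A a x).

Definition right_mul (R : realType) (A : algebra R) (a : A) : 'End(A) :=
  linfun (fun x : A => alg_mul A x a).

Definition alg_hom (R : realType) (A B : algebra R) (f : 'Hom(A, B)) : Prop :=
  forall x y : A, f (alg_mul A x y) = alg_mul B (f x) (f y).

(* The categories below are full in the category of algebras with these
   morphisms, so each of them is given by its class of objects. *)
Definition morphism (R : realType) (A B : algebra R) (f : 'Hom(A, B)) : Prop :=
  f != 0 /\ alg_hom f.

Definition isomorphism (R : realType) (A B : algebra R) (f : 'Hom(A, B)) :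
    Prop :=
  morphism f /\
  exists g : 'Hom(B, A),
    [/\ morphism g, (g \o f)%VF = \1%VF & (f \o g)%VF = \1%VF].

Definition isomorphic (R : realType) (A B : algebra R) : Prop :=
  exists f : 'Hom(A, B), isomorphism f.

Definition classifies (R : realType) (C S : algebra R -> Prop) : Prop :=
  [/\ forall A, S A -> C A,
      forall A, C A -> exists B, S B /\ isomorphic A B
    & forall A B, S A -> S B -> A <> B -> ~ isomorphic A B].

Definition polar (R : realType) (V : vectType R) (q : V -> R) (x y : V) : R :=
  q (x + y) - q x - q y.

Definition quadratic_form (R : realType) (V : vectType R) (q : V -> R) : Prop :=
  (forall (a : R) (x : V), q (a *: x) = a ^+ 2 * q x) /\
  bilinear_for *%R *%R (polar q).

Definition nondegenerate_form (R : realType) (V : vectType R) (q : V -> R) :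
    Prop :=
  forall x : V, (forall y : V, polar q x y = 0) -> x = 0.

Definition composition_algebra (R : realType) (A : algebra R) : Prop :=
  exists q : A -> R,
    [/\ quadratic_form q, nondegenerate_form q
      & forall x y : A, q (alg_mul A x y) = q x * q y].

Definition division_algebra (R : realType) (A : algebra R) : Prop :=
  (exists a : A, a != 0) /\
  forall a : A, a != 0 ->
    bijective (alg_mul A a) /\ bijective (fun x : A => alg_mul A x a).

Definition cat_A8 (R : realType) (A : algebra R) : Prop :=
  [/\ \dim {:A} = 8%N, division_algebra A & composition_algebra A].

Definition derivation (R : realType) (A : algebra R) (d : 'End(A)) : Prop :=
  forall x y : A,
    d (alg_mul A x y) = alg_mul A (d x) y + alg_mul A x (d y).

Definition lie_bracket (R : realType) (V : vectType R) (d e : 'End(V)) :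
    'End(V) :=
  (d \o e)%VF - (e \o d)%VF.

Definition der_abelian (R : realType) (A : algebra R) : Prop :=
  forall d e : 'End(A), derivation d -> derivation e -> lie_bracket d e = 0.

Definition cat_D (R : realType) (A : algebra R) : Prop :=
  cat_A8 A /\ ~ der_abelian A.

Definition der_submodule (R : realType) (A : algebra R) (U : {vspace A}) :
    Prop :=
  forall d : 'End(A), derivation d -> (d @: U <= U)%VS.

Definition der_irreducible (R : realType) (A : algebra R) (U : {vspace A}) :
    Prop :=
  [/\ der_submodule U, U <> 0%VS
    & forall U' : {vspace A},
        der_submodule U' -> (U' <= U)%VS -> U' = 0%VS \/ U' = U].

Definition cat_D35 (R : realType) (A : algebra R) : Prop :=
  cat_D A /\
  exists U V : {vspace A},
    [/\ \dim U = 3%N /\ der_irreducible U,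
        \dim V = 5%N /\ der_irreducible V,
        (U + V)%VS = fullv
      & directv (U + V)].

(* The determinant of an endomorphism, computed in some basis of the space. *)
Definition lfun_det (R : realType) (V : vectType R) (f : 'End(V)) : R :=
  \det (passmx.mxof (vbasis {:V}) (vbasis {:V}) f).

Definition double_sign (R : realType) (A : algebra R) (a : A) : R * R :=
  (Num.sg (lfun_det (left_mul a)), Num.sg (lfun_det (right_mul a))).

Definition cat_D35_sign (R : realType) (i j : 'Z_2) (A : algebra R) : Prop :=
  cat_D35 A /\
  forall a : A, a != 0 -> double_sign a = ((-1) ^+ i, (-1) ^+ j).

(* Cayley-Dickson doubling of a multiplication [m] with involution [c], and of
   an inner product [d]. *)
Definition cd_conj (R : realType) (V : lmodType R) (c : V -> V) (x : V * V) :
    V * V :=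
  (c x.1, - x.2).

Definition cd_mul (R : realType) (V : lmodType R) (m : V -> V -> V)
    (c : V -> V) (x y : V * V) : V * V :=
  (m x.1 y.1 - m (c y.2) x.2, m y.2 x.1 + m x.2 (c y.1)).

Definition cd_dot (R : realType) (V : lmodType R) (d : V -> V -> R)
    (x y : V * V) : R :=
  d x.1 y.1 + d x.2 y.2.

Lemma cd_conj_linear (R : realType) (V : lmodType R) (c : V -> V) :
  linear c -> linear (cd_conj c).
Proof.
by move=> lc a x y; rewrite /cd_conj /= lc opprD -scalerN.
Qed.

Lemma cd_mul_bilinear (R : realType) (V : lmodType R) (m : V -> V -> V)
    (c : V -> V) :
  linear c -> bilinear_for *:%R *:%R m ->
  bilinear_for *:%R *:%R (cd_mul m c).
Proof.
move=> lc [ml mr]; split=> u a x y; rewrite /cd_mul /=; congr pair => /=.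
- by rewrite ml mr scalerBr opprD addrACA.
- by rewrite mr ml scalerDr addrACA.
- by rewrite mr lc ml scalerBr opprD addrACA.
- by rewrite ml lc mr scalerDr addrACA.
Qed.

Definition octonion (R : realType) : vectType R :=
  (((R^o * R^o) * (R^o * R^o)) * ((R^o * R^o) * (R^o * R^o)))%type.

Definition oconj_fun (R : realType) : octonion R -> octonion R :=
  cd_conj (cd_conj (cd_conj (id : R^o -> R^o))).

Lemma oconj_fun_linear (R : realType) : linear (@oconj_fun R).
Proof. by do 3!apply: cd_conj_linear. Qed.

HB.instance Definition _ (R : realType) :=
  GRing.isLinear.Build R (octonion R) (octonion R) *:%R (@oconj_fun R)
    (@oconj_fun_linear R).

Definition omul (R : realType) : octonion R -> octonion R -> octonion R :=
  let c1 := cd_conj (id : R^o -> R^o) in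
  let m1 := cd_mul (fun x y : R^o => x * y : R^o) (id : R^o -> R^o) in
  cd_mul (cd_mul m1 c1) (cd_conj c1).

Definition odot (R : realType) : octonion R -> octonion R -> R :=
  cd_dot (cd_dot (cd_dot (fun x y : R^o => x * y : R))).

Definition oone (R : realType) : octonion R :=
  (((1, 0), (0, 0)), ((0, 0), (0, 0))).

Lemma omul_bilinear (R : realType) : bilinear_for *:%R *:%R (@omul R).
Proof.
do 3![apply: cd_mul_bilinear; first by do ?apply: cd_conj_linear].
by split=> u a x y; rewrite ?mulrDl ?mulrDr -?scalerAl // -scalerAr.
Qed.

HB.instance Definition _ (R : realType) :=
  bilinear_isBilinear.Build R (octonion R) (octonion R) (octonion R)
    *:%R *:%R (@omul R) (@omul_bilinear R).

Definition octonions (R : realType) : algebra R :=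
  Algebra (@omul R : {bilinear octonion R -> octonion R -> octonion R}).

Definition oconj (R : realType) : 'End(octonion R) := linfun (@oconj_fun R).

Definition isotope_mul (R : realType) (f g : 'End(octonion R))
    (x y : octonion R) : octonion R :=
  omul (f x) (g y).

Lemma isotope_mul_bilinear (R : realType) (f g : 'End(octonion R)) :
  bilinear_for *:%R *:%R (isotope_mul f g).
Proof.
by split=> u a x y; rewrite /isotope_mul linearP ?linearPl ?linearPr.
Qed.

HB.instance Definition _ (R : realType) (f g : 'End(octonion R)) :=
  bilinear_isBilinear.Build R (octonion R) (octonion R) (octonion R)
    *:%R *:%R (isotope_mul f g) (isotope_mul_bilinear f g).

Definition isotope (R : realType) (f g : 'End(octonion R)) : algebra R :=
  Algebra (isotope_mul f g :
    {bilinear octonion R -> octonion R -> octonion R}).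

Definition in_G2 (R : realType) (t : 'End(octonion R)) : Prop :=
  @isomorphism R (octonions R) (octonions R) t.

Definition cayley_triple (R : realType) (u v z : octonion R) : Prop :=
  [/\ [/\ odot u u = 1, odot v v = 1 & odot z z = 1],
      [/\ odot u v = 0, odot u z = 0 & odot v z = 0],
      [/\ odot u (oone R) = 0, odot v (oone R) = 0 & odot z (oone R) = 0]
    & odot z (omul u v) = 0].

(* [s] is the orthogonal reflection that is -1 on [W] and 1 on the orthogonal
   complement of [W]; these two conditions determine [s]. *)
Definition is_reflection (R : realType) (W : {vspace octonion R})
    (s : 'End(octonion R)) : Prop :=
  (forall x, x \in W -> s x = - x) /\
  (forall x, (forall w, w \in W -> odot x w = 0) -> s x = x).

Definition lfun_pow (R : realType) (V : vectType R) (f : 'End(V)) (n : nat) :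
    'End(V) :=
  iter n (fun g : 'End(V) => (f \o g)%VF) \1%VF.

Definition isotope_P (R : realType) (tau sigma : 'End(octonion R))
    (i j : 'Z_2) : algebra R :=
  isotope (oconj R \o tau \o lfun_pow sigma (1 - j)%N)%VF
          (oconj R \o tau^-1 \o lfun_pow sigma (1 - i)%N)%VF.

(* Main.v *)
Require Import Defs.
From HB Require Import structures.
From mathcomp Require Import all_boot all_order all_algebra.
From mathcomp Require Import boolp reals.
From mathcomp Require Import ring lra.
Import Order.TTheory GRing.Theory Num.Theory.
Set Implicit Arguments.
Unset Strict Implicit.
Unset Printing Implicit Defensive.
Local Open Scope ring_scope.

(** Let A be an algebra of the category, with summands U of dimension 3 and V of
dimension 5. Its composition form is a positive definite inner product, and
every derivation d is skew for it, because L_a^-1 L_(d a) = L_a^-1 d L_a - d is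
traceless ([derivation_skew]). A Lie algebra of skew operators acting
irreducibly on U must act by all rotations, so U has an orthonormal basis e1,
e2, e3 with derivations rotating it ([so3_frame_exists]); there are no further
derivations, since one that kills U kills V as well ([derivation_frame]).

Equivariance under rotations then controls the product. The product of two
elements of U is the sum of k times their cross product and a symmetric
traceless part in V, which is irreducible of dimension 5
([frame_antisymmetric], [frame_traceless]). The composition law fixes the inner
products of the symmetric part and k^2 = 1/4 ([pf_gram]). It also fixes the
products of U with V, except for a sign g in the products from the left and a
sign g' in those from the right ([product_frame_left], [D35_table]). As the
products of elements of U span A, the composition law settles the products
inside V. So A is isomorphic to one of four algebras, written out with rational
structure constants as [model g g'] ([table_model]).

For g = g' = 1 the model is the Okubo algebra, which has a derivation that does
not preserve the image of U ([okubo_moves]); this pair of signs does not occur.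
For the other three, apply a derivation d to v (v v) = g v and
(v v) v = g' v: these equations force d v to lie in the span of v, z, v z,
so this span and its orthogonal complement are submodules, irreducible under
the rotations ([model_D35]).

In the coordinates that a Cayley triple gives, tau, sigma and conjugation have
explicit rational matrices, and P^ij is the model with g = (-1)^(1-i) and
g' = (-1)^(1-j) ([isotope_P_iso_model]). Its double sign is found by factoring
a one-sided multiplication of the model into one of the octonions, whose
determinant is positive since it satisfies a quadratic equation without real
roots or is a scalar, and the twisting operator, whose determinant has the sign
-g or -g' ([model_double_sign]). Hence the double sign tells the models apart,
and (1,1) belongs to the excluded pair g = g' = 1. *)

(** * Composition algebras over the reals *)

Lemma linear_lfun (R : realType) (U V : vectType R) (f : U -> V) :
  linear f -> exists g : 'Hom(U, V), forall x, g x = f x.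
Proof.
move=> lf.
pose F : {linear U -> V} := HB.pack f (GRing.isLinear.Build R U V *:%R f lf).
by exists (linfun F) => x; rewrite (lfunE F).
Qed.

(** Submodules of a summand are cut out below by conditions that quantify over
all derivations; this turns such a condition into a subspace, by adding
vectors that satisfy it until the dimension stops growing. *)
Lemma vspace_of_pred (R : realType) (V : vectType R) (P : V -> Prop) :
  P 0 -> (forall (a : R) x y, P x -> P y -> P (a *: x + y)) ->
  exists X : {vspace V}, forall x, x \in X <-> P x.
Proof.
move=> P0 Pl.
suff: forall n (X : {vspace V}), (\dim {:V} - \dim X <= n)%N ->
    (forall x, x \in X -> P x) -> exists Y : {vspace V}, forall x, x \in Y <-> P x.
  move=> /(_ (\dim {:V}) 0%VS); apply; first exact: leq_subr.
  by move=> x; rewrite memv0 => /eqP ->.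
elim=> [|n IHn] X leX PX; have [all_in|] := EM (forall x, P x -> x \in X).
- by exists X => x; split; [exact: PX | exact: all_in].
- move=> notin; exists X => x; split; first exact: PX.
  move: leX; rewrite leqn0 subn_eq0 => leX _.
  have /eqP -> : X == {:V}%VS by rewrite eqEdim subvf leX.
  exact: memvf.
- by exists X => x; split; [exact: PX | exact: all_in].
move=> /existsNP[x /not_implyP[Px /negP xX]].
apply: (IHn (<[x]> + X)%VS) => [|y /memv_addP[y1 /vlineP[k ->] [y2 y2X ->]]].
  have dX : (\dim X < \dim (<[x]> + X)%VS)%N.
    rewrite (ltn_leqif (dimv_leqif_sup (addvSr _ _))).
    by apply: contra xX => /subvP; apply; rewrite (subvP (addvSl _ _)) ?memv_line.
  move: leX; rewrite !leq_subLR => leX; apply: (leq_trans leX).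
  by rewrite addnS -addSn leq_add2r.
by apply: Pl => //; exact: PX.
Qed.

Record composition_product (R : realType) (A : algebra R) (b : A -> A -> R) :
    Prop := CompositionProduct {
  cp_sym : forall x y, b x y = b y x;
  cp_lin : forall a x y z, b (a *: x + y) z = a * b x z + b y z;
  cp_pos : forall x, x != 0 -> 0 < b x x;
  cp_mul : forall x y, b (alg_mul A x y) (alg_mul A x y) = b x x * b y y
}.

Section CompositionProduct.
Variables (R : realType) (A : algebra R) (b : A -> A -> R).
Hypothesis cpb : composition_product b.
Local Notation "x ** y" := (alg_mul A x y) (at level 40, left associativity).

Lemma cpC x y : b x y = b y x. Proof. exact: cp_sym cpb x y. Qed.
Lemma cpDl x y z : b (x + y) z = b x z + b y z.
Proof. by rewrite -[x]scale1r (cp_lin cpb) scale1r mul1r. Qed.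
Lemma cp0l z : b 0 z = 0.
Proof. by have := cpDl 0 0 z; rewrite addr0; lra. Qed.
Lemma cpZl a x z : b (a *: x) z = a * b x z.
Proof. by rewrite -[a *: x]addr0 (cp_lin cpb) cp0l addr0. Qed.
Lemma cpNl x z : b (- x) z = - b x z.
Proof. by rewrite -scaleN1r cpZl mulN1r. Qed.
Lemma cpDr x y z : b z (x + y) = b z x + b z y.
Proof. by rewrite cpC cpDl !(cpC z). Qed.
Lemma cp0r z : b z 0 = 0. Proof. by rewrite cpC cp0l. Qed.
Lemma cpZr a x z : b z (a *: x) = a * b z x.
Proof. by rewrite cpC cpZl cpC. Qed.
Lemma cpNr x z : b z (- x) = - b z x.
Proof. by rewrite cpC cpNl cpC. Qed.

Definition cpE := (cpDl, cpZl, cpNl, cp0l, cpDr, cpZr, cpNr, cp0r).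

Lemma mDl x y z : (x + y) ** z = x ** z + y ** z. Proof. exact: linearDl. Qed.
Lemma mDr x y z : z ** (x + y) = z ** x + z ** y. Proof. exact: linearDr. Qed.
Lemma mNl x z : (- x) ** z = - (x ** z). Proof. exact: linearNl. Qed.
Lemma mNr x z : z ** (- x) = - (z ** x). Proof. exact: linearNr. Qed.
Lemma mZl a x z : (a *: x) ** z = a *: (x ** z). Proof. exact: linearZl_LR. Qed.
Lemma mZr a x z : z ** (a *: x) = a *: (z ** x). Proof. exact: linearZr_LR. Qed.
Lemma m0l z : 0 ** z = 0. Proof. exact: linear0l. Qed.
Lemma m0r z : z ** 0 = 0. Proof. exact: linear0r. Qed.

Definition mE := (mDl, mZl, mNl, m0l, mDr, mZr, mNr, m0r).

Lemma cp_eq0 x : b x x = 0 -> x = 0.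
Proof. by move=> bx; apply/eqP/contraT => /(cp_pos cpb); rewrite bx ltxx. Qed.

Lemma cp_inj x y : (forall w, b x w = b y w) -> x = y.
Proof.
move=> xy; apply/eqP; rewrite -subr_eq0; apply/eqP/cp_eq0.
by rewrite cpDl cpNl xy subrr.
Qed.

Lemma cp_mull x y w : b (x ** y) (x ** w) = b x x * b y w.
Proof.
have := cp_mul cpb x (y + w); have := cp_mul cpb x y; have := cp_mul cpb x w.
by rewrite !mE !cpE (cpC w y) (cpC (x ** w)); lra.
Qed.

Lemma cp_mulr x y w : b (y ** x) (w ** x) = b x x * b y w.
Proof.
have := cp_mul cpb (y + w) x; have := cp_mul cpb y x; have := cp_mul cpb w x.
by rewrite !mE !cpE (cpC w y) (cpC (w ** x)); lra.
Qed.

(** The twice linearized composition law. It determines an inner product of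
products from those with two factors exchanged, and is the only form in which
the composition property enters the computation of the product. *)
Lemma cp_mul4 x y z w :
  b (x ** y) (z ** w) + b (x ** w) (z ** y) = 2 * b x z * b y w.
Proof.
have := cp_mull (x + z) y w; have := cp_mull x y w; have := cp_mull z y w.
rewrite !mE !cpE (cpC z x) (cpC (z ** y) (x ** w)); lra.
Qed.

Lemma cp_unit x : x != 0 -> exists2 k : R, k != 0 & b (k *: x) (k *: x) = 1.
Proof.
move=> /(cp_pos cpb) bx; have s_gt0 : 0 < Num.sqrt (b x x) by rewrite sqrtr_gt0.
exists (Num.sqrt (b x x))^-1; first by rewrite invr_eq0 gt_eqF.
rewrite cpZl cpZr mulrA -expr2 exprVn sqr_sqrtr ?ltW //.
by rewrite mulVf // gt_eqF.
Qed.

End CompositionProduct.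

(** * Derivations are skew-symmetric *)

(** The polar form of q, halved. A division algebra has no nonzero isotropic
vector, since left multiplication by one would make q vanish. As q (x x) is a
square, q is positive somewhere on the span of x and x x; if q x were negative,
the quadratic equation for q (x + t (x x)) = 0 would have a real root. *)
Lemma cat_A8_composition (R : realType) (A : algebra R) :
  cat_A8 A -> exists b : A -> A -> R, composition_product b.
Proof.
move=> [_ [_ divA] [q [[qZ [ql qr]] q_nd qM]]].
have q0 : q 0 = 0 by rewrite -[X in q X](scale0r (0 : A)) qZ expr0n mul0r.
have polarZr a x y : polar q x (a *: y) = a * polar q x y.
  by have := qr x a y 0; rewrite addr0 {3}/polar q0 addr0 subr0 subrr /= addr0.
have qD x y : q (x + y) = q x + q y + polar q x y by rewrite /polar; lra.
have q_neq0 a : a != 0 -> q a != 0.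
  move=> a0; apply/eqP => qa0; have [[g _ ga] _] := divA a a0.
  have qz y : q y = 0 by rewrite -[y]ga qM qa0 mul0r.
  by case/eqP: a0; apply: q_nd => y; rewrite /polar !qz !subr0.
have q_gt0 x : x != 0 -> 0 < q x.
  move=> x0; rewrite lt_neqAle eq_sym q_neq0 //= leNgt; apply/negP => qx.
  have := qM x x; set y := alg_mul A x x => qy.
  have qy_gt0 : 0 < q y by rewrite qy; nra.
  pose B := polar q x y; pose D := B ^+ 2 - 4 * q x * q y.
  have D_ge0 : 0 <= D by rewrite /D; have := sqr_ge0 B; nra.
  pose t := (Num.sqrt D - B) / (2 * q y).
  have /eqP : q (x + t *: y) = 0.
    rewrite qD polarZr qZ -/B /t; have := sqr_sqrtr D_ge0.
    set s := Num.sqrt D => sD; have -> : q x = (B ^+ 2 - s ^+ 2) / (4 * q y).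
      by rewrite sD /D; field; rewrite gt_eqF.
    by field; rewrite gt_eqF.
  apply/negP/q_neq0; apply: contraTneq qx => /(canRL (addrK _)).
  by rewrite sub0r -scaleNr => ->; rewrite qZ -leNgt mulr_ge0 ?sqr_ge0 ?ltW.
have polarxx x : polar q x x = 2 * q x.
  by rewrite /polar -[x in x + x]scale1r -scalerDl qZ; ring.
exists (fun x y => polar q x y / 2); split=> [x y|a x y z|x x0|x y].
- by rewrite /polar (addrC x); lra.
- by have := ql z a x y; rewrite /= => ->; lra.
- by rewrite polarxx; have := q_gt0 x x0; lra.
- by rewrite !polarxx qM; field.
Qed.

Section SkewTrace.
Variables (R : realType) (A : algebra R) (b : A -> A -> R).
Hypothesis cpb : composition_product b.
Import passmx.
Local Notation X := (vbasis {:A}).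
Local Notation tr f := (\tr (mxof X X f)).

Lemma trace_comp (f g : 'End(A)) : tr (f \o g)%VF = tr (g \o f)%VF.
Proof. by rewrite !(mxof_comp X X (vbasisP _)) mxtrace_mulC. Qed.

(** With G the Gram matrix of a basis, skewness of f reads M G = - G M^T, so M is
similar to - M^T. *)
Lemma trace_skew (f : 'End(A)) :
  (forall x y, b (f x) y = - b x (f y)) -> tr f = 0.
Proof.
move=> skf; set M := mxof X X f.
pose G : 'M_(\dim {:A}) := \matrix_(i, j) b X`_i X`_j.
have bsum (v : 'rV_(\dim {:A})) y : b (vecof X v) y = \sum_i v 0 i * b X`_i y.
  rewrite /vecof; elim/big_ind2: _ => [|x1 x2 y1 y2 <- <-|i _].
  - exact: cp0l.
  - exact: cpDl.
  - exact: cpZl.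
have fX (i : 'I_(\dim {:A})) : f X`_i = vecof X (row i M).
  by rewrite -[RHS](rVofK (vbasisP _)) rowE /M -hom_vecof ?vbasisP // vecof_delta rVofK ?vbasisP.
have MG : M *m G = - (G *m M^T).
  apply/matrixP => i j; rewrite !mxE.
  transitivity (b (f X`_i) X`_j).
    by rewrite fX bsum; apply: eq_bigr => k _; rewrite !mxE.
  rewrite skf fX (cpC cpb) bsum; congr (- _).
  by apply: eq_bigr => k _; rewrite !mxE (cpC cpb) mulrC.
have Gu : G \in unitmx.
  rewrite -row_free_unit -kermx_eq0; apply/eqP/row_matrixP => i; rewrite row0.
  set v := row i _; have vG : v *m G = 0.
    by rewrite /v -row_mul mulmx_ker row0.
  apply/eqP; rewrite -(vecof_eq0 (vbasisP _)); apply/eqP/(cp_eq0 cpb).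
  rewrite {2}/vecof; elim/big_ind: _ => [|x y bx by_|j _].
  - by rewrite cp0r.
  - by rewrite cpDr // bx by_ addr0.
  - have /matrixP/(_ 0 j) := vG; rewrite cpZr // bsum !mxE => vGj.
    suff -> : \sum_i0 v 0 i0 * b X`_i0 X`_j = 0 by rewrite mulr0.
    by rewrite -[RHS]vGj; apply: eq_bigr => k _; rewrite !mxE.
have : \tr M = - \tr M.
  rewrite -{1}[M](mulmxK Gu) MG mulNmx -mulmxA linearN /= mxtrace_mulC.
  by rewrite mulmxKV // mxtrace_tr.
by lra.
Qed.

(** Put T = L_a^-1 L_(d a) = L_a^-1 d L_a - d. It is traceless, as a difference of
conjugate operators. By the linearized composition law T minus a scalar c is
skew, hence traceless too, so c = 0. Since c is proportional to <a, d a>, this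
says that d a is orthogonal to a. *)
Lemma derivation_skew (d : 'End(A)) :
  derivation d -> forall x y, b (d x) y = - b x (d y).
Proof.
move=> derd.
suff bdx a : b a (d a) = 0.
  move=> x y; have := bdx (x + y); rewrite linearD /= !(cpE cpb) !bdx.
  by rewrite (cpC cpb (d x)); lra.
have [->|a0] := eqVneq a 0; first by rewrite (cp0l cpb).
have ba := cp_pos cpb a0.
have LE x y : left_mul x y = alg_mul A x y by rewrite (lfunE (alg_mul A x)).
have kerL : lker (left_mul a) == 0%VS.
  apply/lker0P => x y; rewrite !LE => axy; apply/eqP; rewrite -subr_eq0.
  apply/eqP/(cp_eq0 cpb)/eqP; have := cp_mul cpb a (x - y).
  rewrite linearBr axy subrr (cp0l cpb) => /esym/eqP.
  by rewrite mulf_eq0 gt_eqF.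
(* c is the factor for which T - c is skew *)
pose T : 'End(A) := ((left_mul a)^-1 \o left_mul (d a))%VF.
have aT y : alg_mul A a (T y) = alg_mul A (d a) y.
  by rewrite -!LE comp_lfunE /= lker0_lfunVK.
have trT : tr T = 0.
  have -> : T = ((left_mul a)^-1 \o (d \o left_mul a) - d)%VF.
    apply/lfunP => y; rewrite add_lfunE opp_lfunE !comp_lfunE /= LE derd.
    by rewrite linearD /= -!LE lker0_lfunK // addrK.
  rewrite linearB linearB /= trace_comp -comp_lfunA lker0_compfV //.
  by rewrite comp_lfun1r subrr.
pose c := b a (d a) / b a a.
have trS : tr (T - c *: \1%VF) = 0.
  apply: trace_skew => x y.
  rewrite !add_lfunE !opp_lfunE !scale_lfunE !id_lfunE !(cpE cpb).
  have := cp_mul4 cpb a x (d a) y; rewrite -!aT !(cp_mull cpb).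
  have -> : b a (d a) = c * b a a by rewrite /c divfK // gt_eqF.
  rewrite (cpC cpb y) => h; apply: (mulfI (lt0r_neq0 ba)); lra.
move: trS; rewrite 2!linearB /= trT !linearZ /= mxof1 ?(basis_free (vbasisP _)) //.
rewrite mxtrace1 sub0r => /eqP; rewrite oppr_eq0 mulf_eq0 pnatr_eq0.
have -> : (\dim {:A} == 0)%N = false.
  by apply/negP; rewrite dimv_eq0 => /eqP full0; have := memvf a; rewrite full0 memv0 (negPf a0).
by rewrite orbF /c mulf_eq0 invr_eq0 (gt_eqF ba) orbF => /eqP.
Qed.

End SkewTrace.

(** * A rotation frame in the three-dimensional summand *)

Lemma derivation_lin (R : realType) (A : algebra R) (a : R) (d e : 'End(A)) :
  derivation d -> derivation e -> derivation (a *: d + e).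
Proof.
move=> dd de x y; rewrite !add_lfunE !scale_lfunE dd de !mE.
by rewrite scalerDr addrACA.
Qed.

Lemma derivation_bracket (R : realType) (A : algebra R) (d e : 'End(A)) :
  derivation d -> derivation e -> derivation (lie_bracket d e).
Proof.
move=> dd de x y; rewrite !add_lfunE !opp_lfunE !comp_lfunE /= dd de.
rewrite !linearD /= !dd !de !mE.
rewrite !opprD [LHS](AC ((2*2)*(2*2)) ((1*5)*(4*8)*(2*7)*(3*6)))%AC /=.
by rewrite !subrr !addr0.
Qed.

Lemma lie_bracketE (R : realType) (V : vectType R) (d e : 'End(V)) x :
  lie_bracket d e x = d (e x) - e (d x).
Proof. by rewrite add_lfunE opp_lfunE !comp_lfunE. Qed.

Lemma mem_span3 (R : realType) (V : vectType R) (x y z w : V) :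
  w \in <<[:: x; y; z]>>%VS <->
  exists k : R * R * R, w = k.1.1 *: x + k.1.2 *: y + k.2 *: z.
Proof.
rewrite !span_cons span_nil addv0; split.
  move=> /memv_addP[_ /vlineP[k1 ->] [_ /memv_addP[_ /vlineP[k2 ->] [_ /vlineP[k3 ->] ->]] ->]].
  by exists (k1, k2, k3); rewrite addrA.
case=> [[[k1 k2] k3] ->]; rewrite -addrA.
by rewrite !memv_add // memvZ // memv_line.
Qed.

Lemma free3P (R : realType) (V : vectType R) (x y z : V) :
  free [:: x; y; z] <->
  (forall k1 k2 k3 : R, k1 *: x + k2 *: y + k3 *: z = 0 ->
     [/\ k1 = 0, k2 = 0 & k3 = 0]).
Proof.
have -> : [:: x; y; z] = [tuple x; y; z] by [].
split=> [/freeP fr k1 k2 k3 k0|fr].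
  have := fr (fun i => nth 0 [:: k1; k2; k3] i).
  rewrite !big_ord_recl big_ord0 /= addr0 addrA => /(_ k0) ki.
  by split; [exact: (ki (@Ordinal 3 0 isT)) | exact: (ki (@Ordinal 3 1 isT)) |
    exact: (ki (@Ordinal 3 2 isT))].
apply/freeP => k; rewrite !big_ord_recl big_ord0 /= addr0 addrA => /fr[k1 k2 k3].
case=> [[|[|[|//]]] lti].
- by rewrite -[RHS]k1; congr k; apply: val_inj.
- by rewrite -[RHS]k2; congr k; apply: val_inj.
- by rewrite -[RHS]k3; congr k; apply: val_inj.
Qed.

(** An orthonormal basis of the three-dimensional summand, with derivations that
act on it as the infinitesimal rotations about its axes. *)
Record so3_frame (R : realType) (A : algebra R) (b : A -> A -> R)
    (e1 e2 e3 : A) (d1 d2 d3 : 'End(A)) : Prop := So3Frame {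
  sf_unit : [/\ b e1 e1 = 1, b e2 e2 = 1 & b e3 e3 = 1];
  sf_orth : [/\ b e1 e2 = 0, b e2 e3 = 0 & b e3 e1 = 0];
  sf_der : [/\ derivation d1, derivation d2 & derivation d3];
  sf_act1 : [/\ d1 e1 = 0, d1 e2 = e3 & d1 e3 = - e2];
  sf_act2 : [/\ d2 e2 = 0, d2 e3 = e1 & d2 e1 = - e3];
  sf_act3 : [/\ d3 e3 = 0, d3 e1 = e2 & d3 e2 = - e1]
}.

Lemma so3_frame_rot (R : realType) (A : algebra R) (b : A -> A -> R)
    (e1 e2 e3 : A) (d1 d2 d3 : 'End(A)) :
  so3_frame b e1 e2 e3 d1 d2 d3 -> so3_frame b e2 e3 e1 d2 d3 d1.
Proof. by case=> [[? ? ?] [? ? ?] [? ? ?] [? ? ?] [? ? ?] [? ? ?]]. Qed.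

Section ThreeDimensional.
Variables (R : realType) (A : algebra R) (b : A -> A -> R).
Hypothesis cpb : composition_product b.
Variable U : {vspace A}.
Hypothesis dimU : \dim U = 3%N.

Lemma orthonormal3_span e1 e2 e3 :
    e1 \in U -> e2 \in U -> e3 \in U ->
    [/\ b e1 e1 = 1, b e2 e2 = 1 & b e3 e3 = 1] ->
    [/\ b e1 e2 = 0, b e2 e3 = 0 & b e3 e1 = 0] ->
  forall x, x \in U -> x = b x e1 *: e1 + b x e2 *: e2 + b x e3 *: e3.
Proof.
move=> e1U e2U e3U [n1 n2 n3] [o12 o23 o31] x xU.
have o21 : b e2 e1 = 0 by rewrite (cpC cpb).
have o32 : b e3 e2 = 0 by rewrite (cpC cpb).
have o13 : b e1 e3 = 0 by rewrite (cpC cpb).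
have fr : free [:: e1; e2; e3].
  apply/free3P => k1 k2 k3 k0; split.
  - by have := congr1 (b e1) k0; rewrite !(cpE cpb) n1 o12 o13; lra.
  - by have := congr1 (b e2) k0; rewrite !(cpE cpb) n2 o21 o23; lra.
  - by have := congr1 (b e3) k0; rewrite !(cpE cpb) n3 o31 o32; lra.
have /eqP spanU : <<[:: e1; e2; e3]>>%VS == U.
  rewrite eqEdim dimU (eqP fr) leqnn andbT; apply/span_subvP => y.
  by rewrite !inE => /or3P[] /eqP ->.
move: xU; rewrite -spanU => /mem_span3[[[k1 k2] k3] /= ->].
rewrite !(cpE cpb) n1 n2 n3 o12 o23 o31 o21 o32 o13.
by congr (_ *: _ + _ *: _ + _ *: _); ring.
Qed.

Hypothesis irrU : der_irreducible U.

Let stable d x : derivation d -> x \in U -> d x \in U.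
Proof. by case: irrU => sub _ _ dd xU; apply: subvP (sub d dd) _ (memv_img d xU). Qed.

Lemma irreducible_moved x : x \in U -> x != 0 ->
  exists2 d, derivation d & d x != 0.
Proof.
move=> xU x0; have [//|nod] := EM (exists2 d, derivation d & d x != 0).
have dx0 d : derivation d -> d x = 0.
  by move=> dd; apply/eqP/contraT => dx; case: nod; exists d.
case: irrU => _ _ /(_ <[x]>%VS)[].
- by move=> d dd; rewrite limg_line dx0 // sub0v.
- by rewrite -memvE.
- by move=> /eqP; rewrite -dimv_eq0 dim_vline x0.
- by move=> lU; have := dimU; rewrite -lU dim_vline x0.
Qed.

(** A skew operator on a three-dimensional space kills the vector whose
coordinates are its three entries above the diagonal, read off a basis. When
all three entries vanish, the operator itself is zero on U. *)
Lemma skew_kernel d : derivation d -> exists2 y, y \in U & y != 0 /\ d y = 0.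
Proof.
move=> dd; have skd := derivation_skew cpb dd.
have [x0 [x1 [x2 bX]]] : exists x0 x1 x2, basis_of U [:: x0; x1; x2].
  have := vbasisP U; case: (vbasis U) => /= X; rewrite dimU.
  by case: X => [|x0 [|x1 [|x2 [|]]]] //= _ bX; exists x0, x1, x2.
have XU x : x \in [:: x0; x1; x2] -> x \in U by exact: basis_mem bX.
have x0U : x0 \in U by rewrite XU ?inE ?eqxx.
have x1U : x1 \in U by rewrite XU ?inE ?eqxx ?orbT.
have x2U : x2 \in U by rewrite XU ?inE ?eqxx ?orbT.
have skxx x : b x (d x) = 0.
  by have := skd x x; rewrite (cpC cpb); lra.
pose y := b x1 (d x2) *: x0 + b x2 (d x0) *: x1 + b x0 (d x1) *: x2.
have yU : y \in U by rewrite !memvD ?memvZ.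
have dy : d y = 0.
  apply: (cp_eq0 cpb); rewrite skd.
  have : d y \in U by rewrite stable.
  rewrite -(span_basis bX) => /mem_span3[[[k1 k2] k3] /= ->].
  rewrite /y !(cpE cpb) !linearD /= !linearZ /= !(cpE cpb).
  have s10 : b x1 (d x0) = - b x0 (d x1) by rewrite (cpC cpb) skd.
  have s21 : b x2 (d x1) = - b x1 (d x2) by rewrite (cpC cpb) skd.
  have s02 : b x0 (d x2) = - b x2 (d x0) by rewrite (cpC cpb) skd.
  by rewrite !skxx s10 s21 s02; ring.
have [y0|] := eqVneq y 0; last by exists y.
have := bX; rewrite basisEfree => /and3P[/free3P fr _ _].
have [s12 s20 s01] := fr _ _ _ y0.
have s21 : b x2 (d x1) = 0 by rewrite (cpC cpb) skd s12 oppr0.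
have s02 : b x0 (d x2) = 0 by rewrite (cpC cpb) skd s20 oppr0.
have s10 : b x1 (d x0) = 0 by rewrite (cpC cpb) skd s01 oppr0.
exists x0; rewrite // (free_not0 (basis_free bX)) ?inE ?eqxx //; split=> //.
apply: (cp_eq0 cpb).
have : d x0 \in U by rewrite stable.
rewrite -{1}(span_basis bX) => /mem_span3[[[k1 k2] k3] /= e]; rewrite {1}e.
by rewrite !(cpE cpb) skxx s10 s20; ring.
Qed.

(** Irreducibility gives a derivation d acting nontrivially on U; its axis e3 is
in turn moved by some d', to a multiple of e1. Rescaled, d is the rotation
about e3, and d' becomes the rotation about e2 after subtracting a multiple of
d; their bracket is the rotation about e1. *)
Lemma so3_frame_exists : exists e1 e2 e3 d1 d2 d3,
  [/\ e1 \in U, e2 \in U, e3 \in U & so3_frame b e1 e2 e3 d1 d2 d3].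
Proof.
have sk d : derivation d -> forall x y, b (d x) y = - b x (d y).
  exact: derivation_skew.
have skxx d x : derivation d -> b (d x) x = 0.
  by move=> dd; have := sk d dd x x; rewrite (cpC cpb x); lra.
have bC := cpC cpb.
have [w wU w0] : exists2 w, w \in U & w != 0.
  exists (vpick U); first exact: memv_pick.
  by rewrite vpick0 -dimv_eq0 dimU.
have [d dd dw] := irreducible_moved wU w0.
have [y yU [y0 dy]] := skew_kernel dd.
have [ky ky0 e3n] := cp_unit cpb y0; set e3 := ky *: y in e3n.
have e3U : e3 \in U by rewrite memvZ.
have e30 : e3 != 0 by rewrite scaler_eq0 negb_or ky0.
have de3 : d e3 = 0 by rewrite linearZ /= dy scaler0.
have [d' dd' d'e3] := irreducible_moved e3U e30.
have [k1 k10 e1n] := cp_unit cpb d'e3; set e1 := k1 *: d' e3 in e1n.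
have e1U : e1 \in U by rewrite memvZ ?stable.
have o31 : b e3 e1 = 0 by rewrite bC (cpZl cpb) skxx ?mulr0.
(* d is skew and kills e3; if it killed e1 it would kill U, against the choice of w *)
have de1 : d e1 != 0.
  apply/eqP => de1; have [k2 k20 gn] := cp_unit cpb dw.
  set g := k2 *: d w in gn.
  have gU : g \in U by rewrite memvZ ?stable.
  have og1 : b e1 g = 0 by rewrite bC (cpZl cpb) sk // de1 (cp0r cpb) oppr0 mulr0.
  have og3 : b g e3 = 0 by rewrite (cpZl cpb) sk // de3 (cp0r cpb) oppr0 mulr0.
  have dg : d g = 0.
    have dgU : d g \in U by rewrite stable.
    rewrite [d g](orthonormal3_span e1U gU e3U _ _ dgU) //.
    rewrite skxx // (sk d) // de1 (sk d) // de3.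
    by rewrite !(cp0r cpb) !oppr0 !scale0r !addr0.
  have : b g g = 0 by rewrite {1}/g (cpZl cpb) sk // dg (cp0r cpb) oppr0 mulr0.
  by rewrite gn => /eqP; rewrite oner_eq0.
have [k2 k20 e2n] := cp_unit cpb de1; set e2 := k2 *: d e1 in e2n.
have e2U : e2 \in U by rewrite memvZ ?stable.
have o12 : b e1 e2 = 0 by rewrite bC (cpZl cpb) skxx ?mulr0.
have o23 : b e2 e3 = 0.
  by rewrite (cpZl cpb) sk // de3 (cp0r cpb) oppr0 mulr0.
have span x := @orthonormal3_span e1 e2 e3 e1U e2U e3U
  (And3 e1n e2n e3n) (And3 o12 o23 o31) x.
pose d3 := k2 *: d + 0.
have dd3 : derivation d3.
  apply: derivation_lin => // x z.
  by rewrite !zero_lfunE m0l m0r addr0.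
have d3E x : d3 x = k2 *: d x by rewrite add_lfunE scale_lfunE zero_lfunE addr0.
have d3e3 : d3 e3 = 0 by rewrite d3E de3 scaler0.
have d3e1 : d3 e1 = e2 by rewrite d3E.
have d3e2 : d3 e2 = - e1.
  rewrite [LHS](span _ (stable dd3 e2U)) skxx // !(sk d3) // d3e1 d3e3 e2n.
  by rewrite (cp0r cpb) oppr0 !scale0r !addr0 scaleN1r.
(* n is the part of d' that rotates about e3 *)
pose n := b (d' e1) e2.
pose d2 := k1 *: (- n *: d3 + d') + 0.
have dd2 : derivation d2.
  apply: derivation_lin => [|x z]; first exact: derivation_lin.
  by rewrite !zero_lfunE m0l m0r addr0.
have d2E x : d2 x = k1 *: (d' x - n *: d3 x).
  by rewrite !(add_lfunE, scale_lfunE) zero_lfunE addr0 scaleNr addrC addrC addrC.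
have d2e3 : d2 e3 = e1 by rewrite d2E d3e3 scaler0 subr0.
have d2e1 : d2 e1 = - e3.
  rewrite [LHS](span _ (stable dd2 e1U)) skxx // [b _ e3](sk d2) // d2e3 e1n.
  rewrite d2E d3e1 (cpZl cpb) (cpDl cpb) (cpNl cpb) (cpZl cpb) e2n -/n mulr1.
  by rewrite subrr mulr0 !scale0r !add0r scaleN1r.
have d2e2 : d2 e2 = 0.
  rewrite [LHS](span _ (stable dd2 e2U)) skxx // !(sk d2) // d2e1 d2e3.
  by rewrite (cpNr cpb) o23 bC o12 !oppr0 !scale0r !addr0.
exists e1, e2, e3, (lie_bracket d2 d3), d2, d3; split=> //; split=> //.
  by split=> //; apply: derivation_bracket.
split; rewrite lie_bracketE.
- by rewrite d3e1 d2e1 linearN /= d3e3 d2e2 oppr0 subr0.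
- by rewrite d3e2 d2e2 linearN /= d2e1 linear0 opprK subr0.
- by rewrite d3e3 d2e3 d3e1 linear0 sub0r.
Qed.
End ThreeDimensional.

(** * Rotation-equivariance of the product *)

Section Frame.
Variables (R : realType) (A : algebra R) (b : A -> A -> R).
Hypothesis cpb : composition_product b.
Local Notation "x ** y" := (alg_mul A x y) (at level 40, left associativity).

Lemma derivation_invariant (d : 'End(A)) x y z : derivation d ->
  b (d x ** y) z + b (x ** d y) z + b (x ** y) (d z) = 0.
Proof.
move=> dd; have := derivation_skew cpb dd (x ** y) z.
by rewrite dd !(cpE cpb); lra.
Qed.

Section Trilinear.
Variables (e1 e2 e3 : A) (d1 d2 d3 : 'End(A)).
Hypothesis F : so3_frame b e1 e2 e3 d1 d2 d3.

(** Rotations by a half turn about an axis change the sign of an odd number of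
these arguments; infinitesimally, differentiate the form <x y, z> along the
rotations. *)
Lemma frame_trilinear_odd :
  b (e1 ** e1) e1 = 0 /\
  [/\ b (e1 ** e2) e2 = 0, b (e2 ** e1) e2 = 0, b (e2 ** e2) e1 = 0,
      b (e1 ** e3) e3 = 0 & b (e3 ** e1) e3 = 0 /\ b (e3 ** e3) e1 = 0].
Proof.
case: F => _ _ [dd1 dd2 dd3] [d11 d12 d13] [d22 d23 d21] [d33 d31 d32].
have h1 := derivation_invariant e1 e1 e2 dd3.
have h2 := derivation_invariant e1 e2 e1 dd3.
have h3 := derivation_invariant e2 e1 e1 dd3.
have h4 := derivation_invariant e1 e1 e3 dd2.
have h5 := derivation_invariant e1 e3 e1 dd2.
have h6 := derivation_invariant e3 e1 e1 dd2.
have h7 := derivation_invariant e2 e2 e2 dd3.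
rewrite d31 d32 !mE !(cpE cpb) in h1 h2 h3 h7.
rewrite d21 d23 !mE !(cpE cpb) in h4 h5 h6.
by do !split; lra.
Qed.

(** Invariant trilinear forms on a three-dimensional rotation module are
multiples of the determinant. *)
Lemma frame_trilinear_even :
  [/\ b (e2 ** e3) e1 = b (e1 ** e2) e3, b (e3 ** e1) e2 = b (e1 ** e2) e3,
      b (e2 ** e1) e3 = - b (e1 ** e2) e3, b (e1 ** e3) e2 = - b (e1 ** e2) e3
    & b (e3 ** e2) e1 = - b (e1 ** e2) e3].
Proof.
case: F => _ _ [dd1 dd2 dd3] [d11 d12 d13] [d22 d23 d21] [d33 d31 d32].
have h1 := derivation_invariant e1 e2 e2 dd1.
have h2 := derivation_invariant e2 e1 e2 dd1.
have h3 := derivation_invariant e2 e2 e1 dd1.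
have h4 := derivation_invariant e3 e3 e2 dd2.
have h5 := derivation_invariant e3 e2 e3 dd2.
have h6 := derivation_invariant e2 e3 e3 dd2.
rewrite d11 d12 !mE !(cpE cpb) in h1 h2 h3.
rewrite d22 d23 !mE !(cpE cpb) in h4 h5 h6.
by split; lra.
Qed.

End Trilinear.

Variables (U V : {vspace A}).
Hypotheses (dimU : \dim U = 3%N) (dimV : \dim V = 5%N).
Hypotheses (irrU : der_irreducible U) (irrV : der_irreducible V).
Hypothesis UV : (U + V)%VS = fullv.
Variables (e1 e2 e3 : A) (d1 d2 d3 : 'End(A)).
Hypotheses (e1U : e1 \in U) (e2U : e2 \in U) (e3U : e3 \in U).
Hypothesis F : so3_frame b e1 e2 e3 d1 d2 d3.

Lemma irreducible_stable (W : {vspace A}) d x :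
  der_irreducible W -> derivation d -> x \in W -> d x \in W.
Proof. by case=> sub _ _ dd xW; apply: subvP (sub d dd) _ (memv_img d xW). Qed.

Lemma frame_span x : x \in U -> x = b x e1 *: e1 + b x e2 *: e2 + b x e3 *: e3.
Proof.
by case: F => n o _ _ _ _; apply: (orthonormal3_span cpb dimU).
Qed.

(** The vectors of V orthogonal to U form a submodule. It is nonzero, because V
has larger dimension than U, hence it is V. *)
Lemma summands_orthogonal x y : x \in U -> y \in V -> b x y = 0.
Proof.
have skd d := derivation_skew cpb (d := d).
have [K KP] : exists K : {vspace A}, forall x,
    x \in K <-> x \in V /\ forall u, u \in U -> b u x = 0.
  apply: vspace_of_pred => [|a z w [zV bz] [wV bw]].
    by split=> [|u _]; rewrite ?mem0v ?(cp0r cpb).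
  split=> [|u uU]; first by rewrite memvD ?memvZ.
  by rewrite !(cpE cpb) bz // bw // mulr0 addr0.
have KV : (K <= V)%VS by apply/subvP => z /KP[].
have [K0|KE] : K = 0%VS \/ K = V.
- case: (irrV) => _ _; apply=> // d dd.
  apply/subvP => _ /memv_imgP[z /KP[zV bz] ->]; apply/KP.
  split=> [|u uU]; first exact: irreducible_stable.
  have du : d u \in U by exact: irreducible_stable.
  by have := skd d dd z u; rewrite (cpC cpb u) (cpC cpb z) (bz _ du); lra.
- pose f z := b z e1 *: e1 + b z e2 *: e2 + b z e3 *: e3.
  have [|g gE] := @linear_lfun R A A f.
    by move=> a z w; apply: (cp_inj cpb) => t; rewrite /f !(cpE cpb); ring.
  have gU : (g @: V <= U)%VS.
    apply/subvP => _ /memv_imgP[z _ ->].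
    by rewrite gE /f !memvD ?memvZ.
  have := dimvS gU; rewrite limg_dim_eq ?dimU ?dimV //.
  apply/eqP; rewrite -subv0 -K0; apply/subvP => z /memv_capP[zV].
  rewrite memv_ker gE => /eqP fz; apply/KP; split=> // u uU.
  case: F => [[n1 n2 n3] [o12 o23 o31] _ _ _ _].
  have o21 : b e2 e1 = 0 by rewrite (cpC cpb).
  have o32 : b e3 e2 = 0 by rewrite (cpC cpb).
  have o13 : b e1 e3 = 0 by rewrite (cpC cpb).
  have z1 := congr1 (b^~ e1) fz; have z2 := congr1 (b^~ e2) fz.
  have z3 := congr1 (b^~ e3) fz; move: z1 z2 z3.
  rewrite /f !(cpE cpb) n1 n2 n3 o12 o23 o31 o21 o32 o13.
  rewrite (frame_span uU) !(cpE cpb) !(cpC cpb _ z).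
  rewrite !mulr0 !mulr1 !addr0 !add0r => -> -> ->.
  by rewrite !mulr0 !addr0.
- by move=> xU yV; rewrite -KE in yV; have /KP[_ ->] := yV.
Qed.

Lemma memV x : (forall u, u \in U -> b u x = 0) -> x \in V.
Proof.
move=> bx; have : x \in (U + V)%VS by rewrite UV memvf.
move=> /memv_addP[u uU [v vV xE]]; suff -> : x = v by [].
rewrite xE; suff -> : u = 0 by rewrite add0r.
apply: (cp_eq0 cpb); have := bx u uU; rewrite xE (cpDr cpb).
by rewrite (summands_orthogonal uU vV) addr0.
Qed.

Lemma memV_frame x : b x e1 = 0 -> b x e2 = 0 -> b x e3 = 0 -> x \in V.
Proof.
move=> x1 x2 x3; apply: memV => u /frame_span ->.
by rewrite (cpC cpb) !(cpE cpb) x1 x2 x3; ring.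
Qed.

(** The derivations that kill U form an ideal, so their common kernel in V is a
submodule. It contains e1 e1, which is nonzero and orthogonal to U, so it is
all of V. *)
Lemma derivation_faithful n :
  derivation n -> (forall u, u \in U -> n u = 0) -> n = 0.
Proof.
move=> dn nU; pose N m := derivation m /\ forall u, u \in U -> m u = 0.
have [K KP] : exists K : {vspace A}, forall x,
    x \in K <-> x \in V /\ forall m, N m -> m x = 0.
  apply: vspace_of_pred => [|a z w [zV nz] [wV nw]].
    by split=> [|m _]; rewrite ?mem0v ?linear0.
  split=> [|m Nm]; first by rewrite memvD ?memvZ.
  by rewrite linearP /= nz // nw // scaler0 addr0.
have KV : (K <= V)%VS by apply/subvP => z /KP[].
have [K0|KE] : K = 0%VS \/ K = V.
- case: (irrV) => _ _; apply=> // d dd.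
  apply/subvP => _ /memv_imgP[z /KP[zV nz] ->]; apply/KP.
  split=> [|m Nm]; first exact: irreducible_stable.
  have [dm mU] := Nm.
  have Nmd : N (lie_bracket m d).
    split=> [|u uU]; first exact: derivation_bracket.
    by rewrite lie_bracketE mU ?(irreducible_stable irrU) // mU // linear0 subr0.
  by have := nz _ Nmd; rewrite lie_bracketE (nz m Nm) linear0 subr0.
- have [t1 _] := frame_trilinear_odd F.
  have [_ [_ _ t3 _ [_ t2]]] := frame_trilinear_odd (so3_frame_rot F).
  have [_ [_ _ t4 _ [_ t5]]] := frame_trilinear_odd (so3_frame_rot (so3_frame_rot F)).
  have eeV : e1 ** e1 \in V by rewrite memV_frame.
  have : e1 ** e1 \in K.
    apply/KP; split=> // m [dm mU].
    by rewrite dm mU // m0l m0r addr0.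
  rewrite K0 memv0 => /eqP ee0; have := cp_mul cpb e1 e1.
  case: F => [[n1 _ _] _ _ _ _ _]; rewrite ee0 (cp0l cpb) n1 mulr1 => /eqP.
  by rewrite eq_sym oner_eq0.
- apply/lfunP => x; rewrite zero_lfunE.
  have : x \in (U + V)%VS by rewrite UV memvf.
  move=> /memv_addP[u uU [v vV ->]]; rewrite linearD /= nU // add0r.
  by rewrite -KE in vV; have /KP[_ ->] := vV.
Qed.

(** On U a derivation is a skew operator of a three-dimensional space, that is, a
combination of the three rotations; the difference kills U. *)
Lemma derivation_frame d : derivation d ->
  exists k1 k2 k3 : R, d = k1 *: d1 + (k2 *: d2 + (k3 *: d3 + 0)).
Proof.
case: (F) => [[n1 n2 n3] [o12 o23 o31] [dd1 dd2 dd3]].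
move=> [d11 d12 d13] [d22 d23 d21] [d33 d31 d32] dd.
have skd := derivation_skew cpb dd.
have skxx x : b (d x) x = 0 by have := skd x x; rewrite (cpC cpb x); lra.
pose k1 := b (d e2) e3; pose k2 := b (d e3) e1; pose k3 := b (d e1) e2.
have k1' : b (d e3) e2 = - k1 by rewrite skd (cpC cpb).
have k2' : b (d e1) e3 = - k2 by rewrite skd (cpC cpb).
have k3' : b (d e2) e1 = - k3 by rewrite skd (cpC cpb).
exists k1, k2, k3; apply/eqP; rewrite -subr_eq0 addrC -[X in X + _]scaleN1r.
set f := _ *: d1 + _; have df : derivation f.
  by do 3?[apply: derivation_lin => //]; move=> x y; rewrite !zero_lfunE m0l m0r addr0.
apply/eqP; apply: derivation_faithful.
  by rewrite scaleN1r -scaleN1r; apply: derivation_lin.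
have fE x : f x = k1 *: d1 x + k2 *: d2 x + k3 *: d3 x.
  by rewrite !(add_lfunE, scale_lfunE) zero_lfunE addr0 !addrA.
clearbody f; have dU x : x \in U -> d x \in U by exact: irreducible_stable.
suff [h1 h2 h3] : [/\ d e1 = f e1, d e2 = f e2 & d e3 = f e3].
  move=> u /frame_span ->; rewrite !linearD /= !linearZ /= !(add_lfunE, scale_lfunE).
  rewrite h1 h2 h3; apply: (cp_inj cpb) => w; rewrite !(cpE cpb); ring.
rewrite !fE d11 d12 d13 d21 d22 d23 d31 d32 d33.
rewrite (frame_span (dU _ e1U)) (frame_span (dU _ e2U)) (frame_span (dU _ e3U)).
rewrite !skxx k1' k2' k3' -/k1 -/k2 -/k3.
by split; apply: (cp_inj cpb) => w; rewrite !(cpE cpb); ring.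
Qed.

(** Three vectors cannot span the five-dimensional irreducible V. This plays the
part of Schur's lemma: a rotation-equivariant image of a three-dimensional
module in V is zero. *)
Lemma small_submodule (a1 a2 a3 : A) :
    [/\ a1 \in V, a2 \in V & a3 \in V] ->
    (forall d, d \in [:: d1; d2; d3] -> forall a, a \in [:: a1; a2; a3] ->
       d a \in <<[:: a1; a2; a3]>>%VS) ->
  [/\ a1 = 0, a2 = 0 & a3 = 0].
Proof.
move=> [a1V a2V a3V] da; set X := <<_>>%VS in da.
have XV : (X <= V)%VS by apply/span_subvP => x; rewrite !inE => /or3P[] /eqP ->.
have dX d : d \in [:: d1; d2; d3] -> (d @: X <= X)%VS.
  move=> d_in; rewrite limg_span; apply/span_subvP => _ /mapP[a a_in ->].
  exact: da.
have [X0|XE] : X = 0%VS \/ X = V; last 1 first.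
- have := dim_span [:: a1; a2; a3]; rewrite -/X XE dimV.
  by [].
- case: irrV => _ _; apply=> // d /derivation_frame[k1 [k2 [k3 ->]]].
  apply/subvP => _ /memv_imgP[x xX ->].
  rewrite !(add_lfunE, scale_lfunE) zero_lfunE addr0.
  have sub d0 : d0 \in [:: d1; d2; d3] -> d0 x \in X.
    by move=> d0_in; apply: subvP (dX _ d0_in) _ (memv_img _ xX).
  by rewrite !memvD ?memvZ ?sub ?inE ?eqxx ?orbT.
- have aX a : a \in [:: a1; a2; a3] -> a = 0.
    by move=> a_in; have := memv_span a_in; rewrite -/X X0 memv0 => /eqP.
  by split; apply: aX; rewrite !inE eqxx ?orbT.
Qed.

(** The commutators of the e_i, made orthogonal to U, span a submodule of V of
dimension at most three. *)
Lemma frame_antisymmetric (k := 2 * b (e1 ** e2) e3) :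
  [/\ e2 ** e3 - e3 ** e2 - k *: e1 = 0,
      e3 ** e1 - e1 ** e3 - k *: e2 = 0
    & e1 ** e2 - e2 ** e1 - k *: e3 = 0].
Proof.
have [t111 [t122 t212 t221 t133 [t313 t331]]] := frame_trilinear_odd F.
have [t222 [t233 t323 t332 t211 [t121 t112]]] :=
  frame_trilinear_odd (so3_frame_rot F).
have [t333 [t311 t131 t113 t322 [t232 t223]]] :=
  frame_trilinear_odd (so3_frame_rot (so3_frame_rot F)).
have [t231 t312 t213 t132 t321] := frame_trilinear_even F.
case: (F) => [[n1 n2 n3] [o12 o23 o31] [dd1 dd2 dd3]].
move=> [d11 d12 d13] [d22 d23 d21] [d33 d31 d32].
have o21 : b e2 e1 = 0 by rewrite (cpC cpb).
have o32 : b e3 e2 = 0 by rewrite (cpC cpb).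
have o13 : b e1 e3 = 0 by rewrite (cpC cpb).
apply: small_submodule => [|d d_in a a_in].
{ split; apply: memV_frame; rewrite /k !(cpE cpb).
  all: rewrite ?(t111,t122,t212,t221,t133,t313,t331).
  all: rewrite ?(t222,t233,t323,t332,t211,t121,t112,t333,t311,t131,t113).
  all: rewrite ?(t322,t232,t223,t231,t312,t213,t132,t321).
  all: by rewrite ?(n1, n2, n3, o12, o23, o31, o21, o32, o13); ring. }
apply/mem_span3; move: d_in a_in; rewrite !inE.
by move=> /or3P[] /eqP -> /or3P[] /eqP ->;
  rewrite !linearD /= !linearN /= !linearZ /= ?(dd1, dd2, dd3);
  rewrite ?(d11,d12,d13,d21,d22,d23,d31,d32,d33) !mE;
  [exists (0,0,0)|exists (0,0,1)|exists (0,-1,0)|exists (0,0,-1)|exists (0,0,0)|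
   exists (1,0,0)|exists (0,1,0)|exists (-1,0,0)|exists (0,0,0)];
  rewrite /=; apply: (cp_inj cpb) => w; rewrite !(cpE cpb); ring.
Qed.

(** The sum of the squares is killed by the rotations, so it spans a submodule of
V of dimension at most one. *)
Lemma frame_traceless : e1 ** e1 + e2 ** e2 + e3 ** e3 = 0.
Proof.
have [t111 [t122 t212 t221 t133 [t313 t331]]] := frame_trilinear_odd F.
have [t222 [t233 t323 t332 t211 [t121 t112]]] :=
  frame_trilinear_odd (so3_frame_rot F).
have [t333 [t311 t131 t113 t322 [t232 t223]]] :=
  frame_trilinear_odd (so3_frame_rot (so3_frame_rot F)).
case: (F) => [[n1 n2 n3] [o12 o23 o31] [dd1 dd2 dd3]].
move=> [d11 d12 d13] [d22 d23 d21] [d33 d31 d32].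
set t := _ + _; have tV : t \in V.
{  apply: memV_frame; rewrite /t !(cpE cpb) ?t111 ?(t111,t221,t331,t222,t332,t112).
  all: by rewrite ?(t333,t113,t223) ?addr0. }
have [//|d d_in a a_in|] := @small_submodule t t t.
have -> : a = t by move: a_in; rewrite !inE => /or3P[] /eqP.
apply/mem_span3; exists (0, 0, 0); rewrite /= /t.
move: d_in; rewrite !inE => /or3P[] /eqP -> {a a_in};
  rewrite !linearD /= ?(dd1, dd2, dd3) ?(d11,d12,d13,d21,d22,d23,d31,d32,d33) !mE;
  by apply: (cp_inj cpb) => w; rewrite !(cpE cpb); ring.
by [].
Qed.

End Frame.

(** * The alternating and the symmetric part of the product *)

(** The products of an so3_frame, split into the alternating part with values in
U, governed by k, and the symmetric traceless part with values in V: p_i is the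
square of e_i, and q_i is half the anticommutator of the other two vectors. By
pf_total a vector is known from its inner products with all of these. *)
Record product_frame (R : realType) (A : algebra R) (b : A -> A -> R)
    (e1 e2 e3 : A) (d1 d2 d3 : 'End(A)) (k : R) (p1 p2 p3 q1 q2 q3 : A) :
    Prop := ProductFrame {
  pf_frame : so3_frame b e1 e2 e3 d1 d2 d3;
  pf_square : [/\ alg_mul A e1 e1 = p1, alg_mul A e2 e2 = p2
                & alg_mul A e3 e3 = p3];
  pf_mul : [/\ alg_mul A e2 e3 = q1 + k *: e1, alg_mul A e3 e1 = q2 + k *: e2
             & alg_mul A e1 e2 = q3 + k *: e3];
  pf_mulC : [/\ alg_mul A e3 e2 = q1 - k *: e1, alg_mul A e1 e3 = q2 - k *: e2
              & alg_mul A e2 e1 = q3 - k *: e3];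
  pf_trace : p1 + p2 + p3 = 0;
  pf_orth : forall x, x \in [:: e1; e2; e3] ->
    forall y, y \in [:: p1; p2; p3; q1; q2; q3] -> b x y = 0;
  pf_total : forall x,
    (forall y, y \in [:: e1; e2; e3; p1; p2; p3; q1; q2; q3] -> b x y = 0) ->
    x = 0
}.

Lemma product_frame_rot (R : realType) (A : algebra R) (b : A -> A -> R)
    e1 e2 e3 d1 d2 d3 (k : R) p1 p2 p3 q1 q2 q3 :
  @product_frame R A b e1 e2 e3 d1 d2 d3 k p1 p2 p3 q1 q2 q3 ->
  product_frame b e2 e3 e1 d2 d3 d1 k p2 p3 p1 q2 q3 q1.
Proof.
case=> F [? ? ?] [? ? ?] [? ? ?] tr orth tot; split=> //.
- exact: so3_frame_rot.
- by rewrite addrC addrA.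
- move=> x; rewrite !inE => xe y ye; apply: orth.
    by move: xe => /or3P[] /eqP ->; rewrite !inE eqxx ?orbT.
  move: ye; rewrite !inE.
  by do ![case/predU1P => [->|]; first by rewrite eqxx ?orbT] => ->; rewrite ?orbT.
- move=> x xy; apply: tot => y ye; apply: xy; move: ye; rewrite !inE.
  by do ![case/predU1P => [->|]; first by rewrite eqxx ?orbT] => ->; rewrite ?orbT.
Qed.

Section ProductFrame.
Variables (R : realType) (A : algebra R) (b : A -> A -> R).
Hypothesis cpb : composition_product b.
Local Notation "x ** y" := (alg_mul A x y) (at level 40, left associativity).

Lemma so3_frame_opp e1 e2 e3 (d1 d2 d3 : 'End(A)) :
  so3_frame b e1 e2 e3 d1 d2 d3 -> so3_frame b (- e1) (- e2) (- e3) d1 d2 d3.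
Proof.
case=> [[n1 n2 n3] [o1 o2 o3] D [h1 h2 h3] [h4 h5 h6] [h7 h8 h9]]; split=> //.
- by rewrite !(cpE cpb) n1 n2 n3 !opprK.
- by rewrite !(cpE cpb) o1 o2 o3 !opprK.
- by rewrite !linearN /= h1 h2 h3 oppr0.
- by rewrite !linearN /= h4 h5 h6 oppr0.
- by rewrite !linearN /= h7 h8 h9 oppr0.
Qed.

Lemma product_frame_opp e1 e2 e3 d1 d2 d3 (k : R) p1 p2 p3 q1 q2 q3 :
  @product_frame R A b e1 e2 e3 d1 d2 d3 k p1 p2 p3 q1 q2 q3 ->
  product_frame b (- e1) (- e2) (- e3) d1 d2 d3 (- k) p1 p2 p3 q1 q2 q3.
Proof.
case=> F sq mu muC tr orth tot; split=> //.
- exact: so3_frame_opp.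
- by rewrite !mE !opprK.
- by rewrite !mE !opprK !scalerN !scaleNr !opprK.
- by rewrite !mE !opprK !scalerN !scaleNr !opprK.
- move=> x; rewrite !inE => xe y ye; rewrite -[x]opprK (cpNl cpb) orth ?oppr0 //.
  by move: xe => /or3P[] /eqP ->; rewrite opprK !inE eqxx ?orbT.
- move=> x xy; apply: tot => y.
  rewrite (mem_cat y [:: e1; e2; e3] [:: p1; p2; p3; q1; q2; q3]).
  case/orP=> [|ye]; last first.
    apply: xy; rewrite (mem_cat y [:: - e1; - e2; - e3] [:: p1; p2; p3; q1; q2; q3]).
    by rewrite ye orbT.
  rewrite !inE => ye; apply/eqP; rewrite -oppr_eq0 -(cpNr cpb); apply/eqP/xy.
  by move: ye => /or3P[] /eqP ->; rewrite !inE eqxx ?orbT.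
Qed.

Section Left.
Variables (e1 e2 e3 : A) (d1 d2 d3 : 'End(A)) (k : R).
Variables (p1 p2 p3 q1 q2 q3 : A).
Hypothesis PF : product_frame b e1 e2 e3 d1 d2 d3 k p1 p2 p3 q1 q2 q3.

Lemma pf_orthE :
  ([/\ b e1 p1 = 0, b e1 p2 = 0, b e1 p3 = 0 & [/\ b e1 q1 = 0, b e1 q2 = 0 & b e1 q3 = 0]] *
   [/\ b e2 p1 = 0, b e2 p2 = 0, b e2 p3 = 0 & [/\ b e2 q1 = 0, b e2 q2 = 0 & b e2 q3 = 0]] *
   [/\ b e3 p1 = 0, b e3 p2 = 0, b e3 p3 = 0 & [/\ b e3 q1 = 0, b e3 q2 = 0 & b e3 q3 = 0]])%type.
Proof. by do !split; apply: (pf_orth PF); rewrite !inE eqxx ?orbT. Qed.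

(** The inner products come from the composition laws on the frame; the squared
length of q3 and k^2 are still tied together here. *)
Lemma pf_gram1 :
  [/\ b p1 p1 = 1, b p1 q2 = 0, b p1 q3 = 0 & b q1 q2 = 0] /\
  b q3 q3 + k ^+ 2 = 1 /\ b p1 p2 + b q3 q3 - k ^+ 2 = 0.
Proof.
case: (PF) => [[[n1 n2 n3] [o12 o23 o31] _ _ _ _] [s1 s2 s3] [m1 m2 m3]].
move=> [m1' m2' m3'] _ _ _.
have [[[e1p1 e1p2 e1p3 [e1q1 e1q2 e1q3]] [e2p1 e2p2 e2p3 [e2q1 e2q2 e2q3]]]
  [e3p1 e3p2 e3p3 [e3q1 e3q2 e3q3]]] := pf_orthE.
have bC := cpC cpb.
have := cp_mul cpb e1 e1; have := cp_mull cpb e1 e1 e2; have := cp_mulr cpb e1 e1 e3.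
have := cp_mulr cpb e3 e2 e1; have := cp_mul cpb e1 e2; have := cp_mul4 cpb e1 e1 e2 e2.
rewrite s1 s2 m1 m2 m3 m2' m3' !(cpE cpb) !(bC p1 e2) !(bC p1 e3) !(bC q1 e2) !(bC q3 e3).
rewrite !(bC e1 e3) ?(n1, n2, n3, o12, o23, o31, bC e2 e1, bC e1 e3).
rewrite ?(e1p1,e1p2,e1p3,e1q1,e1q2,e1q3,e2p1,e2p2,e2p3,e2q1,e2q2,e2q3).
rewrite ?(e3p1,e3p2,e3p3,e3q1,e3q2,e3q3).
by do !split; lra.
Qed.

Lemma pf_derivation1 :
  [/\ d1 p1 = 0, d1 p2 = 2 *: q1 & d1 p3 = - 2 *: q1] /\
  [/\ d1 q1 = p3 - p2, d1 q2 = - q3 & d1 q3 = q2].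
Proof.
case: (PF) => [[_ _ [dd1 _ _] [d11 d12 d13] _ _] [s1 s2 s3] [m1 m2 m3]].
move=> [m1' m2' m3'] _ _ _.
have q1E : q1 = e2 ** e3 - k *: e1 by rewrite m1 addrK.
have q2E : q2 = e3 ** e1 - k *: e2 by rewrite m2 addrK.
have q3E : q3 = e1 ** e2 - k *: e3 by rewrite m3 addrK.
split; split.
- by rewrite -s1 dd1 d11 m0l m0r addr0.
- by rewrite -s2 dd1 d12 m1 m1' addrC addrA addrAC addrK -mulr2n scaler_nat.
- by rewrite -s3 dd1 d13 !mE m1 m1'; apply: (cp_inj cpb) => w; rewrite !(cpE cpb); ring.
- by rewrite q1E linearB linearZ /= dd1 d11 d12 d13 scaler0 subr0 mNr s2 s3.
- by rewrite q2E linearB linearZ /= dd1 d11 d12 d13 m0r addr0 mNl m3' opprB addrAC subrr sub0r.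
- by rewrite q3E linearB linearZ /= dd1 d11 d12 d13 m0l add0r m2' scalerN opprK subrK.
Qed.

End Left.

(** The relation p1 + p2 + p3 = 0, combined with the three rotated copies of
pf_gram1, leaves a single value for every inner product and for k^2. *)
Lemma pf_gram e1 e2 e3 d1 d2 d3 (k : R) p1 p2 p3 q1 q2 q3 :
  @product_frame R A b e1 e2 e3 d1 d2 d3 k p1 p2 p3 q1 q2 q3 ->
  k ^+ 2 = 4^-1 /\
  ([/\ b p1 p1 = 1, b p2 p2 = 1, b p1 p2 = - 2^-1 & b p2 p1 = - 2^-1] *
   [/\ b q1 q1 = 3 / 4, b q2 q2 = 3 / 4 & b q3 q3 = 3 / 4] *
   [/\ b q1 q2 = 0, b q2 q3 = 0 & b q3 q1 = 0] *
   [/\ b q2 q1 = 0, b q3 q2 = 0 & b q1 q3 = 0] *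
   [/\ b p1 q1 = 0, b p1 q2 = 0 & b p1 q3 = 0] *
   [/\ b p2 q1 = 0, b p2 q2 = 0 & b p2 q3 = 0])%type.
Proof.
move=> PF; have PF2 := product_frame_rot PF; have PF3 := product_frame_rot PF2.
have bC := cpC cpb.
have [[a1 a2 a3 a4] [a5 a6]] := pf_gram1 PF.
have [[b1 b2 b3 b4] [b5 b6]] := pf_gram1 PF2.
have [[c1 c2 c3 c4] [c5 c6]] := pf_gram1 PF3.
have /(canRL (addrK _)) := pf_trace PF; rewrite sub0r => p12.
have p3E : p3 = - (p1 + p2) by rewrite p12 opprK.
rewrite p3E !(cpE cpb) ?(bC p2 p1) in b6 c1 c2 c3 c6.
have p11 : b p1 q1 = 0 by lra.
have p22 : b p2 q2 = 0 by lra.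
by do !split; rewrite ?(bC q2 q1) ?(bC q3 q2) ?(bC q1 q3) ?(bC p2 p1); lra.
Qed.

Lemma pf_derivation e1 e2 e3 d1 d2 d3 (k : R) p1 p2 p3 q1 q2 q3 :
  @product_frame R A b e1 e2 e3 d1 d2 d3 k p1 p2 p3 q1 q2 q3 ->
  ([/\ d1 p1 = 0, d1 p2 = 2 *: q1, d1 p3 = - 2 *: q1 &
       [/\ d1 q1 = p3 - p2, d1 q2 = - q3 & d1 q3 = q2]] *
   [/\ d2 p2 = 0, d2 p3 = 2 *: q2, d2 p1 = - 2 *: q2 &
       [/\ d2 q2 = p1 - p3, d2 q3 = - q1 & d2 q1 = q3]] *
   [/\ d3 p3 = 0, d3 p1 = 2 *: q3, d3 p2 = - 2 *: q3 &
       [/\ d3 q3 = p2 - p1, d3 q1 = - q2 & d3 q2 = q1]])%type.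
Proof.
move=> PF; have PF2 := product_frame_rot PF; have PF3 := product_frame_rot PF2.
have [[? ? ?] [? ? ?]] := pf_derivation1 PF.
have [[? ? ?] [? ? ?]] := pf_derivation1 PF2.
by have [[? ? ?] [? ? ?]] := pf_derivation1 PF3.
Qed.

End ProductFrame.

(** * Left multiplication by frame vectors *)

Section LeftTable.
Variables (R : realType) (A : algebra R) (b : A -> A -> R).
Hypothesis cpb : composition_product b.
Local Notation "x ** y" := (alg_mul A x y) (at level 40, left associativity).

(** The product e1 p1 is killed by the rotation d1 and orthogonal to p1, hence it
is a multiple g e1, and g^2 = 1 as both factors are unit vectors. For
y = e2 p1 one has d1 (d1 y) = - y, which leaves the coordinates of y along e2,
e3, q2 and q3; the composition law, applied to y and to
e1 q3 = (g e2 - y) / 2, fixes these. The other products follow by applying the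
rotations to the ones already found. *)
Lemma product_frame_left e1 e2 e3 d1 d2 d3 (k : R) p1 p2 p3 q1 q2 q3 :
  @product_frame R A b e1 e2 e3 d1 d2 d3 k p1 p2 p3 q1 q2 q3 ->
  exists2 g : R, g ^+ 2 = 1 & e1 ** p1 = g *: e1 /\
    [/\ e2 ** p1 = - (g / 2) *: e2 - (2 * k * g) *: q2,
        e3 ** p1 = - (g / 2) *: e3 + (2 * k * g) *: q3,
        e1 ** q3 = (3 / 4 * g) *: e2 + (k * g) *: q2,
        e1 ** q2 = (3 / 4 * g) *: e3 - (k * g) *: q3 &
        e2 ** q2 = (k * g) *: (p1 - p3) /\ e3 ** q3 = (k * g) *: (p2 - p1)].
Proof.
move=> PF; have bC := cpC cpb.
have [k2 [[[[[[p11 p22 p12 p21] [q11 q22 q33]] [q12 q23 q31]] [q21 q32 q13]]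
  [p1q1 p1q2 p1q3]] [p2q1 p2q2 p2q3]]] := pf_gram cpb PF.
have k0 : k != 0.
  by apply: contraPneq k2 => ->; rewrite expr0n /=; clear - cpb; lra.
have [[[e1p1 e1p2 e1p3 [e1q1 e1q2 e1q3]] [e2p1 e2p2 e2p3 [e2q1 e2q2 e2q3]]]
  [e3p1 e3p2 e3p3 [e3q1 e3q2 e3q3]]] := pf_orthE PF.
have [[[d1p1 d1p2 d1p3 [d1q1 d1q2 d1q3]] [d2p2 d2p3 d2p1 [d2q2 d2q3 d2q1]]]
  [d3p3 d3p1 d3p2 [d3q3 d3q1 d3q2]]] := pf_derivation cpb PF.
case: (PF) => [[[n1 n2 n3] [o12 o23 o31] [dd1 dd2 dd3] [d11 d12 d13] [d22 d23 d21] [d33 d31 d32]]].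
move=> [s1 s2 s3] [m1 m2 m3] [m1' m2' m3'] tr _ tot.
have o21 : b e2 e1 = 0 by rewrite bC.
have o32 : b e3 e2 = 0 by rewrite bC.
have o13 : b e1 e3 = 0 by rewrite bC.
have sk1 := derivation_skew cpb dd1.
have p3E : p3 = - p1 - p2.
  by apply/eqP; rewrite -opprD -addr_eq0 addrC tr.
have d1_perp x y : d1 x = 0 -> b x (d1 y) = 0.
  by move=> dx; have := sk1 x y; rewrite dx (cp0l cpb); lra.
pose g := b (e1 ** p1) e1.
(* the kernel of d1 is orthogonal to the image of d1 *)
have L1 : e1 ** p1 = g *: e1.
  apply/eqP; rewrite -subr_eq0; apply/eqP/tot.
  have dL : d1 (e1 ** p1) = 0 by rewrite dd1 d11 d1p1 m0l m0r addr0.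
  have Le3 := d1_perp _ e2 dL; have Le2 := d1_perp _ e3 dL.
  have Lq1 := d1_perp _ p2 dL; have Lp := d1_perp _ q1 dL.
  have Lq3 := d1_perp _ q2 dL; have Lq2 := d1_perp _ q3 dL.
  have Lp1 : b (e1 ** p1) p1 = 0.
    by rewrite -{2}s1 (cp_mull cpb) bC e1p1 mulr0.
  rewrite d12 d13 d1p2 d1q1 d1q2 d1q3 p3E !(cpE cpb) in Le2 Le3 Lq1 Lp Lq2 Lq3.
  move=> y; rewrite !inE.
  do ![case/predU1P => [->|]; [|]] => [||||||||/eqP ->];
    rewrite ?p3E !(cpE cpb) ?(n1,o12,o13,e1p1,e1p2,e1q1,e1q2,e1q3) -?/g;
    clear - cpb Le2 Le3 Lq1 Lp Lq2 Lq3 Lp1; lra.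
have g2 : g ^+ 2 = 1.
  have := cp_mul cpb e1 p1; rewrite L1 !(cpE cpb) n1 p11; clear - cpb; lra.
exists g => //; split=> //.
set y := e2 ** p1.
(* y has weight one for the rotation d1 *)
have y2 : d1 (d1 y) = - y.
  by rewrite /y dd1 d12 d1p1 m0r addr0 dd1 d13 d1p1 m0r addr0 mNl.
have sk2 x : b y x = - b y (d1 (d1 x)).
  have := sk1 (d1 y) x; have := sk1 y (d1 x); rewrite y2 (cpNl cpb); clear - cpb; lra.
have ye1 := sk2 e1; have yp1 := sk2 p1; have yq1 := sk2 q1; have yp := sk2 p2.
rewrite d11 d1p1 d1q1 d1p2 !linear0 !linearD !linearN /= !linearZ /= in ye1 yp1 yq1 yp.
rewrite ?d1p2 ?d1p3 ?d1q1 p3E !(cpE cpb) in ye1 yp1 yq1 yp.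
have y21 := cp_mull cpb e2 p1 e1; rewrite -/y m3' !(cpE cpb) (bC p1 e1) e1p1 in y21.
have e1q3E : e1 ** q3 = 2^-1 *: (g *: e2 - y).
  have := congr1 d3 L1; rewrite dd3 d31 d3p1 -/y [d3 (g *: _)]linearZ /= d31 mZr => <-.
  by rewrite addrAC subrr add0r scalerA mulVf ?scale1r // pnatr_eq0.
have z12 := cp_mull cpb e1 q3 e2; have z13 := cp_mull cpb e1 q3 e3.
have z33 := cp_mul cpb e1 q3; have yy := cp_mul cpb e2 p1.
rewrite e1q3E m3 !(cpE cpb) n1 ?(bC q3 e2) ?e2q3 o23 -/y in z12.
rewrite e1q3E m2' !(cpE cpb) n1 n2 ?(bC q3 e3) ?e3q3 ?e2q2 ?e2q3 -/y in z13.
rewrite e1q3E !(cpE cpb) n1 n2 q33 (bC e2 y) -/y in z33.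
rewrite -/y n2 p11 in yy.
have ye3 : k * b y e3 = 0 by clear - cpb z12 y21; lra.
have {}ye3 : b y e3 = 0.
  by apply/eqP; move/eqP: ye3; rewrite mulf_eq0 (negPf k0).
have ye2 : b y e2 = - (g / 2).
  have : g * (g + 2 * b y e2) = 0 by move: g2 yy z33; rewrite expr2 => h1 h2 h3; clear - cpb h1 h2 h3; lra.
  move=> /eqP; rewrite mulf_eq0 => /orP[/eqP g0|/eqP]; last by clear - cpb; lra.
  by move: g2; rewrite g0 expr0n /=; clear - cpb; lra.
rewrite ye2 ye3 in z12 z13 y21.
have L2 : y = - (g / 2) *: e2 - (2 * k * g) *: q2.
  apply/eqP; rewrite -subr_eq0; apply/eqP/tot => x; rewrite !inE.
  do ![case/predU1P => [->|]; [|]] => [||||||||/eqP ->];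
    rewrite ?p3E !(cpE cpb) ?(bC q2 e1) ?(bC q2 e2) ?(bC q2 e3) ?(bC q2 p1) ?(bC q2 p2);
    rewrite ?(n1,n2,n3,o12,o13,o23,o21,o31,o32,e2p1,e2p2,e2q1,e2q2,e2q3,q21,q22,q23);
    rewrite ?(p1q2,p2q2,e1q2,e3q2) ?ye2 ?ye3;
    clear - cpb ye1 yp1 yq1 yp z12 z13 y21; lra.
have d1y : e3 ** p1 = d1 y by rewrite /y dd1 d12 d1p1 m0r addr0.
have L3 : e3 ** p1 = - (g / 2) *: e3 + (2 * k * g) *: q3.
  rewrite d1y L2 linearB !linearZ /= d12 d1q2.
  by apply: (cp_inj cpb) => w; rewrite !(cpE cpb); ring.
have h1 : d2 e1 ** p1 + e1 ** d2 p1 = g *: d2 e1 by rewrite -dd2 L1 linearZ.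
have h2 := congr1 d2 L2; have h3 := congr1 d3 L3.
rewrite d21 d2p1 !mE L3 in h1.
rewrite {1}/y dd2 d22 m0l add0r d2p1 mZr linearB /= !linearZ /= linearN /= in h2.
rewrite d22 d2q2 in h2.
rewrite dd3 d33 m0l add0r d3p1 mZr linearD /= !linearZ /= d33 d3q3 in h3.
split=> //.
- by rewrite e1q3E L2; apply: (cp_inj cpb) => w; rewrite !(cpE cpb); field.
- have -> : e1 ** q2 = - 2^-1 *: (- 2 *: (e1 ** q2)).
    by rewrite scalerA mulrNN mulVf ?scale1r ?pnatr_eq0.
  have -> : - 2 *: (e1 ** q2) = g *: - e3 + (- (g / 2) *: e3 + (2 * k * g) *: q3).
    by rewrite -h1 addrAC addNr add0r.
  by apply: (cp_inj cpb) => w; rewrite !(cpE cpb); field.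
- split.
  - have -> : e2 ** q2 = - 2^-1 *: (- 2 *: (e2 ** q2)).
      by rewrite scalerA mulrNN mulVf ?scale1r ?pnatr_eq0.
    by rewrite h2; apply: (cp_inj cpb) => w; rewrite !(cpE cpb); field.
  - have -> : e3 ** q3 = 2^-1 *: (2 *: (e3 ** q3)).
      by rewrite scalerA mulVf ?scale1r ?pnatr_eq0.
    by rewrite h3; apply: (cp_inj cpb) => w; rewrite !(cpE cpb); field.
Qed.

End LeftTable.

(** * The multiplication table up to two signs *)

(** The products of e1 with the symmetric part, in terms of the sign g. Rotating
the indices cyclically gives the rows of e2 and e3. *)
Definition left_row (R : realType) (V : lmodType R) (m : V -> V -> V) (k g : R)
    (e1 e2 e3 p1 p2 p3 q1 q2 q3 : V) : Prop :=
  [/\ m e1 p1 = g *: e1,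
      m e1 p2 = - (g / 2) *: e1 + (2 * k * g) *: q1,
      m e1 p3 = - (g / 2) *: e1 - (2 * k * g) *: q1,
      m e1 q1 = (k * g) *: (p3 - p2)
    & m e1 q2 = (3 / 4 * g) *: e3 - (k * g) *: q3 /\
      m e1 q3 = (3 / 4 * g) *: e2 + (k * g) *: q2].

(** Each e_i comes with a sign of its own; multiplying e_j by
p1 + p2 + p3 = 0 shows that the sign of each is the mean of the other two. *)
Lemma pf_left_rows (R : realType) (A : algebra R) (b : A -> A -> R)
    (cpb : composition_product b) e1 e2 e3 d1 d2 d3 (k : R) p1 p2 p3 q1 q2 q3 :
  @product_frame R A b e1 e2 e3 d1 d2 d3 k p1 p2 p3 q1 q2 q3 ->
  exists2 g : R, g ^+ 2 = 1 &
    [/\ left_row (alg_mul A) k g e1 e2 e3 p1 p2 p3 q1 q2 q3,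
        left_row (alg_mul A) k g e2 e3 e1 p2 p3 p1 q2 q3 q1 &
        left_row (alg_mul A) k g e3 e1 e2 p3 p1 p2 q3 q1 q2].
Proof.
move=> PF; have PF2 := product_frame_rot PF; have PF3 := product_frame_rot PF2.
have [g1 g12 [r11 [r21 r31 s13 s12 [s22 s33]]]] := product_frame_left cpb PF.
have [g2 g22 [r22 [r32 r12 s21 s23 [s33' s11]]]] := product_frame_left cpb PF2.
have [g3 g32 [r33 [r13 r23 s32 s31 [s11' s22']]]] := product_frame_left cpb PF3.
case: (PF) => [[[n1 n2 n3] _ _ _ _ _] _ _ _ tr orth _].
have orthE e q : e \in [:: e1; e2; e3] -> q \in [:: p1; p2; p3; q1; q2; q3] ->
  b q e = 0 by move=> ein qin; rewrite (cpC cpb) orth.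
have t1 : alg_mul A e1 (p1 + p2 + p3) = 0 by rewrite tr m0r.
have t2 : alg_mul A e2 (p1 + p2 + p3) = 0 by rewrite tr m0r.
have {t1}g1E : g1 = (g2 + g3) / 2.
  have := congr1 (b^~ e1) t1; rewrite !mDr r11 r12 r13 !(cpE cpb) n1.
  by rewrite !orthE ?inE ?eqxx ?orbT //; clear - cpb; lra.
have {t2}g2E : g2 = (g3 + g1) / 2.
  have := congr1 (b^~ e2) t2; rewrite !mDr r21 r22 r23 !(cpE cpb) n2.
  by rewrite !orthE ?inE ?eqxx ?orbT //; clear - cpb; lra.
have g21 : g2 = g1 by clear - cpb g1E g2E; lra.
have g31 : g3 = g1 by clear - cpb g1E g2E; lra.
rewrite g21 g31 in r22 r32 r12 s21 s23 s33' s11 r33 r13 r23 s32 s31 s11' s22'.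
by exists g1; rewrite /left_row.
Qed.

(** The opposite algebra turns the left rows into right rows. Exchanging the
factors changes the sign of k. *)
Section Opposite.
Variables (R : realType) (A : algebra R).

Definition opposite_mul (x y : A) : A := alg_mul A y x.

Lemma opposite_mul_bilinear : bilinear_for *:%R *:%R opposite_mul.
Proof. by split=> u a x y; rewrite /opposite_mul ?linearPl ?linearPr. Qed.

HB.instance Definition _ :=
  bilinear_isBilinear.Build R A A A *:%R *:%R opposite_mul
    opposite_mul_bilinear.

Definition opposite : algebra R :=
  Algebra (opposite_mul : {bilinear A -> A -> A}).

Lemma opposite_derivation (d : 'End(A)) :
  derivation d -> derivation (d : 'End(opposite)).
Proof. by move=> dd x y; rewrite /= /opposite_mul dd addrC. Qed.

Lemma opposite_composition (b : A -> A -> R) :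
  composition_product b -> composition_product (b : opposite -> opposite -> R).
Proof. by case=> sy li po mu; split=> // x y; rewrite mu mulrC. Qed.

Lemma opposite_frame (b : A -> A -> R) (e1 e2 e3 : A) (d1 d2 d3 : 'End(A))
    (k : R) (p1 p2 p3 q1 q2 q3 : A) :
  product_frame b e1 e2 e3 d1 d2 d3 k p1 p2 p3 q1 q2 q3 ->
  @product_frame R opposite b e1 e2 e3 d1 d2 d3 (- k) p1 p2 p3 q1 q2 q3.
Proof.
case=> [[n o [dd1 dd2 dd3] a1 a2 a3] sq [m1 m2 m3] [m1' m2' m3'] tr orth tot].
split=> //.
- by split=> //; split; apply: opposite_derivation.
- by rewrite /= /opposite_mul m1' m2' m3' !scaleNr.
- by rewrite /= /opposite_mul m1 m2 m3 !scaleNr !opprK.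
Qed.

End Opposite.

(** The constant k, equal to 1/2 or -1/2, is normalized to 1/2. *)
Record multiplication_table (R : realType) (A : algebra R) (b : A -> A -> R)
    (g g' : R) (e1 e2 e3 : A) (d1 d2 d3 : 'End(A)) (p1 p2 p3 q1 q2 q3 : A) :
    Prop := MultiplicationTable {
  mt_frame : product_frame b e1 e2 e3 d1 d2 d3 2^-1 p1 p2 p3 q1 q2 q3;
  mt_left : [/\ left_row (alg_mul A) 2^-1 g e1 e2 e3 p1 p2 p3 q1 q2 q3,
    left_row (alg_mul A) 2^-1 g e2 e3 e1 p2 p3 p1 q2 q3 q1 &
    left_row (alg_mul A) 2^-1 g e3 e1 e2 p3 p1 p2 q3 q1 q2];
  mt_right : [/\
    left_row (@opposite_mul R A) (- 2^-1) g' e1 e2 e3 p1 p2 p3 q1 q2 q3,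
    left_row (@opposite_mul R A) (- 2^-1) g' e2 e3 e1 p2 p3 p1 q2 q3 q1 &
    left_row (@opposite_mul R A) (- 2^-1) g' e3 e1 e2 p3 p1 p2 q3 q1 q2]
}.

Lemma left_row_opp (R : realType) (A : algebra R) (k g : R)
    (e1 e2 e3 p1 p2 p3 q1 q2 q3 : A) :
  left_row (alg_mul A) k g e1 e2 e3 p1 p2 p3 q1 q2 q3 ->
  left_row (alg_mul A) (- k) g (- e1) (- e2) (- e3) p1 p2 p3 q1 q2 q3.
Proof.
case=> h1 h2 h3 h4 [h5 h6]; rewrite /left_row !mNl h1 h2 h3 h4 h5 h6.
rewrite !(mulrN, mulNr) !(scalerN, scaleNr) !opprD !opprK.
by split.
Qed.

(** Replacing the frame by its negative keeps the products of frame vectors and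
changes the sign of k. *)
Lemma product_frame_table (R : realType) (A : algebra R) (b : A -> A -> R)
    (cpb : composition_product b) e1 e2 e3 d1 d2 d3 (k : R) p1 p2 p3 q1 q2 q3 :
  @product_frame R A b e1 e2 e3 d1 d2 d3 k p1 p2 p3 q1 q2 q3 ->
  exists g g' : R, [/\ g ^+ 2 = 1, g' ^+ 2 = 1 &
    multiplication_table b g g' e1 e2 e3 d1 d2 d3 p1 p2 p3 q1 q2 q3 \/
    multiplication_table b g g' (- e1) (- e2) (- e3) d1 d2 d3 p1 p2 p3 q1 q2 q3].
Proof.
move=> PF; have PFo := opposite_frame PF.
have [k2 _] := pf_gram cpb PF.
have [g g2 [l1 l2 l3]] := pf_left_rows cpb PF.
have [g' g'2 [r1 r2 r3]] := pf_left_rows (opposite_composition cpb) PFo.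
exists g, g'; split=> //.
have : (k - 2^-1) * (k + 2^-1) = 0.
  by rewrite -subr_sqr k2; field.
move=> /eqP; rewrite mulf_eq0 => /orP[|].
  by rewrite subr_eq0 => /eqP kE; left; rewrite kE in PF l1 l2 l3 r1 r2 r3.
rewrite addr_eq0 => /eqP kE; right.
have {}kE : 2^-1 = - k by rewrite kE opprK.
split; rewrite kE; first exact: product_frame_opp.
  by split; apply: left_row_opp.
by split; apply: (@left_row_opp R (opposite A)).
Qed.

Section D35.
Variables (R : realType) (A : algebra R) (b : A -> A -> R).
Hypothesis cpb : composition_product b.
Variables (U V : {vspace A}).
Hypotheses (dimU : \dim U = 3%N) (dimV : \dim V = 5%N).
Hypotheses (irrU : der_irreducible U) (irrV : der_irreducible V).
Hypothesis UV : (U + V)%VS = fullv.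

(** It remains to see that the vectors of a product frame span: the vectors of V
orthogonal to all products of elements of U form a submodule of V that does
not contain e1 e1. *)
Lemma D35_table : exists g g' e1 e2 e3 d1 d2 d3 p1 p2 p3 q1 q2 q3,
  [/\ g ^+ 2 = 1, g' ^+ 2 = 1, [/\ e1 \in U, e2 \in U & e3 \in U] &
      @multiplication_table R A b g g' e1 e2 e3 d1 d2 d3 p1 p2 p3 q1 q2 q3].
Proof.
have [e1 [e2 [e3 [d1 [d2 [d3 [e1U e2U e3U F]]]]]]] :=
  so3_frame_exists cpb dimU irrU.
pose k := b (alg_mul A e1 e2) e3.
pose q1 := alg_mul A e2 e3 - k *: e1; pose q2 := alg_mul A e3 e1 - k *: e2.
pose q3 := alg_mul A e1 e2 - k *: e3.
suff PF : product_frame b e1 e2 e3 d1 d2 d3 k (alg_mul A e1 e1) (alg_mul A e2 e2)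
  (alg_mul A e3 e3) q1 q2 q3.
  have [g [g' [g2 g'2 [T|T]]]] := product_frame_table cpb PF.
    by exists g, g', e1, e2, e3, d1, d2, d3; do 6!eexists; split; [| | |exact: T].
  exists g, g', (- e1), (- e2), (- e3), d1, d2, d3.
  by do 6!eexists; split; [| | |exact: T]; rewrite ?memvN.
have [a1 a2 a3] := frame_antisymmetric cpb dimU dimV irrU irrV UV e1U e2U e3U F.
pose S := [:: e1; e2; e3; alg_mul A e1 e1; alg_mul A e2 e2; alg_mul A e3 e3; q1; q2; q3].
have tr := frame_traceless cpb dimU dimV irrU irrV UV e1U e2U e3U F.
have [t111 [t122 t212 t221 t133 [t313 t331]]] := frame_trilinear_odd cpb F.
have [t222 [t233 t323 t332 t211 [t121 t112]]] :=
  frame_trilinear_odd cpb (so3_frame_rot F).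
have [t333 [t311 t131 t113 t322 [t232 t223]]] :=
  frame_trilinear_odd cpb (so3_frame_rot (so3_frame_rot F)).
have [t231 t312 t213 t132 t321] := frame_trilinear_even cpb F.
have bC := cpC cpb.
have orth x y : x \in [:: e1; e2; e3] ->
    y \in [:: alg_mul A e1 e1; alg_mul A e2 e2; alg_mul A e3 e3; q1; q2; q3] ->
    b x y = 0.
  case: (F) => [[n1 n2 n3] [o12 o23 o31] _ _ _ _] xin yin; rewrite bC.
  move: xin yin; rewrite !inE.
  case/or3P => /eqP ->; do ![case/predU1P => [->|]; [|]] => [|||||/eqP ->];
    rewrite /q1 /q2 /q3 ?(cpE cpb)
      ?(t111,t122,t212,t221,t133,t313,t331,t222,t233,t323,t332,t211,t121)
      ?(t112,t333,t311,t131,t113,t322,t232,t223,t231,t312) // -/k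
      ?(n1,n2,n3,o12,o23,o31,bC e2 e1,bC e3 e2,bC e1 e3); ring.
split=> //.
- by rewrite /q1 /q2 /q3 !subrK.
- split.
  + by rewrite -[LHS]addr0 -a1 /q1; apply: (cp_inj cpb) => w; rewrite !(cpE cpb) -/k; ring.
  + by rewrite -[LHS]addr0 -a2 /q2; apply: (cp_inj cpb) => w; rewrite !(cpE cpb) -/k; ring.
  + by rewrite -[LHS]addr0 -a3 /q3; apply: (cp_inj cpb) => w; rewrite !(cpE cpb) -/k; ring.
  by move=> x xin y; apply: orth.
move=> x xS.
have xV : x \in V.
  apply: (memV_frame cpb dimU dimV irrU irrV UV e1U e2U e3U F);
  by apply: xS; rewrite !inE eqxx ?orbT.
have [K KP] : exists K : {vspace A}, forall y, y \in K <->
    y \in V /\ forall u w, u \in U -> w \in U -> b y (alg_mul A u w) = 0.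
  apply: vspace_of_pred => [|a y z [yV by0] [zV bz0]].
    by split=> [|u w _ _]; rewrite ?mem0v ?(cp0l cpb).
  split=> [|u w uU wU]; first by rewrite memvD ?memvZ.
  by rewrite (cpDl cpb) (cpZl cpb) by0 // bz0 // mulr0 addr0.
have KV : (K <= V)%VS by apply/subvP => y /KP[].
have span y := frame_span cpb dimU e1U e2U e3U F (x := y).
have xK : x \in K.
  apply/KP; split=> // u w /span -> /span ->.
  have xE y : y \in S -> b x y = 0 by exact: xS.
  have h1 : alg_mul A e2 e3 = q1 + k *: e1 by rewrite subrK.
  have h2 : alg_mul A e3 e1 = q2 + k *: e2 by rewrite subrK.
  have h3 : alg_mul A e1 e2 = q3 + k *: e3 by rewrite subrK.
  have h4 : alg_mul A e3 e2 = q1 - k *: e1.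
    by rewrite -[LHS]addr0 -a1 /q1; apply: (cp_inj cpb) => v; rewrite !(cpE cpb) -/k; ring.
  have h5 : alg_mul A e1 e3 = q2 - k *: e2.
    by rewrite -[LHS]addr0 -a2 /q2; apply: (cp_inj cpb) => v; rewrite !(cpE cpb) -/k; ring.
  have h6 : alg_mul A e2 e1 = q3 - k *: e3.
    by rewrite -[LHS]addr0 -a3 /q3; apply: (cp_inj cpb) => v; rewrite !(cpE cpb) -/k; ring.
  clear a1 a2 a3 orth xS; clearbody q1 q2 q3; rewrite !mE h1 h2 h3 h4 h5 h6 !(cpE cpb) !xE ?inE ?eqxx ?orbT //; ring.
have [K0|KE] : K = 0%VS \/ K = V.
- case: irrV => _ _; apply=> // d dd.
  apply/subvP => _ /memv_imgP[y /KP[yV by0] ->]; apply/KP.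
  split=> [|u w uU wU]; first exact: irreducible_stable.
  rewrite (derivation_skew cpb dd) dd (cpDr cpb).
  by rewrite !by0 ?addr0 ?oppr0 ?(irreducible_stable irrU).
- by move: xK; rewrite K0 memv0 => /eqP.
- have eeV : alg_mul A e1 e1 \in V.
    exact: (memV_frame cpb dimU dimV irrU irrV UV e1U e2U e3U F).
  rewrite -KE in eeV; have /KP[_ /(_ e1 e1 e1U e1U)] := eeV.
  case: (F) => [[n1 _ _] _ _ _ _ _].
  by rewrite (cp_mul cpb) n1 mulr1 => /eqP; rewrite oner_eq0.
Qed.

End D35.

(** * Rational model algebras *)

Section Model.
Variable R : realType.
Local Notation O := (octonion R).

(** For a Cayley triple (u, v, z), these are to be coordinates along
1, s u, v, (s u) v, z, (s u) z, v z, ((s u) v) z with s = sqrt 3, a choice that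
makes tau and all structure constants rational. *)
Definition oct (x0 x1 x2 x3 x4 x5 x6 x7 : R) : O :=
  (((x0 : R^o, x1 : R^o), (x2 : R^o, x3 : R^o)),
   ((x4 : R^o, x5 : R^o), (x6 : R^o, x7 : R^o))).

Lemma octP (x : O) : exists x0 x1 x2 x3 x4 x5 x6 x7,
  x = oct x0 x1 x2 x3 x4 x5 x6 x7.
Proof.
case: x => [[[x0 x1] [x2 x3]] [[x4 x5] [x6 x7]]].
by exists x0, x1, x2, x3, x4, x5, x6, x7.
Qed.

Definition qmul3 (x y : (R^o * R^o)%type) : (R^o * R^o)%type :=
  (x.1 * y.1 - 3 * (x.2 * y.2) : R^o, x.1 * y.2 + x.2 * y.1 : R^o).

(** The octonion product in such coordinates: the same doubling process, started
from the complex numbers written in the basis 1, sqrt 3 i. *)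
Definition omul3 (x y : O) : O :=
  let c1 := cd_conj (id : R^o -> R^o) in
  cd_mul (cd_mul qmul3 c1) (cd_conj c1) x y.

(** Multiplication by (- 1 - t sqrt 3 i) / 2 for the parameter t, a primitive cube
root of unity when t is 1 or -1. It rotates the two planes that tau moves. *)
Definition rot3 (t : R) (x : (R^o * R^o)%type) : (R^o * R^o)%type :=
  (- x.1 / 2 + t * (3 / 2) * x.2 : R^o, - (t * x.1 + x.2) / 2 : R^o).

Definition tau3 (t : R) (x : O) : O :=
  (x.1, (rot3 t x.2.1, rot3 t x.2.2)).

(** For g = -1 this is the reflection that negates v, z and v z. *)
Definition sig3 (g : R) (x : O) : O :=
  ((x.1.1, (g * x.1.2.1 : R^o, x.1.2.2)),
   ((g * x.2.1.1 : R^o, x.2.1.2), (g * x.2.2.1 : R^o, x.2.2.2))).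

(** The sign g is twisted into the right factor, which governs left
multiplications. *)
Definition model_mul (g g' : R) (x y : O) : O :=
  omul3 (oconj_fun (tau3 1 (sig3 g' x))) (oconj_fun (tau3 (-1) (sig3 g y))).

Lemma oct_linear (a : R) x0 x1 x2 x3 x4 x5 x6 x7 y0 y1 y2 y3 y4 y5 y6 y7 :
  a *: oct x0 x1 x2 x3 x4 x5 x6 x7 + oct y0 y1 y2 y3 y4 y5 y6 y7 =
  oct (a * x0 + y0) (a * x1 + y1) (a * x2 + y2) (a * x3 + y3)
      (a * x4 + y4) (a * x5 + y5) (a * x6 + y6) (a * x7 + y7).
Proof. by []. Qed.

Lemma oct_eq x0 x1 x2 x3 x4 x5 x6 x7 y0 y1 y2 y3 y4 y5 y6 y7 :
  x0 = y0 -> x1 = y1 -> x2 = y2 -> x3 = y3 ->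
  x4 = y4 -> x5 = y5 -> x6 = y6 -> x7 = y7 ->
  oct x0 x1 x2 x3 x4 x5 x6 x7 = oct y0 y1 y2 y3 y4 y5 y6 y7.
Proof. by do 8!move=> ->. Qed.

Lemma oct_inj x0 x1 x2 x3 x4 x5 x6 x7 y0 y1 y2 y3 y4 y5 y6 y7 :
  oct x0 x1 x2 x3 x4 x5 x6 x7 = oct y0 y1 y2 y3 y4 y5 y6 y7 ->
  [/\ x0 = y0, x1 = y1, x2 = y2 & x3 = y3] /\
  [/\ x4 = y4, x5 = y5, x6 = y6 & x7 = y7].
Proof. by case=> -> -> -> -> -> -> -> ->. Qed.

Lemma qmul3_bilinear : bilinear_for *:%R *:%R qmul3.
Proof.
split=> -[u1 u2] a [x1 x2] [y1 y2]; rewrite /qmul3 /=;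
  congr pair; rewrite /= /GRing.scale /=; ring.
Qed.

Lemma omul3_bilinear : bilinear_for *:%R *:%R omul3.
Proof.
have lid : linear (id : R^o -> R^o) by [].
apply: cd_mul_bilinear; first by do 2!apply: cd_conj_linear.
by apply: cd_mul_bilinear; [exact: cd_conj_linear | exact: qmul3_bilinear].
Qed.

Lemma rot3_linear s : linear (rot3 s).
Proof.
by move=> a [x1 x2] [y1 y2]; rewrite /rot3 /=; congr pair; rewrite /= /GRing.scale /=; field.
Qed.

Lemma tau3_linear s : linear (tau3 s).
Proof. by move=> a x y; rewrite /tau3 /= !rot3_linear. Qed.

Lemma sig3E g x0 x1 x2 x3 x4 x5 x6 x7 :
  sig3 g (oct x0 x1 x2 x3 x4 x5 x6 x7) =
  oct x0 x1 (g * x2) x3 (g * x4) x5 (g * x6) x7.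
Proof. by []. Qed.

Lemma sig3_linear g : linear (sig3 g).
Proof.
move=> a x y.
have [x0 [x1 [x2 [x3 [x4 [x5 [x6 [x7 ->]]]]]]]] := octP x.
have [y0 [y1 [y2 [y3 [y4 [y5 [y6 [y7 ->]]]]]]]] := octP y.
by rewrite oct_linear !sig3E oct_linear; apply: oct_eq; ring.
Qed.

Lemma model_mul_bilinear g g' : bilinear_for *:%R *:%R (model_mul g g').
Proof.
have [ml mr] := omul3_bilinear.
split=> u a x y; rewrite /model_mul.
  by rewrite sig3_linear tau3_linear oconj_fun_linear ml.
by rewrite sig3_linear tau3_linear oconj_fun_linear mr.
Qed.

HB.instance Definition _ g g' :=
  bilinear_isBilinear.Build R O O O *:%R *:%R (model_mul g g')
    (model_mul_bilinear g g').

Definition model (g g' : R) : algebra R :=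
  Algebra (model_mul g g' : {bilinear O -> O -> O}).

Lemma model_mulE g g' x0 x1 x2 x3 x4 x5 x6 x7 y0 y1 y2 y3 y4 y5 y6 y7 :
  model_mul g g' (oct x0 x1 x2 x3 x4 x5 x6 x7) (oct y0 y1 y2 y3 y4 y5 y6 y7) =
  oct
    (x0 * y0 - g' * g * (x2 * y2) + 3 * (- (x1 * y1) - x3 * y3) + 1 / 2 * (g' * g *
      (x4 * y4) + g' * g * (x6 * y6)) + 3 / 2 * (- (g' * (x4 * y5)) + g * (x5 * y4) +
      x5 * y5 - g' * (x6 * y7) + g * (x7 * y6) + x7 * y7))
    (- (x0 * y1) - x1 * y0 + g' * (x2 * y3) - g * (x3 * y2) + 1 / 2 * (- (g' * g * (x4
      * y4)) - g' * (x4 * y5) + g * (x5 * y4) + g' * g * (x6 * y6) + g' * (x6 * y7) -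
      g * (x7 * y6)) + 3 / 2 * (- (x5 * y5) + x7 * y7))
    (- (g * (x0 * y2)) - g' * (x2 * y0) + 3 * (- (x1 * y3) + x3 * y1) + 1 / 2 * (- (g'
      * g * (x4 * y6)) + g' * g * (x6 * y4)) + 3 / 2 * (g' * (x4 * y7) - g * (x5 * y6)
      - x5 * y7 - g' * (x6 * y5) + g * (x7 * y4) + x7 * y5))
    (- (x0 * y3) + g * (x1 * y2) - g' * (x2 * y1) - x3 * y0 + 1 / 2 * (- (g' * g * (x4
      * y6)) - g' * (x4 * y7) + g * (x5 * y6) - g' * g * (x6 * y4) - g' * (x6 * y5) +
      g * (x7 * y4)) + 3 / 2 * (- (x5 * y7) - x7 * y5))
    (1 / 2 * (g * (x0 * y4) + g' * g * (x2 * y6) + g' * (x4 * y0) - g' * g * (x6 *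
      y2)) + 3 / 2 * (x0 * y5 - g * (x1 * y4) + x1 * y5 + g' * (x2 * y7) - g * (x3 *
      y6) + x3 * y7 - g' * (x4 * y1) - x5 * y0 - x5 * y1 - g' * (x6 * y3) + g * (x7 *
      y2) - x7 * y3))
    (1 / 2 * (- (g * (x0 * y4)) + x0 * y5 - g * (x1 * y4) - g' * g * (x2 * y6) + g' *
      (x2 * y7) - g * (x3 * y6) + g' * (x4 * y0) + g' * (x4 * y1) + x5 * y0 - g' * g *
      (x6 * y2) + g' * (x6 * y3) - g * (x7 * y2)) + 3 / 2 * (- (x1 * y5) - x3 * y7 -
      x5 * y1 - x7 * y3))
    (1 / 2 * (g * (x0 * y6) - g' * g * (x2 * y4) + g' * g * (x4 * y2) + g' * (x6 *
      y0)) + 3 / 2 * (x0 * y7 + g * (x1 * y6) - x1 * y7 - g' * (x2 * y5) - g * (x3 *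
      y4) + x3 * y5 - g' * (x4 * y3) - g * (x5 * y2) - x5 * y3 + g' * (x6 * y1) - x7 *
      y0 + x7 * y1))
    (1 / 2 * (- (g * (x0 * y6)) + x0 * y7 + g * (x1 * y6) + g' * g * (x2 * y4) - g' *
      (x2 * y5) - g * (x3 * y4) + g' * g * (x4 * y2) + g' * (x4 * y3) + g * (x5 * y2)
      + g' * (x6 * y0) - g' * (x6 * y1) + x7 * y0) + 3 / 2 * (x1 * y7 - x3 * y5 - x5 *
      y3 + x7 * y1)).
Proof.
rewrite /model_mul /omul3 /cd_mul /=.
by apply: oct_eq; rewrite /=; field.
Qed.

Definition form3 (x y : O) : R :=
  x.1.1.1 * y.1.1.1 + 3 * (x.1.1.2 * y.1.1.2)
  + x.1.2.1 * y.1.2.1 + 3 * (x.1.2.2 * y.1.2.2)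
  + x.2.1.1 * y.2.1.1 + 3 * (x.2.1.2 * y.2.1.2)
  + x.2.2.1 * y.2.2.1 + 3 * (x.2.2.2 * y.2.2.2).

Lemma form3_omul3 x y : form3 (omul3 x y) (omul3 x y) = form3 x x * form3 y y.
Proof.
have [x0 [x1 [x2 [x3 [x4 [x5 [x6 [x7 ->]]]]]]]] := octP x.
have [y0 [y1 [y2 [y3 [y4 [y5 [y6 [y7 ->]]]]]]]] := octP y.
rewrite /omul3 /cd_mul /form3 /=; ring.
Qed.

Lemma form3_oconj x : form3 (oconj_fun x) (oconj_fun x) = form3 x x.
Proof. by rewrite /form3 /=; ring. Qed.

Lemma form3_tau3 s x : s ^+ 2 = 1 -> form3 (tau3 s x) (tau3 s x) = form3 x x.
Proof.
by move=> /eqP; rewrite sqrf_eq1 => /orP[] /eqP ->; rewrite /form3 /=; field.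
Qed.

Lemma form3_sig3 g x : g ^+ 2 = 1 -> form3 (sig3 g x) (sig3 g x) = form3 x x.
Proof.
move=> /eqP; rewrite sqrf_eq1 => /orP[] /eqP ->; rewrite /form3 /=; ring.
Qed.

Lemma model_composition g g' : g ^+ 2 = 1 -> g' ^+ 2 = 1 ->
  composition_product (form3 : model g g' -> model g g' -> R).
Proof.
move=> g2 g'2; split.
- by move=> x y; rewrite /form3; ring.
- by move=> a x y z; rewrite /form3 /= /GRing.scale /=; ring.
- move=> x; have [x0 [x1 [x2 [x3 [x4 [x5 [x6 [x7 ->]]]]]]]] := octP x.
  apply: contraNT; rewrite -leNgt /form3 /= => le0.
  have sq (t : R) : 0 <= t * t by rewrite -expr2 sqr_ge0.
  have z (t : R) : t * t <= 0 -> t = 0.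
    by move=> t0; apply/eqP; rewrite -sqrf_eq0 expr2 eq_le t0 sq.
  have := sq x0; have := sq x1; have := sq x2; have := sq x3.
  have := sq x4; have := sq x5; have := sq x6; have := sq x7.
  move=> h7 h6 h5 h4 h3 h2 h1 h0; apply/eqP.
  by apply: oct_eq; apply: z; lra.
- move=> x y; rewrite /= /model_mul form3_omul3 !form3_oconj.
  by rewrite !form3_tau3 ?sqrrN ?expr1n // !form3_sig3.
Qed.

End Model.

(** * The multiplication table determines the algebra *)

Section TableModel.
Variables (R : realType) (A : algebra R) (b : A -> A -> R).
Hypothesis cpb : composition_product b.
Variables (g g' : R) (e1 e2 e3 : A) (d1 d2 d3 : 'End(A)).
Variables (p1 p2 p3 q1 q2 q3 : A).
Hypotheses (g2 : g ^+ 2 = 1) (g'2 : g' ^+ 2 = 1).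
Hypothesis T :
  multiplication_table b g g' e1 e2 e3 d1 d2 d3 p1 p2 p3 q1 q2 q3.
Local Notation "x ** y" := (alg_mul A x y) (at level 40, left associativity).
Local Notation M := (model g g').

(** Sends v, z, v z to a frame of U, up to sign, and the other coordinates to the
symmetric part. It is locked because unfolding it on coordinates is costly for
conversion. *)
Definition table_map : octonion R -> A := locked (fun x =>
  (g * g') *: (x.1.2.1 *: e1 + x.2.1.1 *: e2 - x.2.2.1 *: e3
    - x.1.1.1 *: p1 + x.1.1.2 *: (p3 - p2)
    + (2 * x.2.2.2) *: q3 + (2 * x.2.1.2) *: q2 + (2 * x.1.2.2) *: q1)).

Lemma table_mapE x : table_map x =
  (g * g') *: (x.1.2.1 *: e1 + x.2.1.1 *: e2 - x.2.2.1 *: e3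
    - x.1.1.1 *: p1 + x.1.1.2 *: (p3 - p2)
    + (2 * x.2.2.2) *: q3 + (2 * x.2.1.2) *: q2 + (2 * x.1.2.2) *: q1).
Proof. by rewrite /table_map -lock. Qed.

Lemma table_map_linear : linear table_map.
Proof.
move=> a x y; apply: (cp_inj cpb) => w; rewrite !table_mapE /= /GRing.scale /=.
rewrite !(cpE cpb); ring.
Qed.

(** lin_part and sym_part project to the spans of v, z, v z and of its orthogonal
complement, which are to become the three- and five-dimensional summands. *)
Definition lin_part (x : octonion R) : octonion R :=
  oct 0 0 x.1.2.1 0 x.2.1.1 0 x.2.2.1 0.
Definition sym_part (x : octonion R) : octonion R :=
  oct x.1.1.1 x.1.1.2 0 x.1.2.2 0 x.2.1.2 0 x.2.2.2.

Lemma parts x : x = lin_part x + sym_part x.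
Proof.
have [x0 [x1 [x2 [x3 [x4 [x5 [x6 [x7 ->]]]]]]]] := octP x.
by rewrite -[X in X + _]scale1r oct_linear; apply: oct_eq => /=; ring.
Qed.

Lemma table_isometry x y : b (table_map x) (table_map y) = form3 x y.
Proof.
case: T => PF _ _; have p3E : p3 = - p1 - p2.
  by apply/eqP; rewrite -opprD -addr_eq0 addrC (pf_trace PF).
have [_ [[[[[[p11 p22 p12 p21] [q11 q22 q33]] [q12 q23 q31]] [q21 q32 q13]]
  [p1q1 p1q2 p1q3]] [p2q1 p2q2 p2q3]]] := pf_gram cpb PF.
have [[[e1p1 e1p2 _ [e1q1 e1q2 e1q3]] [e2p1 e2p2 _ [e2q1 e2q2 e2q3]]]
  [e3p1 e3p2 _ [e3q1 e3q2 e3q3]]] := pf_orthE PF.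
case: (pf_frame PF) => [[n1 n2 n3] [o12 o23 o31] _ _ _ _]; have bC := cpC cpb.
have c2 : (g * g') * (g * g') = 1 by rewrite -expr2 exprMn g2 g'2 mulr1.
have [x0 [x1 [x2 [x3 [x4 [x5 [x6 [x7 ->]]]]]]]] := octP x.
have [y0 [y1 [y2 [y3 [y4 [y5 [y6 [y7 ->]]]]]]]] := octP y.
rewrite !table_mapE p3E (cpZl cpb) (cpZr cpb) mulrA c2 mul1r /=.
rewrite !(cpE cpb) !(bC p1 e1) !(bC p1 e2) !(bC p1 e3) !(bC p2 e1) !(bC p2 e2)
  !(bC p2 e3) !(bC q1 e1) !(bC q1 e2) !(bC q1 e3) !(bC q2 e1) !(bC q2 e2)
  !(bC q2 e3) !(bC q3 e1) !(bC q3 e2) !(bC q3 e3)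
  !(bC q1 p1) !(bC q2 p1) !(bC q3 p1) !(bC q1 p2) !(bC q2 p2) !(bC q3 p2).
rewrite !(p11,p22,p12,p21,q11,q22,q33,q12,q23,q31,q21,q32,q13,p1q1,p1q2,p1q3)
  !(p2q1,p2q2,p2q3,e1p1,e1p2,e1q1,e1q2,e1q3,e2p1,e2p2,e2q1,e2q2,e2q3)
  !(e3p1,e3p2,e3q1,e3q2,e3q3,n1,n2,n3,o12,o23,o31) ?(bC e2 e1) ?(bC e3 e2)
  ?(bC e1 e3) ?(o12,o23,o31).
by rewrite /form3 /=; field.
Qed.

Lemma sign_mul (P : R -> R -> Prop) :
  P 1 1 -> P 1 (-1) -> P (-1) 1 -> P (-1) (-1) -> P g g'.
Proof.
move: g2 g'2 => /eqP; rewrite sqrf_eq1 => gE /eqP; rewrite sqrf_eq1.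
by move: gE => /orP[] /eqP -> /orP[] /eqP ->.
Qed.

Lemma sym_partP x : exists y0 y1 y3 y5 y7,
  sym_part x = oct y0 y1 0 y3 0 y5 0 y7.
Proof.
by exists x.1.1.1, x.1.1.2, x.1.2.2, x.2.1.2, x.2.2.2.
Qed.

Lemma lin_partE x : lin_part x =
  x.1.2.1 *: oct 0 0 1 0 0 0 0 0 + (x.2.1.1 *: oct 0 0 0 0 1 0 0 0 +
  (x.2.2.1 *: oct 0 0 0 0 0 0 1 0 + oct 0 0 0 0 0 0 0 0)).
Proof.
have [x0 [x1 [x2 [x3 [x4 [x5 [x6 [x7 ->]]]]]]]] := octP x.
rewrite [_.2.2.1 *: _ + _]oct_linear [_.2.1.1 *: _ + _]oct_linear oct_linear.
by apply: oct_eq; rewrite /=; ring.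
Qed.

Let f := table_map.
Let mm := model_mul g g'.

Ltac close_table := apply: (cp_inj cpb) => w; rewrite !(cpE cpb);
  pattern g, g'; apply: sign_mul; by field.

Let f_sym y0 y1 y3 y5 y7 : f (oct y0 y1 0 y3 0 y5 0 y7) =
  (g * g') *: (y1 *: (p3 - p2) - y0 *: p1 + (2 * y7) *: q3 + (2 * y5) *: q2
               + (2 * y3) *: q1).
Proof.
by apply: (cp_inj cpb) => w; rewrite /f !table_mapE /= !(cpE cpb); ring.
Qed.

Let Y2 : octonion R := oct 0 0 1 0 0 0 0 0.
Let Y4 : octonion R := oct 0 0 0 0 1 0 0 0.
Let Y6 : octonion R := oct 0 0 0 0 0 0 1 0.

Let f_Y2 : f Y2 = (g * g') *: e1.
Proof.
by apply: (cp_inj cpb) => w; rewrite /f !table_mapE /= !(cpE cpb); ring.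
Qed.
Let f_Y4 : f Y4 = (g * g') *: e2.
Proof.
by apply: (cp_inj cpb) => w; rewrite /f !table_mapE /= !(cpE cpb); ring.
Qed.
Let f_Y6 : f Y6 = - (g * g') *: e3.
Proof.
by apply: (cp_inj cpb) => w; rewrite /f !table_mapE /= !(cpE cpb); ring.
Qed.

Let trace3 : p3 = - p1 - p2.
Proof.
case: T => PF _ _; apply/eqP.
by rewrite -opprD -addr_eq0 addrC (pf_trace PF).
Qed.

Lemma table_map_lin_lin x y :
  f (mm (lin_part x) (lin_part y)) = f (lin_part x) ** f (lin_part y).
Proof.
case: T => PF _ _; case: (PF) => [_ [s1 s2 s3] [m1 m2 m3] [m1' m2' m3'] _ _ _].
have [x0 [x1 [x2 [x3 [x4 [x5 [x6 [x7 ->]]]]]]]] := octP x.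
have [y0 [y1 [y2 [y3 [y4 [y5 [y6 [y7 ->]]]]]]]] := octP y.
rewrite /lin_part /=.
have fE (t : octonion R) : f (oct 0 0 t.1.2.1 0 t.2.1.1 0 t.2.2.1 0) =
    (g * g') *: (t.1.2.1 *: e1 + t.2.1.1 *: e2 - t.2.2.1 *: e3).
  by apply: (cp_inj cpb) => w; rewrite /f !table_mapE /= !(cpE cpb); ring.
rewrite (fE (oct 0 0 x2 0 x4 0 x6 0)) (fE (oct 0 0 y2 0 y4 0 y6 0)) /=.
rewrite !mE s1 s2 s3 m1 m2 m3 m1' m2' m3' /f /mm model_mulE !table_mapE trace3 /=.
close_table.
Qed.

Let left_sym (e : A) (Y : octonion R) (s : R) r2 r3 t1 t2 t3 a1 :
    f Y = s *: e -> e ** p1 = a1 -> e ** p2 = r2 -> e ** p3 = r3 ->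
    e ** q1 = t1 -> e ** q2 = t2 -> e ** q3 = t3 ->
  forall y0 y1 y3 y5 y7, f Y ** f (oct y0 y1 0 y3 0 y5 0 y7) =
    (s * (g * g')) *: (y1 *: (r3 - r2) - y0 *: a1 + (2 * y7) *: t3
      + (2 * y5) *: t2 + (2 * y3) *: t1).
Proof.
by move=> -> <- <- <- <- <- <- y0 y1 y3 y5 y7; rewrite f_sym mZl mZr scalerA !mE.
Qed.

Let right_sym (e : A) (Y : octonion R) (s : R) r2 r3 t1 t2 t3 a1 :
    f Y = s *: e -> p1 ** e = a1 -> p2 ** e = r2 -> p3 ** e = r3 ->
    q1 ** e = t1 -> q2 ** e = t2 -> q3 ** e = t3 ->
  forall y0 y1 y3 y5 y7, f (oct y0 y1 0 y3 0 y5 0 y7) ** f Y =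
    (s * (g * g')) *: (y1 *: (r3 - r2) - y0 *: a1 + (2 * y7) *: t3
      + (2 * y5) *: t2 + (2 * y3) *: t1).
Proof.
by move=> -> <- <- <- <- <- <- y0 y1 y3 y5 y7; rewrite f_sym mZl mZr scalerA mulrC !mE.
Qed.

Lemma table_map_lin_sym x y :
  f (mm (lin_part x) (sym_part y)) = f (lin_part x) ** f (sym_part y).
Proof.
case: T => _ [[l11 l12 l13 l1 [l1' l1'']] [l22 l23 l21 l2 [l2' l2'']]
  [l33 l31 l32 l3 [l3' l3'']]] _.
have [y0 [y1 [y3 [y5 [y7 ->]]]]] := sym_partP y.
have [ml _] := model_mul_bilinear g g'.
have fl : linear f := table_map_linear.
set S := oct y0 y1 0 y3 0 y5 0 y7; have [S' S'E] : exists t, t = S by exists S.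
have [Z0 Z0E] : exists t : octonion R, t = 0 by exists 0.
have [Z2 Z2E] : exists t, t = Y2 by exists Y2.
have [Z4 Z4E] : exists t, t = Y4 by exists Y4.
have [Z6 Z6E] : exists t, t = Y6 by exists Y6.
rewrite lin_partE -/Y2 -/Y4 -/Y6 -[oct 0 0 0 0 0 0 0 0]/(0 : octonion R).
rewrite -Z2E -Z4E -Z6E -Z0E -S'E /mm !ml !fl !mDl !mZl.
rewrite Z2E Z4E Z6E Z0E S'E.
congr (_ *: _ + (_ *: _ + (_ *: _ + _))).
- rewrite (left_sym f_Y2 l11 l12 l13 l1 l1' l1'') /f /Y2 model_mulE !table_mapE trace3 /=.
  close_table.
- rewrite (left_sym f_Y4 l21 l22 l23 l2'' l2 l2') /f /Y4 model_mulE !table_mapE trace3 /=.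
  close_table.
- rewrite (left_sym f_Y6 l31 l32 l33 l3' l3'' l3) /f /Y6 model_mulE !table_mapE trace3 /=.
  close_table.
- have -> t : model_mul g g' 0 t = 0 by rewrite (linear0l (model_mul g g')).
  have -> : f 0 = 0 by apply: (cp_inj cpb) => w; rewrite /f !table_mapE /= !(cpE cpb); ring.
  by rewrite m0l.
Qed.

Lemma table_map_sym_lin x y :
  f (mm (sym_part x) (lin_part y)) = f (sym_part x) ** f (lin_part y).
Proof.
case: T => _ _ [[l11 l12 l13 l1 [l1' l1'']] [l22 l23 l21 l2 [l2' l2'']]
  [l33 l31 l32 l3 [l3' l3'']]].
have [y0 [y1 [y3 [y5 [y7 ->]]]]] := sym_partP x.
have [_ mr] := model_mul_bilinear g g'.
have fl : linear f := table_map_linear.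
set S := oct y0 y1 0 y3 0 y5 0 y7; have [S' S'E] : exists t, t = S by exists S.
have [Z0 Z0E] : exists t : octonion R, t = 0 by exists 0.
have [Z2 Z2E] : exists t, t = Y2 by exists Y2.
have [Z4 Z4E] : exists t, t = Y4 by exists Y4.
have [Z6 Z6E] : exists t, t = Y6 by exists Y6.
rewrite lin_partE -/Y2 -/Y4 -/Y6 -[oct 0 0 0 0 0 0 0 0]/(0 : octonion R).
rewrite -Z2E -Z4E -Z6E -Z0E -S'E /mm !mr !fl !mDr !mZr.
rewrite Z2E Z4E Z6E Z0E S'E.
congr (_ *: _ + (_ *: _ + (_ *: _ + _))).
- rewrite (right_sym f_Y2 l11 l12 l13 l1 l1' l1'') /f /Y2 model_mulE !table_mapE trace3 /=.
  close_table.
- rewrite (right_sym f_Y4 l21 l22 l23 l2'' l2 l2') /f /Y4 model_mulE !table_mapE trace3 /=.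
  close_table.
- rewrite (right_sym f_Y6 l31 l32 l33 l3' l3'' l3) /f /Y6 model_mulE !table_mapE trace3 /=.
  close_table.
- have -> t : model_mul g g' t 0 = 0 by rewrite (linear0r (model_mul g g')).
  have -> : f 0 = 0 by apply: (cp_inj cpb) => w; rewrite /f !table_mapE /= !(cpE cpb); ring.
  by rewrite m0r.
Qed.

(** The products of elements of U span the whole algebra. *)
Lemma table_map_total z :
  (forall x y, b z (f (lin_part x) ** f (lin_part y)) = 0) -> z = 0.
Proof.
move=> bz; case: T => PF _ _.
case: (PF) => [_ [s1 s2 s3] [m1 m2 m3] [m1' m2' m3'] _ _ tot].
have c0 : g * g' != 0.
  by apply: (@sign_mul (fun g g' => g * g' != 0)); rewrite ?mulrN mulr1 ?opprK ?oppr_eq0 oner_eq0.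
have h0 s t x y : s != 0 -> t != 0 -> b z ((s *: x) ** (t *: y)) = 0 ->
    b z (x ** y) = 0.
  move=> s0 t0; rewrite mZl mZr !(cpZr cpb) => /eqP.
  by rewrite !mulf_eq0 (negPf s0) (negPf t0) => /eqP.
have c0' : - (g * g') != 0 by rewrite oppr_eq0.
have h11 := bz Y2 Y2; have h22 := bz Y4 Y4; have h33 := bz Y6 Y6.
have h12 := bz Y2 Y4; have h21 := bz Y4 Y2; have h13 := bz Y2 Y6.
have h31 := bz Y6 Y2; have h23 := bz Y4 Y6; have h32 := bz Y6 Y4.
rewrite -[lin_part Y2]/Y2 f_Y2 in h11 h12 h21 h13 h31.
rewrite -[lin_part Y4]/Y4 f_Y4 in h22 h12 h21 h23 h32.
rewrite -[lin_part Y6]/Y6 f_Y6 in h33 h13 h31 h23 h32.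
move: h11 h22 h33 h12 h21 h13 h31 h23 h32.
move=> /(h0 _ _ _ _ c0 c0) h11 /(h0 _ _ _ _ c0 c0) h22 /(h0 _ _ _ _ c0' c0') h33.
move=> /(h0 _ _ _ _ c0 c0) h12 /(h0 _ _ _ _ c0 c0) h21.
move=> /(h0 _ _ _ _ c0 c0') h13 /(h0 _ _ _ _ c0' c0) h31.
move=> /(h0 _ _ _ _ c0 c0') h23 /(h0 _ _ _ _ c0' c0) h32.
move: h11 h22 h33 h12 h21 h13 h31 h23 h32; clear - cpb tot s1 s2 s3 m1 m2 m3 m1' m2' m3'.
rewrite s1 s2 s3 m1 m2 m3 m1' m2' m3' !(cpE cpb) => h11 h22 h33 h12 h21 h13 h31 h23 h32.
apply: tot => y; rewrite !inE.
do ![case/predU1P => [->|]; [|]] => [||||||||/eqP ->] //; lra.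
Qed.

(** The multiplication table covers every product with a factor in U. For s, t in
the symmetric part, the linearized composition law expresses <s t, x y> with
x, y in U through such products, and the products x y span. *)
Lemma table_map_mul x y : f (mm x y) = f x ** f y.
Proof.
have cM := model_composition g2 g'2.
have mmD1 u v t : mm (u + v) t = mm u t + mm v t by exact: linearDl.
have mmD2 u v t : mm t (u + v) = mm t u + mm t v by exact: linearDr.
have fD u v : f (u + v) = f u + f v.
  by have := table_map_linear 1 u v; rewrite !scale1r.
suff sym_sym : f (mm (sym_part x) (sym_part y)) = f (sym_part x) ** f (sym_part y).
  rewrite [x in mm x _]parts [y in mm _ y]parts [x in f x ** _]parts [y in _ ** f y]parts.
  rewrite mmD1 !mmD2 !fD !mDl !mDr.
  by rewrite sym_sym table_map_lin_lin table_map_lin_sym table_map_sym_lin.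
apply/eqP; rewrite -subr_eq0; apply/eqP/table_map_total => u w.
rewrite -table_map_lin_lin (cpDl cpb) (cpNl cpb) table_isometry table_map_lin_lin.
have := cp_mul4 cpb (f (sym_part x)) (f (sym_part y)) (f (lin_part u)) (f (lin_part w)).
have := cp_mul4 cM (sym_part x) (sym_part y) (lin_part u) (lin_part w).
rewrite -table_map_sym_lin -table_map_lin_sym !table_isometry /=.
rewrite -/(mm _ _) -/(mm (sym_part x) (lin_part w)) -/(mm (lin_part u) (sym_part y))
  -/(mm (lin_part u) (lin_part w)).
lra.
Qed.

Lemma table_model : exists h : 'Hom(M, A),
  [/\ forall x, h x = f x, forall x y, b (h x) (h y) = form3 x y & alg_hom h].
Proof.
have [h hE] := linear_lfun table_map_linear.
exists h; split=> // x y; rewrite !hE; first exact: table_isometry.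
exact: table_map_mul.
Qed.

End TableModel.

(** * Transport along isomorphisms *)

Section Transport.
Variable R : realType.

(** The inverse is kept explicit, so that both directions can transport
derivations, subspaces and determinants. *)
Definition algebra_iso (A B : algebra R) (h : 'Hom(A, B)) (k : 'Hom(B, A)) :
    Prop :=
  [/\ alg_hom h, alg_hom k, cancel h k & cancel k h].

Lemma algebra_iso_sym A B h k : @algebra_iso A B h k -> algebra_iso k h.
Proof. by case=> ? ? ? ?. Qed.

Lemma algebra_iso_comp A B C h k h' k' : @algebra_iso A B h k ->
  @algebra_iso B C h' k' -> algebra_iso (h' \o h)%VF (k \o k')%VF.
Proof.
case=> hh kh hk kk [hh' kh' hk' kk']; split=> [x y|x y|x|x].
- by rewrite !comp_lfunE /= hh hh'.
- by rewrite !comp_lfunE /= kh' kh.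
- by rewrite !comp_lfunE /= hk' hk.
- by rewrite !comp_lfunE /= kk kk'.
Qed.

Lemma iso_isomorphic (A B : algebra R) h k : (exists a : A, a != 0) ->
  @algebra_iso A B h k -> isomorphic A B.
Proof.
move=> [a a0] [hh kh hk kk]; exists h.
have h0 : h != 0.
  by apply: contraNneq a0 => h0; rewrite -[a]hk h0 zero_lfunE linear0.
have k0 : k != 0.
  apply: contraNneq a0 => k0; rewrite -[a]hk.
  by rewrite k0 zero_lfunE.
split=> //; exists k; split=> //; apply/lfunP => x.
  by rewrite comp_lfunE id_lfunE.
by rewrite comp_lfunE id_lfunE.
Qed.

Lemma inj_iso (A B : algebra R) (h : 'Hom(A, B)) : alg_hom h ->
  injective h -> \dim {:A} = \dim {:B} -> exists k, algebra_iso h k.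
Proof.
move=> hh /lker0P ker0 dimE.
have img : limg h = fullv.
  apply/eqP; rewrite eqEdim subvf limg_dim_eq ?dimE ?leqnn //.
  by move/eqP: ker0 => ->; rewrite capv0.
have hk := lker0_lfunK ker0.
have kk : cancel (h^-1)%VF h by move=> y; rewrite limg_lfunVK // img memvf.
exists (h^-1)%VF; split=> // x y; apply: (can_inj hk).
by rewrite kk hh !kk.
Qed.

Section Iso.
Variables (A B : algebra R) (h : 'Hom(A, B)) (k : 'Hom(B, A)).
Hypothesis iso : algebra_iso h k.

Let hh : alg_hom h. Proof. by case: iso. Qed.
Let kh : alg_hom k. Proof. by case: iso. Qed.
Let hk : cancel h k. Proof. by case: iso. Qed.
Let kk : cancel k h. Proof. by case: iso. Qed.

Lemma iso_dim (U : {vspace A}) : \dim (h @: U)%VS = \dim U.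
Proof.
apply: limg_dim_eq; apply/eqP; rewrite -subv0; apply/subvP => x /memv_capP[_].
by rewrite memv_ker memv0 => /eqP hx; rewrite -[x]hk hx linear0.
Qed.

Lemma iso_full : (h @: fullv = fullv)%VS.
Proof. by apply/eqP; rewrite eqEsubv subvf; apply/subvP => y _; rewrite -[y]kk memv_img ?memvf. Qed.

Lemma iso_dimf : \dim {:B} = \dim {:A}.
Proof. by rewrite -iso_full iso_dim. Qed.

Lemma iso_mem (U : {vspace A}) y : (y \in (h @: U)%VS) = (k y \in U).
Proof.
apply/idP/idP => [/memv_imgP[x xU ->]|kyU]; first by rewrite hk.
by rewrite -[y]kk memv_img.
Qed.

Lemma iso_derivation (d : 'End(B)) : derivation d -> derivation (k \o (d \o h))%VF.
Proof. by move=> dd x y; rewrite !comp_lfunE /= hh dd linearD /= !kh !hk. Qed.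

Lemma iso_submodule (U : {vspace A}) : der_submodule U -> der_submodule (h @: U)%VS.
Proof.
move=> sub d dd; apply/subvP => _ /memv_imgP[y yU ->]; rewrite !iso_mem in yU *.
apply: subvP (sub _ (iso_derivation dd)) _ _.
by apply/memv_imgP; exists (k y); rewrite ?comp_lfunE /= ?comp_lfunE /= ?kk.
Qed.

Lemma iso_division : division_algebra A -> division_algebra B.
Proof.
move=> [[a a0] bij]; split.
  by exists (h a); apply: contraNneq a0 => ha; rewrite -[a]hk ha linear0.
move=> y y0; have ky0 : k y != 0.
  by apply: contraNneq y0 => ky; rewrite -[y]kk ky linear0.
have [[l l1 l2] [r r1 r2]] := bij _ ky0; split.
  exists (fun x => h (l (k x))) => x; first by rewrite kh l1 kk.
  by rewrite -[y in alg_mul B y]kk -hh l2 kk.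
exists (fun x => h (r (k x))) => x; first by rewrite kh r1 kk.
by rewrite -[y in alg_mul B _ y]kk -hh r2 kk.
Qed.

Lemma iso_composition : composition_algebra A -> composition_algebra B.
Proof.
move=> [q [[qZ [ql qr]] nd qM]].
have polarE x y : polar (fun t => q (k t)) x y = polar q (k x) (k y).
  by rewrite /polar linearD.
exists (fun t => q (k t)); split.
- split; first by move=> a x; rewrite linearZ qZ.
  split=> [u a x y|u a x y]; rewrite /= !polarE linearP /=.
    exact: ql.
  exact: qr.
- move=> x px; have k0 : k x = 0.
    by apply: nd => y; rewrite -[y]hk -polarE px.
  by rewrite -[x]kk k0 linear0.
- by move=> x y; rewrite kh qM.
Qed.

Lemma iso_A8 : cat_A8 A -> cat_A8 B.
Proof.
move=> [dimA div comp]; split; first by rewrite iso_dimf.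
  exact: iso_division.
exact: iso_composition.
Qed.

Lemma iso_abelian : der_abelian B -> der_abelian A.
Proof.
move=> ab d e dd de.
have kA : forall d : 'End(A), derivation d -> derivation (h \o (d \o k))%VF.
  by move=> d0 dd0 x y; rewrite !comp_lfunE /= kh dd0 linearD /= !hh !kk.
have := ab _ _ (kA _ dd) (kA _ de) => /lfunP br; apply/lfunP => x.
have := congr1 k (br (h x)); rewrite !add_lfunE !opp_lfunE !comp_lfunE /=.
by rewrite !zero_lfunE linear0 !hk -linearB hk.
Qed.

End Iso.

Lemma iso_irreducible A B h k : @algebra_iso A B h k ->
  forall U, der_irreducible U -> der_irreducible (h @: U)%VS.
Proof.
move=> iso U [sub U0 irr]; have iso' := algebra_iso_sym iso.
have [_ _ hk kk] := iso.
split; first exact: (iso_submodule iso).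
  by move=> hU; apply: U0; apply/eqP; rewrite -dimv_eq0 -(iso_dim iso) hU dimv0.
move=> W subW WU.
have [||kW|kW] := irr (k @: W)%VS.
- exact: (iso_submodule iso').
- by apply/subvP => x; rewrite (iso_mem iso') => /(subvP WU); rewrite (iso_mem iso) hk.
- by left; apply/eqP; rewrite -dimv_eq0 -(iso_dim iso') kW dimv0.
- right; apply/vspaceP => y; rewrite (iso_mem iso) -kW (iso_mem iso').
  by rewrite kk.
Qed.

Lemma iso_D35 A B h k : @algebra_iso A B h k -> cat_D35 A -> cat_D35 B.
Proof.
move=> iso [[A8 nab] [U [V [[dU iU] [dV iV] UV dir]]]].
have iso' := algebra_iso_sym iso; have [_ _ hk kk] := iso.
split.
  split; first exact: iso_A8 iso A8.
  by move=> ab; apply: nab; apply: iso_abelian iso ab.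
exists (h @: U)%VS, (h @: V)%VS; split.
- by rewrite (iso_dim iso); split=> //; apply: iso_irreducible iso _ iU.
- by rewrite (iso_dim iso); split=> //; apply: iso_irreducible iso _ iV.
- by rewrite -limgD UV (iso_full iso).
apply/directv_addP/eqP; rewrite -subv0; apply/subvP => y /memv_capP[].
rewrite !(iso_mem iso) => kU kV.
have : k y \in (U :&: V)%VS by apply/memv_capP.
by rewrite (directv_addP dir) !memv0 => /eqP ky; rewrite -[y]kk ky linear0.
Qed.

Lemma det_conj (m n : nat) (P : 'M[R]_(n, m)) (M : 'M_m) (Q : 'M_(m, n)) :
  m = n -> Q *m P = 1%:M -> \det (P *m M *m Q) = \det M.
Proof.
move=> mn; subst n => QP; rewrite !det_mulmx mulrC mulrA -det_mulmx QP det1.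
by rewrite mul1r.
Qed.

Import passmx.

Lemma mxof_cancel (V W : vectType R) (e : (\dim {:V}).-tuple V)
    (e' : (\dim {:W}).-tuple W) (h : 'Hom(V, W)) (k : 'Hom(W, V)) :
  basis_of {:V} e -> basis_of {:W} e' -> cancel h k ->
  mxof e e' h *m mxof e' e k = 1%:M.
Proof.
move=> be be' hk; rewrite -(mxof_comp _ _ be') -(mxof1 (basis_free be)).
by congr mxof; apply/lfunP => x; rewrite comp_lfunE id_lfunE.
Qed.

(** In particular the determinant does not depend on the basis. *)
Lemma lfun_det_conj (V W : vectType R) (h : 'Hom(V, W)) (k : 'Hom(W, V))
    (f : 'End(V)) : \dim {:V} = \dim {:W} -> cancel h k ->
  lfun_det (h \o f \o k)%VF = lfun_det f.
Proof.
move=> dimE hk; rewrite /lfun_det.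
rewrite (mxof_comp _ _ (vbasisP {:V})) (mxof_comp _ _ (vbasisP {:V})) mulmxA.
by apply: det_conj => //; apply: mxof_cancel; rewrite ?vbasisP.
Qed.

Lemma lfun_det_comp (V : vectType R) (f g : 'End(V)) :
  lfun_det (f \o g)%VF = lfun_det f * lfun_det g.
Proof. by rewrite /lfun_det (mxof_comp _ _ (vbasisP _)) det_mulmx mulrC. Qed.

Lemma lfun_det1 (V : vectType R) : lfun_det (\1%VF : 'End(V)) = 1.
Proof. by rewrite /lfun_det mxof1 ?det1 // (basis_free (vbasisP _)). Qed.

Lemma left_mulE (A : algebra R) (a x : A) : left_mul a x = alg_mul A a x.
Proof. by rewrite (lfunE (alg_mul A a)). Qed.

Lemma right_mulE (A : algebra R) (a x : A) : right_mul a x = alg_mul A x a.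
Proof.
have [|g gE] := @linear_lfun R A A (fun x => alg_mul A x a).
  by move=> c y z; rewrite linearPl.
have -> : right_mul a = g; last exact: gE.
rewrite /right_mul -[RHS]fun_of_lfunK; congr linfun.
by apply/funext => y; rewrite gE.
Qed.

Lemma iso_double_sign A B h k : @algebra_iso A B h k ->
  forall a, double_sign (h a) = double_sign a.
Proof.
move=> iso a; have [hh kh hk kk] := iso.
have dimE := iso_dimf iso.
congr (Num.sg _, Num.sg _).
- rewrite -(lfun_det_conj (h := h) (k := k) (left_mul a)) ?dimE //.
  congr lfun_det; apply/lfunP => x; rewrite !comp_lfunE /= !left_mulE.
  by rewrite hh kk.
- rewrite -(lfun_det_conj (h := h) (k := k) (right_mul a)) ?dimE //.
  congr lfun_det; apply/lfunP => x; rewrite !comp_lfunE /= !right_mulE.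
  by rewrite hh kk.
Qed.

End Transport.

(** * Rotations of the models *)

Lemma dim_octonion (R : realType) : \dim {:octonion R} = 8%N.
Proof. by rewrite dimvf. Qed.

Section ModelDerivations.
Variables (R : realType) (g g' : R).
Local Notation O := (octonion R).
Local Notation M := (model g g').

Let Y0 : O := oct 1 0 0 0 0 0 0 0.
Let Y1 : O := oct 0 1 0 0 0 0 0 0.
Let Y2 : O := oct 0 0 1 0 0 0 0 0.
Let Y3 : O := oct 0 0 0 1 0 0 0 0.
Let Y4 : O := oct 0 0 0 0 1 0 0 0.
Let Y5 : O := oct 0 0 0 0 0 1 0 0.
Let Y6 : O := oct 0 0 0 0 0 0 1 0.
Let Y7 : O := oct 0 0 0 0 0 0 0 1.

(** The infinitesimal rotations of the span of v, z, v z, and the way they act on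
the symmetric part, on which rot_u has the weights 0, 1 and 2. *)
Definition rot_u (x : O) : O :=
  oct 0 (2 * x.1.2.2) 0 (- 2 * x.1.1.2) x.2.2.1 x.2.2.2 (- x.2.1.1) (- x.2.1.2).
Definition rot_v (x : O) : O :=
  oct (- 3 * x.2.1.2) (- x.2.1.2) (- x.2.2.1) (- x.2.2.2) 0 (x.1.1.1 + x.1.1.2)
      x.1.2.1 x.1.2.2.
Definition rot_w (x : O) : O :=
  oct (3 * x.2.2.2) (- x.2.2.2) (- x.2.1.1) x.2.1.2 x.1.2.1 (- x.1.2.2) 0
      (x.1.1.2 - x.1.1.1).

Lemma rot_linear : [/\ linear rot_u, linear rot_v & linear rot_w].
Proof.
split=> a x y.
all: have [x0 [x1 [x2 [x3 [x4 [x5 [x6 [x7 ->]]]]]]]] := octP x.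
all: have [y0 [y1 [y2 [y3 [y4 [y5 [y6 [y7 ->]]]]]]]] := octP y.
all: rewrite oct_linear ?[rot_u (oct x0 _ _ _ _ _ _ _)]/rot_u /rot_u /rot_v /rot_w oct_linear.
all: by apply: oct_eq; rewrite /=; ring.
Qed.

Lemma rot_derivation :
  [/\ exists d : 'End(M), derivation d /\ forall x, d x = rot_u x,
      exists d : 'End(M), derivation d /\ forall x, d x = rot_v x
    & exists d : 'End(M), derivation d /\ forall x, d x = rot_w x].
Proof.
have [lu lv lw] := rot_linear.
split.
all: [> have [d dE] := linear_lfun lu | have [d dE] := linear_lfun lv
      | have [d dE] := linear_lfun lw].
all: exists d; split=> // x y; rewrite !dE.
all: have [x0 [x1 [x2 [x3 [x4 [x5 [x6 [x7 ->]]]]]]]] := octP x.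
all: have [y0 [y1 [y2 [y3 [y4 [y5 [y6 [y7 ->]]]]]]]] := octP y.
all: rewrite /= model_mulE /rot_u /rot_v /rot_w !model_mulE -[X in _ = X + _]scale1r oct_linear.
all: by apply: oct_eq; rewrite /=; field.
Qed.

Definition linU : {vspace M} := <<[:: Y2 : M; Y4; Y6]>>%VS.
Definition symV : {vspace M} := <<[:: Y0 : M; Y1; Y3; Y5; Y7]>>%VS.

Lemma part_linear : linear (@lin_part R) /\ linear (@sym_part R).
Proof.
split=> a x y.
all: have [x0 [x1 [x2 [x3 [x4 [x5 [x6 [x7 ->]]]]]]]] := octP x.
all: have [y0 [y1 [y2 [y3 [y4 [y5 [y6 [y7 ->]]]]]]]] := octP y.
all: by rewrite oct_linear /lin_part /sym_part oct_linear; apply: oct_eq; rewrite /=; ring.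
Qed.

Lemma sym_partE x : sym_part x = x.1.1.1 *: Y0 + (x.1.1.2 *: Y1 +
  (x.1.2.2 *: Y3 + (x.2.1.2 *: Y5 + (x.2.2.2 *: Y7 + oct 0 0 0 0 0 0 0 0)))).
Proof.
have [x0 [x1 [x2 [x3 [x4 [x5 [x6 [x7 ->]]]]]]]] := octP x.
rewrite [_.2.2.2 *: _ + _]oct_linear [_.2.1.2 *: _ + _]oct_linear.
rewrite [_.1.2.2 *: _ + _]oct_linear [_.1.1.2 *: _ + _]oct_linear oct_linear.
by apply: oct_eq; rewrite /=; ring.
Qed.

Lemma linUP (x : M) : x \in linU <-> sym_part x = 0.
Proof.
have [_ ls] := part_linear; have [S SE] := linear_lfun ls; split=> [xU|x0].
  have /subvP sub : (linU <= lker (S : 'End(M)))%VS.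
    by apply/span_subvP => y; rewrite !inE => /or3P[] /eqP ->; rewrite memv_ker SE; apply/eqP.
  by have := sub x xU; rewrite memv_ker SE => /eqP.
rewrite [x](@parts R) x0 addr0 lin_partE -[oct 0 0 0 0 0 0 0 0]/(0 : M) addr0.
by rewrite !memvD // memvZ // memv_span // !inE eqxx ?orbT.
Qed.

Lemma symVP (x : M) : x \in symV <-> lin_part x = 0.
Proof.
have [ll _] := part_linear; have [S SE] := linear_lfun ll; split=> [xV|x0].
  have /subvP sub : (symV <= lker (S : 'End(M)))%VS.
    apply/span_subvP => y; rewrite !inE.
    by do 4?[case/predU1P => [->|]]; last move/eqP => ->; rewrite memv_ker SE; apply/eqP.
  by have := sub x xV; rewrite memv_ker SE => /eqP.
rewrite [x](@parts R) x0 add0r sym_partE -[oct 0 0 0 0 0 0 0 0]/(0 : M) addr0.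
by rewrite !memvD // memvZ // memv_span // !inE eqxx ?orbT.
Qed.

Lemma linU_symV : [/\ (linU + symV)%VS = fullv, directv (linU + symV),
  \dim linU = 3%N & \dim symV = 5%N].
Proof.
have full : (linU + symV)%VS = fullv.
  apply/eqP; rewrite eqEsubv subvf; apply/subvP => x _.
  rewrite [x](@parts R) memv_add //; first exact/linUP.
  exact/symVP.
have cap : (linU :&: symV)%VS = 0%VS.
  apply/eqP; rewrite -subv0; apply/subvP => x /memv_capP[/linUP sx /symVP lx].
  by rewrite [x](@parts R) sx lx addr0 mem0v.
have sum := dimv_sum_cap linU symV.
rewrite full cap dimv0 addn0 dim_octonion in sum.
have leU : (\dim linU <= 3)%N by exact: dim_span.
have leV : (\dim symV <= 5)%N by exact: dim_span.
split=> //; first exact/directv_addP.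
  by apply/eqP; rewrite eqn_leq leU -(leq_add2r (\dim symV)) -sum (leq_add2l 3).
by apply/eqP; rewrite eqn_leq leV -(leq_add2l (\dim linU)) -sum (leq_add2r 5 _ 3).
Qed.

Lemma submodule_rot (W : {vspace M}) : der_submodule W ->
  [/\ forall x : O, (x : M) \in W -> (rot_u x : M) \in W,
      forall x : O, (x : M) \in W -> (rot_v x : M) \in W
    & forall x : O, (x : M) \in W -> (rot_w x : M) \in W].
Proof.
have [[du [ddu duE]] [dv [ddv dvE]] [dw [ddw dwE]]] := rot_derivation.
move=> subW; have stab d x : derivation d -> x \in W -> d x \in W.
  by move=> dd xW; apply: subvP (subW d dd) _ (memv_img d xW).
by split=> x xW; rewrite -?duE -?dvE -?dwE stab.
Qed.

Lemma octZ (k : R) x0 x1 x2 x3 x4 x5 x6 x7 :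
  k *: oct x0 x1 x2 x3 x4 x5 x6 x7 =
  oct (k * x0) (k * x1) (k * x2) (k * x3) (k * x4) (k * x5) (k * x6) (k * x7).
Proof. by []. Qed.

(** Composites of rotations isolate each coordinate of a vector. *)
Lemma linU_irreducible : der_submodule linU -> der_irreducible linU.
Proof.
have [_ _ dimU _] := linU_symV.
move=> subU; split=> // [U0|W subW WU]; first by have := dimU; rewrite U0 dimv0.
have [uW vW wW] := submodule_rot subW.
have [->|/eqP W0] := eqVneq W 0%VS; [by left | right].
have gen (k : R) : k != 0 -> (k *: (Y2 : M)) \in W -> W = linU.
  move=> k0 kY2; have Y2W : (Y2 : M) \in W by rewrite -[X in X \in _]scale1r -(mulVf k0) -scalerA memvZ.
  apply/eqP; rewrite eqEsubv WU; apply/span_subvP => y.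
  have e4 : rot_w Y2 = Y4 by apply: oct_eq; rewrite /=; ring.
  have e6 : rot_v Y2 = Y6 by apply: oct_eq; rewrite /=; ring.
  by rewrite !inE => /or3P[] /eqP ->; rewrite -?e4 -?e6 ?wW ?vW.
have xW : vpick W \in W by exact: memv_pick.
have /linUP sx := subvP WU _ xW; have x0 : vpick W != 0 by rewrite vpick0; apply/eqP.
move: (vpick W : M) xW sx x0 => x.
have [x0 [x1 [x2 [x3 [x4 [x5 [x6 [x7 ->]]]]]]]] := octP x => xW.
move=> /(@oct_inj R _ _ _ _ _ _ _ _ 0 0 0 0 0 0 0 0)[[/= z0 z1 _ z3] [_ z5 _ z7]] xn0.
have [x20|x20] := eqVneq x2 0; last first.
  apply: (gen x2) => //.
  suff -> : x2 *: (Y2 : M) = rot_v (rot_u (rot_w (oct x0 x1 x2 x3 x4 x5 x6 x7))).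
    by rewrite vW ?uW ?wW.
  by rewrite [LHS]octZ; apply: oct_eq; rewrite /= ?z0 ?z1 ?z3 ?z5 ?z7; ring.
have [x40|x40] := eqVneq x4 0; last first.
  apply: (gen x4) => //.
  suff -> : x4 *: (Y2 : M) = rot_v (rot_u (oct x0 x1 x2 x3 x4 x5 x6 x7)).
    by rewrite vW ?uW.
  by rewrite [LHS]octZ; apply: oct_eq; rewrite /= ?z0 ?z1 ?z3 ?z5 ?z7; ring.
have [x60|x60] := eqVneq x6 0; last first.
  apply: (gen (- x6)); rewrite ?oppr_eq0 //.
  suff -> : - x6 *: (Y2 : M) = rot_w (rot_u (oct x0 x1 x2 x3 x4 x5 x6 x7)).
    by rewrite wW ?uW.
  by rewrite [LHS]octZ; apply: oct_eq; rewrite /= ?z0 ?z1 ?z3 ?z5 ?z7; ring.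
by move: xn0; rewrite z0 z1 x20 z3 x40 z5 x60 z7 eqxx.
Qed.

(** The nonzero weights of rot_u on the symmetric part are 1 and 2, so the
operator (D + 1) (D + 4), with D the square of rot_u, has its values in the
line of the unit octonion. *)
Lemma zero_weight (W : {vspace M}) x0 x1 x3 x5 x7 : der_submodule W ->
  (oct x0 x1 0 x3 0 x5 0 x7 : M) \in W -> x0 != 0 -> (Y0 : M) \in W.
Proof.
move=> /submodule_rot[uW _ _] xW x00.
set X := oct x0 x1 0 x3 0 x5 0 x7 in xW.
have uu x : (x : M) \in W -> (rot_u (rot_u x) : M) \in W by move=> ?; apply/uW/uW.
have A : rot_u (rot_u X) = oct 0 (- 4 * x1) 0 (- 4 * x3) 0 (- x5) 0 (- x7).
  by apply: oct_eq; rewrite /=; ring.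
have B : rot_u (rot_u (rot_u (rot_u X))) = oct 0 (16 * x1) 0 (16 * x3) 0 x5 0 x7.
  by rewrite A; apply: oct_eq; rewrite /=; ring.
have E : (4 * x0) *: (Y0 : M) =
    4 *: (X : M) + (5 *: (rot_u (rot_u X) : M) + (rot_u (rot_u (rot_u (rot_u X))) : M)).
  by rewrite B A [5 *: _ + _]oct_linear [RHS]oct_linear [LHS]octZ; apply: oct_eq; ring.
have k0 : 4 * x0 != 0 by rewrite mulf_neq0 // pnatr_eq0.
rewrite -[X in X \in _]scale1r -(mulVf k0) -scalerA memvZ // E.
by rewrite !memvD ?memvZ ?uu // uu.
Qed.

(** A nonzero coordinate is first carried to the coordinate of weight zero, by a
suitable composite of rotations; the unit octonion then generates. *)
Lemma symV_irreducible : der_submodule symV -> der_irreducible symV.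
Proof.
have [_ _ _ dimV] := linU_symV.
move=> subV; split=> // [V0|W subW WV]; first by have := dimV; rewrite V0 dimv0.
have [uW vW wW] := submodule_rot subW.
have [->|/eqP W0] := eqVneq W 0%VS; [by left | right].
have gen : (Y0 : M) \in W -> W = symV.
  move=> Y0W; apply/eqP; rewrite eqEsubv WV; apply/span_subvP => y.
  have Y5W : (Y5 : M) \in W.
    suff -> : (Y5 : M) = rot_v Y0 by rewrite vW.
    by apply: oct_eq; rewrite /=; ring.
  have Y7W : (Y7 : M) \in W.
    suff -> : (Y7 : M) = -1 *: (rot_w Y0 : M) by rewrite memvZ ?wW.
    by rewrite [RHS]octZ; apply: oct_eq; rewrite /=; ring.
  have Y3W : (Y3 : M) \in W.
    suff -> : (Y3 : M) = rot_w Y5 by rewrite wW.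
    by apply: oct_eq; rewrite /=; ring.
  have Y1W : (Y1 : M) \in W.
    suff -> : (Y1 : M) = 2^-1 *: (rot_u Y3 : M) by rewrite memvZ ?uW.
    by rewrite [RHS]octZ; apply: oct_eq; rewrite /=; field.
  by rewrite !inE; do 4?[case/predU1P => [->|]]; last move/eqP => ->.
have xW : vpick W \in W by exact: memv_pick.
have /symVP sx := subvP WV _ xW; have x0 : vpick W != 0 by rewrite vpick0; apply/eqP.
move: (vpick W : M) xW sx x0 => x.
have [x0 [x1 [x2 [x3 [x4 [x5 [x6 [x7 ->]]]]]]]] := octP x => xW.
move=> /(@oct_inj R _ _ _ _ _ _ _ _ 0 0 0 0 0 0 0 0)[[/= _ _ z2 _] [z4 _ z6 _]] xn0.
rewrite z2 z4 z6 in xW xn0.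
have n3 : 3 != 0 :> R by rewrite pnatr_eq0.
have n6 : 6 != 0 :> R by rewrite pnatr_eq0.
have [x00|x00] := eqVneq x0 0; last by apply/gen/(zero_weight subW xW).
have [x70|x70] := eqVneq x7 0; last first.
  apply/gen/(zero_weight (x0 := 3 * x7) (x1 := - x7) (x3 := x5) (x5 := - x3)
    (x7 := x1 - x0) subW); last by rewrite mulf_neq0.
  suff <- : rot_w (oct x0 x1 0 x3 0 x5 0 x7) = oct (3 * x7) (- x7) 0 x5 0 (- x3) 0 (x1 - x0).
    exact: wW.
  by apply: oct_eq; rewrite /=; ring.
have [x50|x50] := eqVneq x5 0; last first.
  apply/gen/(zero_weight (x0 := - 3 * x5) (x1 := - x5) (x3 := - x7) (x5 := x0 + x1)
    (x7 := x3) subW); last by rewrite mulf_neq0 ?oppr_eq0.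
  suff <- : rot_v (oct x0 x1 0 x3 0 x5 0 x7) = oct (- 3 * x5) (- x5) 0 (- x7) 0 (x0 + x1) 0 x3.
    exact: vW.
  by apply: oct_eq; rewrite /=; ring.
have [x30|x30] := eqVneq x3 0; last first.
  apply/gen/(zero_weight (x0 := 3 * x3) (x1 := x3) (x3 := x0 - x1) (x5 := 2 * x7)
    (x7 := x5) subW); last by rewrite mulf_neq0.
  suff <- : rot_v (rot_w (oct x0 x1 0 x3 0 x5 0 x7)) = oct (3 * x3) x3 0 (x0 - x1) 0 (2 * x7) 0 x5.
    by rewrite vW ?wW.
  by apply: oct_eq; rewrite /=; ring.
have [x10|x10] := eqVneq x1 0; last first.
  apply/gen/(zero_weight (x0 := - 6 * x1) (x1 := - 2 * x1) (x3 := - 2 * x3)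
    (x5 := - 2 * x5) (x7 := x7) subW); last by rewrite mulf_neq0 ?oppr_eq0.
  suff <- : rot_v (rot_w (rot_u (oct x0 x1 0 x3 0 x5 0 x7))) =
      oct (- 6 * x1) (- 2 * x1) 0 (- 2 * x3) 0 (- 2 * x5) 0 x7.
    by rewrite vW ?wW ?uW.
  by apply: oct_eq; rewrite /=; ring.
by move: xn0; rewrite x00 x10 x30 x50 x70 eqxx.
Qed.

End ModelDerivations.

(** * Derivations of the models preserve the summands *)

Section ModelD35.
Variables (R : realType) (g g' : R).
Hypotheses (g2 : g ^+ 2 = 1) (g'2 : g' ^+ 2 = 1).
Local Notation O := (octonion R).
Local Notation M := (model g g').
Local Notation Y2 := (oct 0 0 1 0 0 0 0 0 : octonion R).

Lemma form3_polar (x y : O) : polar (fun t => form3 t t) x y = 2 * form3 x y.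
Proof. by rewrite /polar /form3 /=; ring. Qed.

Lemma model_A8 : cat_A8 M.
Proof.
have cM := model_composition g2 g'2.
split; first exact: dim_octonion.
- split.
    exists (Y2 : M); apply/eqP => h; have := congr1 (fun t : O => t.1.2.1) h.
    by move=> /eqP; rewrite /= oner_eq0.
  move=> a a0.
  have bij (f : 'End(M)) : (forall x, f x = 0 -> x = 0) -> bijective f.
    move=> inj; have ker0 : lker f == 0%VS.
      by rewrite -subv0; apply/subvP => x; rewrite memv_ker memv0 => /eqP/inj ->.
    exists (f^-1)%VF; first exact: lker0_lfunK.
    exact: lker0_lfunVK.
  split; [apply: (eq_bij (bij (left_mul a) _)) => x; rewrite left_mulE //
         |apply: (eq_bij (bij (right_mul a) _)) => x; rewrite right_mulE //].
    move=> ax; apply: (cp_eq0 cM); have := cp_mul cM a x; rewrite ax (cp0l cM).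
    by move/esym/eqP; rewrite mulf_eq0 gt_eqF ?(cp_pos cM) //= => /eqP.
  move=> ax; apply: (cp_eq0 cM); have := cp_mul cM x a; rewrite ax (cp0l cM).
  by move/esym/eqP; rewrite mulf_eq0 orbC gt_eqF ?(cp_pos cM) //= => /eqP.
- exists (fun t => form3 t t); split; last by move=> x y; exact: (cp_mul cM).
    split; first by move=> a x; rewrite (cpZl cM) (cpZr cM) mulrA.
    by split=> u a x y; rewrite /= !form3_polar /form3 /= /GRing.scale /=; ring.
  move=> x px; apply: (cp_eq0 cM); have := px x; rewrite form3_polar => /eqP.
  by rewrite mulf_eq0 pnatr_eq0 => /eqP.
Qed.

Lemma model_nonabelian : ~ der_abelian M.
Proof.
move=> ab; have [[du [ddu duE]] [dv [ddv dvE]] _] := rot_derivation g g'.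
have /lfunP/(_ (Y2 : M)) := ab _ _ ddu ddv.
rewrite lie_bracketE zero_lfunE !duE !dvE => h.
have := congr1 (fun t : O => t.2.1.1) h; rewrite /= => /eqP.
by rewrite !(mulr0, oppr0, subr0, addr0) oner_eq0.
Qed.

Lemma octD x0 x1 x2 x3 x4 x5 x6 x7 y0 y1 y2 y3 y4 y5 y6 y7 :
  oct x0 x1 x2 x3 x4 x5 x6 x7 + oct y0 y1 y2 y3 y4 y5 y6 y7 =
  oct (x0 + y0) (x1 + y1) (x2 + y2) (x3 + y3) (x4 + y4) (x5 + y5) (x6 + y6)
    (x7 + y7) :> octonion R.
Proof. by []. Qed.

Section Cube.
Variables a0 a1 a2 a3 a4 a5 a6 a7 : R.
Let a : O := oct a0 a1 a2 a3 a4 a5 a6 a7.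
Let mm := model_mul g g'.

Let square_v : mm Y2 Y2 = oct (- (g' * g)) 0 0 0 0 0 0 0.
Proof. by rewrite /mm model_mulE; apply: oct_eq; ring. Qed.

Let square_v_deriv : mm a Y2 + mm Y2 a =
  oct (- 2 * g' * g * a2)
        (- g * a3 + g' * a3)
        (- g * a0 - g' * a0)
        (g * a1 - g' * a1)
        (3 / 2 * g * a7 + 3 / 2 * g' * a7)
        (- g' * g * a6 - 1 / 2 * g * a7 + 1 / 2 * g' * a7)
        (- 3 / 2 * g * a5 - 3 / 2 * g' * a5)
        (g' * g * a4 + 1 / 2 * g * a5 - 1 / 2 * g' * a5).
Proof.
rewrite /mm /a (model_mulE _ _ a0) (model_mulE _ _ 0) octD.
by apply: oct_eq; field.
Qed.

(** The two cubes of v are g v and g' v. Applying a derivation d to these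
equations constrains d v; unless both signs are 1, it confines d v to the span
of v, z and v z. *)
Lemma cube_left : mm Y2 (mm Y2 Y2) = g *: Y2.
Proof.
rewrite square_v /mm model_mulE octZ; apply: oct_eq; pattern g, g';
  apply: (sign_mul g2 g'2); ring.
Qed.

Lemma cube_right : mm (mm Y2 Y2) Y2 = g' *: Y2.
Proof.
rewrite square_v /mm model_mulE octZ; apply: oct_eq; pattern g, g';
  apply: (sign_mul g2 g'2); ring.
Qed.

Lemma cube_left_deriv : mm a (mm Y2 Y2) + mm Y2 (mm a Y2 + mm Y2 a) =
  oct (g * a0 + g' * a0 - g' * g * a0)
        (- a1 + 2 * g' * g * a1)
        (3 * g * a2)
        (- a3 + 2 * g' * g * a3)
        (g * a4 - 3 / 4 * a5 - 3 / 4 * g * a5 - 3 / 4 * g' * a5 + 9 / 4 * g' * g * a5)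
        (- 1 / 4 * a5 + 3 / 4 * g * a5 + 3 / 4 * g' * a5 - 1 / 4 * g' * g * a5)
        (g * a6 - 3 / 4 * a7 - 3 / 4 * g * a7 - 3 / 4 * g' * a7 + 9 / 4 * g' * g * a7)
        (- 1 / 4 * a7 + 3 / 4 * g * a7 + 3 / 4 * g' * a7 - 1 / 4 * g' * g * a7).
Proof.
rewrite square_v_deriv square_v /mm /a (model_mulE _ _ a0) (model_mulE _ _ 0) octD.
by apply: oct_eq; pattern g, g'; apply: (sign_mul g2 g'2); field.
Qed.

Lemma cube_right_deriv : mm (mm a Y2 + mm Y2 a) Y2 + mm (mm Y2 Y2) a =
  oct (g * a0 + g' * a0 - g' * g * a0)
        (- a1 + 2 * g' * g * a1)
        (3 * g' * a2)
        (- a3 + 2 * g' * g * a3)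
        (g' * a4 + 3 / 4 * a5 + 3 / 4 * g * a5 + 3 / 4 * g' * a5 - 9 / 4 * g' * g * a5)
        (- 1 / 4 * a5 + 3 / 4 * g * a5 + 3 / 4 * g' * a5 - 1 / 4 * g' * g * a5)
        (g' * a6 + 3 / 4 * a7 + 3 / 4 * g * a7 + 3 / 4 * g' * a7 - 9 / 4 * g' * g * a7)
        (- 1 / 4 * a7 + 3 / 4 * g * a7 + 3 / 4 * g' * a7 - 1 / 4 * g' * g * a7).
Proof.
rewrite square_v_deriv square_v /mm /a !model_mulE octD.
by apply: oct_eq; pattern g, g'; apply: (sign_mul g2 g'2); field.
Qed.

End Cube.

Hypothesis g_or : g = -1 \/ g' = -1.

Lemma derivation_v (d : 'End(M)) : derivation d -> (d (Y2 : M) : M) \in linU g g'.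
Proof.
move=> dd.
have c1 := congr1 (d : M -> M) cube_left; have c2 := congr1 (d : M -> M) cube_right.
rewrite (dd (Y2 : M)) (dd (Y2 : M) (Y2 : M)) linearZ /= in c1.
rewrite (dd _ (Y2 : M)) (dd (Y2 : M) (Y2 : M)) linearZ /= in c2.
apply/linUP; move: c1 c2.
have [a0 [a1 [a2 [a3 [a4 [a5 [a6 [a7 ->]]]]]]]] := octP (d (Y2 : M)).
rewrite cube_left_deriv cube_right_deriv !octZ.
case/oct_inj => [[h0 h1 _ h3] [_ h5 _ h7]].
case/oct_inj => [[k0 k1 _ k3] [_ k5 _ k7]].
have gg : (g == -1) && (g' == 1) || (g == 1) && (g' == -1) || (g == -1) && (g' == -1).
  move/eqP: g2; rewrite sqrf_eq1 => /orP[] /eqP ge;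
  move/eqP: g'2; rewrite sqrf_eq1 => /orP[] /eqP g'e;
  rewrite ge g'e !eqxx ?orbT //; by case: g_or; rewrite ?ge ?g'e => /eqP; rewrite -subr_eq0; move=> /eqP; lra.
apply: oct_eq; rewrite /=; case/orP: gg => [/orP[]|] /andP[/eqP ge /eqP g'e];
  rewrite ge g'e in h0 h1 h3 h5 h7 k0 k1 k3 k5 k7 *; clear - h0 h1 h3 h5 h7 k0 k1 k3 k5 k7; lra.
Qed.

End ModelD35.

Section ModelInD35.
Variables (R : realType) (g g' : R).
Hypotheses (g2 : g ^+ 2 = 1) (g'2 : g' ^+ 2 = 1).
Hypothesis g_or : g = -1 \/ g' = -1.
Local Notation O := (octonion R).
Local Notation M := (model g g').
Local Notation Y2 := (oct 0 0 1 0 0 0 0 0 : octonion R).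
Local Notation Y4 := (oct 0 0 0 0 1 0 0 0 : octonion R).
Local Notation Y6 := (oct 0 0 0 0 0 0 1 0 : octonion R).

Lemma rot_linU (x : M) : x \in linU g g' ->
  (rot_v x : M) \in linU g g' /\ (rot_w x : M) \in linU g g'.
Proof.
move=> /linUP; have [x0 [x1 [x2 [x3 [x4 [x5 [x6 [x7 ->]]]]]]]] := octP x.
case/(@oct_inj R _ _ _ _ _ _ _ _ 0 0 0 0 0 0 0 0) => [[/= z0 z1 _ z3] [_ z5 _ z7]].
by split; apply/linUP; apply: oct_eq; rewrite /= ?z0 ?z1 ?z3 ?z5 ?z7; ring.
Qed.

(** As z and v z are images of v under rotations e, and
d e = e d + [d, e], the statement about d v suffices. *)
Lemma linU_stable : der_submodule (linU g g').
Proof.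
move=> d dd; rewrite limg_span; apply/span_subvP => _ /mapP[y yin ->].
have [_ [dv [ddv dvE]] [dw [ddw dwE]]] := rot_derivation g g'.
have other (e : 'End(M)) (rot : O -> O) : derivation e -> (forall x, e x = rot x) ->
    (forall x : M, x \in linU g g' -> (rot x : M) \in linU g g') ->
    (d (rot Y2 : M) : M) \in linU g g'.
  move=> de eE rotU; rewrite -eE.
  have -> : d (e (Y2 : M)) = e (d (Y2 : M)) + lie_bracket d e (Y2 : M).
    by rewrite lie_bracketE addrC subrK.
  rewrite memvD //; first by rewrite eE; apply: rotU; apply: derivation_v.
  exact/derivation_v/derivation_bracket.
move: yin; rewrite !inE => /or3P[] /eqP ->; first exact: derivation_v.
  have -> : Y4 = rot_w Y2 by apply: oct_eq; rewrite /=; ring.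
  by apply: other ddw dwE _ => x /rot_linU[].
have -> : Y6 = rot_v Y2 by apply: oct_eq; rewrite /=; ring.
by apply: other ddv dvE _ => x /rot_linU[].
Qed.

Lemma symV_stable : der_submodule (symV g g').
Proof.
have cM := model_composition g2 g'2.
move=> d dd; apply/subvP => _ /memv_imgP[x /symVP lx ->]; apply/symVP.
have orth (u : M) : u \in linU g g' -> form3 (d x) u = 0.
  move=> uU; rewrite (derivation_skew cM dd).
  have /linUP : d u \in linU g g' := subvP (linU_stable dd) _ (memv_img d uU).
  move: lx; have [x0 [x1 [x2 [x3 [x4 [x5 [x6 [x7 ->]]]]]]]] := octP x.
  have [u0 [u1 [u2 [u3 [u4 [u5 [u6 [u7 ->]]]]]]]] := octP (d u).
  case/(@oct_inj R _ _ _ _ _ _ _ _ 0 0 0 0 0 0 0 0) => [[/= _ _ z2 _] [z4 _ z6 _]].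
  case/(@oct_inj R _ _ _ _ _ _ _ _ 0 0 0 0 0 0 0 0) => [[/= z0 z1 _ z3] [_ z5 _ z7]].
  by rewrite /form3 /= z0 z1 z2 z3 z4 z5 z6 z7; ring.
have o2 := orth Y2; have o4 := orth Y4; have o6 := orth Y6.
move: o2 o4 o6; have [x0 [x1 [x2 [x3 [x4 [x5 [x6 [x7 ->]]]]]]]] := octP (d x).
rewrite /form3 /= => o2 o4 o6.
have {}o2 : x2 = 0.
  by rewrite -[RHS]o2; [ring | apply/linUP].
have {}o4 : x4 = 0.
  by rewrite -[RHS]o4; [ring | apply/linUP].
have {}o6 : x6 = 0.
  by rewrite -[RHS]o6; [ring | apply/linUP].
by rewrite o2 o4 o6.
Qed.

Lemma model_D35 : cat_D35 M.
Proof.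
split; first by split; [exact: model_A8 | exact: model_nonabelian].
have [full dir dimU dimV] := linU_symV g g'.
exists (linU g g'), (symV g g'); split=> //; split=> //.
  exact/linU_irreducible/linU_stable.
exact/symV_irreducible/symV_stable.
Qed.

End ModelInD35.

Section Okubo.
Variable R : realType.
Local Notation O := (octonion R).
Local Notation M := (model (1 : R) 1).

(** For both signs equal to 1 the model is the Okubo algebra, whose derivations
form su(3) and do not preserve the span of v, z, v z. One such derivation is
the commutator with the unit octonion, an idempotent of the Okubo product. *)
Lemma okubo_moves :
  exists2 d : 'End(M), derivation d &
    exists2 x : M, x \in linU 1 1 & d x \notin linU 1 1.
Proof.
pose f (x : O) := model_mul 1 1 (oct 1 0 0 0 0 0 0 0) x -
                  model_mul 1 1 x (oct 1 0 0 0 0 0 0 0).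
have fE x0 x1 x2 x3 x4 x5 x6 x7 : f (oct x0 x1 x2 x3 x4 x5 x6 x7) =
  oct 0 0 0 0 (3 * x5) (- x4) (3 * x7) (- x6).
  rewrite /f -scaleN1r [in LHS]addrC !model_mulE oct_linear.
  by apply: oct_eq; field.
have [|d dE] := @linear_lfun R O O f.
  move=> a x y.
  have [x0 [x1 [x2 [x3 [x4 [x5 [x6 [x7 ->]]]]]]]] := octP x.
  have [y0 [y1 [y2 [y3 [y4 [y5 [y6 [y7 ->]]]]]]]] := octP y.
  by rewrite oct_linear !fE oct_linear; apply: oct_eq; ring.
exists (d : 'End(M)).
  move=> x y; rewrite !dE.
  have [x0 [x1 [x2 [x3 [x4 [x5 [x6 [x7 ->]]]]]]]] := octP x.
  have [y0 [y1 [y2 [y3 [y4 [y5 [y6 [y7 ->]]]]]]]] := octP y.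
  by rewrite /= model_mulE !fE !model_mulE octD; apply: oct_eq; field.
exists (oct 0 0 0 0 1 0 0 0 : M); first by apply/linUP.
rewrite dE fE; apply/negP => /linUP.
case/(@oct_inj R _ _ _ _ _ _ _ _ 0 0 0 0 0 0 0 0) => [_ [_ /eqP]].
by rewrite /= oppr_eq0 oner_eq0.
Qed.

End Okubo.

(** * Octonion identities and doubling *)

Section OctonionIdentities.
Variable R : realType.
Local Notation O := (octonion R).
Local Notation conj := (@oconj_fun R).

Lemma omul_oct (x0 x1 x2 x3 x4 x5 x6 x7 y0 y1 y2 y3 y4 y5 y6 y7 : R) :
  omul (oct x0 x1 x2 x3 x4 x5 x6 x7) (oct y0 y1 y2 y3 y4 y5 y6 y7) =
  oct (x0 * y0 - x1 * y1 - x2 * y2 - x3 * y3 - x4 * y4 - x5 * y5 - x6 * y6 - x7 * y7)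
      (x0 * y1 + x1 * y0 + x2 * y3 - x3 * y2 + x4 * y5 - x5 * y4 - x6 * y7 + x7 * y6)
      (x0 * y2 - x1 * y3 + x2 * y0 + x3 * y1 + x4 * y6 + x5 * y7 - x6 * y4 - x7 * y5)
      (x0 * y3 + x1 * y2 - x2 * y1 + x3 * y0 + x4 * y7 - x5 * y6 + x6 * y5 - x7 * y4)
      (x0 * y4 - x1 * y5 - x2 * y6 - x3 * y7 + x4 * y0 + x5 * y1 + x6 * y2 + x7 * y3)
      (x0 * y5 + x1 * y4 - x2 * y7 + x3 * y6 - x4 * y1 + x5 * y0 - x6 * y3 + x7 * y2)
      (x0 * y6 + x1 * y7 + x2 * y4 - x3 * y5 - x4 * y2 + x5 * y3 + x6 * y0 - x7 * y1)
      (x0 * y7 - x1 * y6 + x2 * y5 + x3 * y4 - x4 * y3 - x5 * y2 + x6 * y1 + x7 * y0).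
Proof. by rewrite /omul /cd_mul /=; apply: oct_eq; rewrite /=; ring. Qed.

Lemma conj_oct (x0 x1 x2 x3 x4 x5 x6 x7 : R) :
  conj (oct x0 x1 x2 x3 x4 x5 x6 x7) =
  oct x0 (- x1) (- x2) (- x3) (- x4) (- x5) (- x6) (- x7).
Proof. by []. Qed.

Lemma odot_oct (x0 x1 x2 x3 x4 x5 x6 x7 y0 y1 y2 y3 y4 y5 y6 y7 : R) :
  odot (oct x0 x1 x2 x3 x4 x5 x6 x7) (oct y0 y1 y2 y3 y4 y5 y6 y7) =
  x0 * y0 + x1 * y1 + x2 * y2 + x3 * y3 + x4 * y4 + x5 * y5 + x6 * y6 + x7 * y7.
Proof. by rewrite /odot /cd_dot /=; ring. Qed.

Lemma oone_oct : oone R = oct 1 0 0 0 0 0 0 0.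
Proof. by []. Qed.

Ltac oct_coords x :=
  let E := fresh in
  have [? [? [? [? [? [? [? [? E]]]]]]]] := octP x; rewrite E; clear E.
Ltac oct_compute :=
  rewrite ?oone_oct ?(omul_oct, conj_oct, octZ, octD, odot_oct) /=.

Lemma octonion_composition : composition_product (@odot R : octonions R -> octonions R -> R).
Proof.
split.
- by move=> x y; oct_coords x; oct_coords y; oct_compute; ring.
- move=> a x y z; oct_coords x; oct_coords y; oct_coords z; oct_compute; ring.
- move=> x; have [x0 [x1 [x2 [x3 [x4 [x5 [x6 [x7 ->]]]]]]]] := octP x.
  apply: contraNT; rewrite odot_oct -leNgt => le0.
  have sq (t : R) : 0 <= t * t by rewrite -expr2 sqr_ge0.
  have z (t : R) : t * t <= 0 -> t = 0.
    by move=> t0; apply/eqP; rewrite -sqrf_eq0 expr2 eq_le t0 sq.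
  have := sq x0; have := sq x1; have := sq x2; have := sq x3.
  have := sq x4; have := sq x5; have := sq x6; have := sq x7.
  move=> h7 h6 h5 h4 h3 h2 h1 h0; apply/eqP.
  by apply: oct_eq; apply: z; lra.
- by move=> x y; oct_coords x; oct_coords y; oct_compute; ring.
Qed.

Lemma omul_conj_left (x y w : O) :
  omul x (omul (conj y) w) + omul y (omul (conj x) w) = (2 * odot x y) *: w.
Proof. by oct_coords x; oct_coords y; oct_coords w; oct_compute; apply: oct_eq; rewrite /=; ring. Qed.

Lemma omul_conj_right (x y w : O) :
  omul (omul w (conj y)) x + omul (omul w (conj x)) y = (2 * odot x y) *: w.
Proof. by oct_coords x; oct_coords y; oct_coords w; oct_compute; apply: oct_eq; rewrite /=; ring. Qed.

Lemma conj_omul (x y : O) : conj (omul x y) = omul (conj y) (conj x).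
Proof. by oct_coords x; oct_coords y; oct_compute; apply: oct_eq; rewrite /=; ring. Qed.

Lemma conjK (x : O) : conj (conj x) = x.
Proof. by oct_coords x; oct_compute; apply: oct_eq; rewrite /=; ring. Qed.

Lemma conj_trace (x : O) : conj x = (2 * odot x (oone R)) *: oone R - x.
Proof.
rewrite -[- x]scaleN1r; oct_coords x.
rewrite oone_oct odot_oct conj_oct [-1 *: _]octZ [(2 * _) *: _]octZ octD.
by apply: oct_eq; rewrite /=; ring.
Qed.

Lemma odot_omul_one (x y : O) : odot (omul x y) (oone R) = odot (conj x) y.
Proof. by oct_coords x; oct_coords y; oct_compute; ring. Qed.

Lemma omul1 (x : O) : omul x (oone R) = x.
Proof. by oct_coords x; oct_compute; apply: oct_eq; rewrite /=; ring. Qed.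

Lemma omul1l (x : O) : omul (oone R) x = x.
Proof. by oct_coords x; oct_compute; apply: oct_eq; rewrite /=; ring. Qed.

Lemma omul_conj (x : O) : omul x (conj x) = odot x x *: oone R.
Proof. by oct_coords x; oct_compute; apply: oct_eq; rewrite /=; ring. Qed.

End OctonionIdentities.

Section Doubling.
Variable R : realType.
Local Notation O := (octonion R).
Local Notation conj := (@oconj_fun R).
Local Notation "x ** y" := (omul x y) (at level 40, left associativity).
Local Notation one := (oone R).

Let cO := octonion_composition R.

Lemma oconjN (x : O) : conj (- x) = - conj x. Proof. exact: linearN. Qed.
Lemma oconjD (x y : O) : conj (x + y) = conj x + conj y. Proof. exact: linearD. Qed.
Lemma omulDl (x y w : O) : (x + y) ** w = x ** w + y ** w. Proof. exact: linearDl. Qed.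
Lemma omulDr (x y w : O) : w ** (x + y) = w ** x + w ** y. Proof. exact: linearDr. Qed.
Lemma omulNl (x w : O) : (- x) ** w = - (x ** w). Proof. exact: linearNl. Qed.
Lemma omulNr (x w : O) : w ** (- x) = - (w ** x). Proof. exact: linearNr. Qed.
Lemma omulZl (a : R) (x w : O) : (a *: x) ** w = a *: (x ** w). Proof. exact: linearZl_LR. Qed.
Lemma omulZr (a : R) (x w : O) : w ** (a *: x) = a *: (w ** x). Proof. exact: linearZr_LR. Qed.

Definition imaginary_unit (z : O) := odot z one = 0 /\ odot z z = 1.

Lemma conj_imaginary (z : O) : odot z one = 0 -> conj z = - z.
Proof. by move=> z1; rewrite conj_trace z1 mulr0 scale0r sub0r. Qed.

Lemma imaginary_unit_square (z w : O) : imaginary_unit z -> z ** (z ** w) = - w.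
Proof.
move=> [z1 zz]; have := omul_conj_left z z w.
rewrite (conj_imaginary z1) zz omulNl omulNr -opprD -mulr2n mulr1 scaler_nat.
move=> /eqP; rewrite eqr_oppLR -mulNrn -!scaler_nat => /eqP.
by apply: scalerI; rewrite pnatr_eq0.
Qed.

(** One step of the Cayley-Dickson process inside the octonions: a copy of a
subalgebra, closed under conjugation, together with a unit z orthogonal to it,
generates a copy of the doubled algebra. *)
Section Step.
Variables (V : lmodType R) (m : V -> V -> V) (c : V -> V) (psi : V -> O) (z : O).
Hypotheses (psi_lin : linear psi) (psi_mul : forall a b, psi (m a b) = psi a ** psi b).
Hypothesis psi_conj : forall a, psi (c a) = conj (psi a).
Hypothesis z_unit : imaginary_unit z.
Hypothesis z_perp : forall a, odot z (psi a) = 0.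

Let z1 : odot z one = 0. Proof. by case: z_unit. Qed.
Let perp a : odot (psi a) z = 0. Proof. by rewrite (cpC cO). Qed.

Lemma doubling_trace a : odot (psi a ** z) one = 0.
Proof. by rewrite odot_omul_one -psi_conj perp. Qed.

Lemma doubling_swap a : psi a ** z = z ** conj (psi a).
Proof.
have := conj_imaginary (doubling_trace a); rewrite conj_omul (conj_imaginary z1).
by rewrite omulNl => /oppr_inj.
Qed.

(** Both sides arise from conjugates of psi b, moving psi a past the orthogonal z
by the linearized identity x (conj y w) + y (conj x w) = 2 <x, y> w. *)
Lemma doubling_left a b : psi a ** (psi b ** z) = psi (m b a) ** z.
Proof.
rewrite doubling_swap doubling_swap psi_mul conj_omul.
have := omul_conj_left (psi a) z (conj (psi b)).
rewrite perp mulr0 scale0r (conj_imaginary z1) omulNl omulNr addrC => /eqP.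
rewrite subr_eq0 => /eqP e; exact: (esym e).
Qed.

Lemma doubling_right a b : (psi a ** z) ** psi b = psi (m a (c b)) ** z.
Proof.
rewrite psi_mul psi_conj.
have := omul_conj_right (psi b) (- z) (psi a).
rewrite oconjN (conj_imaginary z1) opprK omulNr (cpNr cO) perp oppr0 mulr0 scale0r.
move=> /eqP; rewrite subr_eq0 => /eqP e; exact: e.
Qed.

Lemma doubling_both a b : (psi a ** z) ** (psi b ** z) = - psi (m (c b) a).
Proof.
rewrite (doubling_swap b) psi_mul psi_conj.
have := omul_conj_left (psi a ** z) (- z) (conj (psi b)).
rewrite oconjN (conj_imaginary z1) opprK (conj_imaginary (doubling_trace a)).
rewrite !omulNl omulNr opprK (cpNr cO).
have -> : odot (psi a ** z) z = odot (psi a) one.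
  rewrite -[z in odot _ z]omul1l (cp_mulr cO) /=.
  by case: z_unit => _ ->; rewrite mul1r.
have -> : psi a ** z ** conj (psi b) = z ** conj (psi (m a b)).
  by rewrite -doubling_swap -psi_conj doubling_right !psi_mul !psi_conj conjK.
rewrite imaginary_unit_square // psi_mul conj_omul mulrN scaleNr.
move=> /eqP; rewrite subr_eq => /eqP ->.
rewrite [conj (psi a)]conj_trace (omulDr (_ *: _)) omulZr omul1 omulNr.
by rewrite addrA addNr sub0r.
Qed.

Lemma doubling (x y : V * V) (psi' := fun p : V * V => psi p.1 + psi p.2 ** z) :
  [/\ psi' (cd_mul m c x y) = psi' x ** psi' y,
      psi' (cd_conj c x) = conj (psi' x) & linear psi'].
Proof.
have psiD a b : psi (a + b) = psi a + psi b.
  by rewrite -[a]scale1r psi_lin !scale1r.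
have psi0 : psi 0 = 0 by apply: (addrI (psi 0)); rewrite -psiD !addr0.
have psiN a : psi (- a) = - psi a.
  by apply/eqP; rewrite -addr_eq0 -psiD addNr psi0.
split.
- have regroup (V' : zmodType) (s t u v : V') : s - t + (u + v) = s + u + (v - t).
    by rewrite addrACA [- t + v]addrC.
  rewrite /psi' /= omulDl (omulDr _ _ (psi _)) (omulDr _ _ (_ ** z)).
  rewrite doubling_left doubling_right doubling_both -psi_mul psiD psiN.
  by rewrite [psi (m y.2 x.1 + _)]psiD omulDl; exact: regroup.
- rewrite /psi' /= psi_conj psiN omulNl oconjD.
  by rewrite [conj (_ ** z)]conj_imaginary // doubling_trace.
- by move=> a p q; rewrite /psi' /= !psi_lin omulDl omulZl scalerDr addrACA.
Qed.

End Step.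
End Doubling.

(** * Octonions of a Cayley triple *)

Section UnitalIsometry.
Variables (R : realType) (psi : octonion R -> octonion R).
Hypotheses (psi_lin : linear psi)
  (psi_mul : forall x y, psi (omul3 x y) = omul (psi x) (psi y))
  (psi_conj : forall x, psi (oconj_fun x) = oconj_fun (psi x))
  (psi1 : psi (oct 1 0 0 0 0 0 0 0) = oone R).

Lemma omul3_conj (x : octonion R) :
  omul3 x (oconj_fun x) = form3 x x *: oct 1 0 0 0 0 0 0 0.
Proof.
have [a0 [a1 [a2 [a3 [a4 [a5 [a6 [a7 ->]]]]]]]] := octP x.
by rewrite octZ /omul3 /cd_mul /form3 /=; apply: oct_eq; rewrite /=; ring.
Qed.

(** The norm is recovered from the product, as x times its conjugate. *)
Lemma unital_isometry x y : odot (psi x) (psi y) = form3 x y.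
Proof.
have cO := octonion_composition R.
have cM := @model_composition R 1 1 (expr1n _ _) (expr1n _ _).
have one1 : odot (oone R) (oone R) = 1 by rewrite odot_oct; ring.
have psiD a w : psi (a + w) = psi a + psi w.
  by have := psi_lin 1 a w; rewrite !scale1r.
have psi0 : psi 0 = 0 by apply: (addrI (psi 0)); rewrite -psiD !addr0.
have psiZ a w : psi (a *: w) = a *: psi w.
  by rewrite -[a *: w]addr0 psi_lin psi0 addr0.
have q x0 : odot (psi x0) (psi x0) = form3 x0 x0.
  have := congr1 (odot (oone R)) (congr1 psi (omul3_conj x0)).
  rewrite psi_mul psi_conj omul_conj (psiZ (form3 x0 x0)) psi1.
  have zr (a : R) : odot (oone R) (a *: oone R) = a.
    by rewrite (cpZr cO) one1 mulr1.
  by move=> e; exact: (etrans (esym (zr _)) (etrans e (zr _))).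
have bC : odot (psi y) (psi x) = odot (psi x) (psi y) := cp_sym cO _ _.
have := q (x + y); rewrite psiD (cpDl cO (psi x)) !(cpDr cO (psi x)) !q bC.
rewrite (cpDl cM x y) !(cpDr cM x y) (cp_sym cM y x).
by move: (odot _ _) (form3 _ _) (form3 _ _) (form3 _ _) => ? ? ? ? ?; lra.
Qed.

End UnitalIsometry.

Section Embedding.
Variable R : realType.
Local Notation O := (octonion R).
Local Notation conj := (@oconj_fun R).
Local Notation "x ** y" := (omul x y) (at level 40, left associativity).
Local Notation one := (oone R).
Variables (u v z : O).
Hypothesis uvz : cayley_triple u v z.
Local Notation s := (Num.sqrt (3 : R)).

Let cO := octonion_composition R.
Let c1 := cd_conj (id : R^o -> R^o).
Let c2 := cd_conj c1.
Let m2 := cd_mul (@qmul3 R) c1.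

Definition embed2 (x : (R^o * R^o)%type) : O := x.1 *: one + (x.2 * s) *: u.
Definition embed4 (x : ((R^o * R^o) * (R^o * R^o))%type) : O :=
  embed2 x.1 + embed2 x.2 ** v.
(** The isomorphism from the rational coordinates to the octonions that is given
by a Cayley triple, built by three doublings. *)
Definition embed8 (x : O) : O := embed4 x.1 + embed4 x.2 ** z.

Let one1 : odot one one = 1 :> R.
Proof. by rewrite odot_oct; ring. Qed.

Let s2 : s * s = 3.
Proof. by rewrite -expr2 sqr_sqrtr // ler0n. Qed.

Let u_unit : imaginary_unit u.
Proof. by case: uvz => [[uu _ _] _ [u1 _ _] _]. Qed.
Let v_unit : imaginary_unit v.
Proof. by case: uvz => [[_ vv _] _ [_ v1 _] _]. Qed.
Let z_unit : imaginary_unit z.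
Proof. by case: uvz => [[_ _ zz] _ [_ _ z1] _]. Qed.

Lemma embed2P : [/\ linear embed2, forall x y, embed2 (qmul3 x y) = embed2 x ** embed2 y,
  forall x, embed2 (c1 x) = conj (embed2 x) & forall x, odot v (embed2 x) = 0].
Proof.
have regroup (E : lmodType R) (a x1 x2 y1 y2 : R) (e f : E) :
    (a * x1 + y1) *: e + ((a * x2 + y2) * s) *: f =
    a *: (x1 *: e + (x2 * s) *: f) + (y1 *: e + (y2 * s) *: f).
  by rewrite mulrDl !scalerDl scalerDr !scalerA -mulrA addrACA.
have uu : u ** u = - one by rewrite -[X in _ ** X]omul1 imaginary_unit_square.
split.
- by move=> a [x1 x2] [y1 y2]; exact: regroup.
- move=> [x1 x2] [y1 y2]; rewrite /embed2 /=.
  rewrite !omulDl !omulDr !omulZl !omulZr omul1 omul1l uu omul1.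
  apply: (cp_inj cO) => w; rewrite !(cpE cO).
  move: s s2 (odot one w) (odot u w) => t e p q.
  by ring: e.
- move=> [x1 x2]; rewrite /embed2 /= oconjD.
  have -> : conj (x1 *: one) = x1 *: one.
    by rewrite oone_oct octZ conj_oct; apply: oct_eq; rewrite /=; ring.
  have -> : conj ((x2 * s) *: u) = (x2 * s) *: conj u by exact: linearZ.
  by case: u_unit => u1 _; rewrite (conj_imaginary u1) scalerN mulNr scaleNr.
- move=> [x1 x2]; rewrite /embed2 /= !(cpE cO).
  case: uvz => _ [uv _ _] [_ v1 _] _.
  by rewrite v1 (cpC cO) uv !mulr0 addr0.
Qed.

Lemma embed4P : [/\ linear embed4, forall x y, embed4 (m2 x y) = embed4 x ** embed4 y,
  forall x, embed4 (c2 x) = conj (embed4 x) & forall x, odot z (embed4 x) = 0].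
Proof.
have [l2 mul2 conj2 perp2] := embed2P.
have D x y := doubling l2 mul2 conj2 v_unit perp2 x y.
split.
- by have [_ _ l] := D 0 0; exact: l.
- by move=> x y; have [mu _ _] := D x y; exact: mu.
- by move=> x; have [_ co _] := D x x; exact: co.
- move=> x; rewrite /embed4 /embed2 omulDl omulZl omulZl omul1l !(cpE cO).
  case: uvz => _ [_ uz vz] [_ _ z1] zuv.
  by rewrite z1 zuv [odot z u](cpC cO) uz [odot z v](cpC cO) vz !mulr0 !addr0.
Qed.

Lemma embed8P : [/\ linear embed8, forall x y, embed8 (omul3 x y) = embed8 x ** embed8 y
  & forall x, embed8 (conj x) = conj (embed8 x)].
Proof.
have [l4 mul4 conj4 perp4] := embed4P.
have D x y := doubling l4 mul4 conj4 z_unit perp4 x y.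
split.
- by have [_ _ l] := D 0 0; exact: l.
- by move=> x y; have [mu _ _] := D x y; exact: mu.
- by move=> x; have [_ co _] := D x x; exact: co.
Qed.

Lemma embed8_one : embed8 (oct 1 0 0 0 0 0 0 0) = one.
Proof.
rewrite /embed8 /embed4 /embed2 /= mul0r !scale0r scale1r !addr0.
have o0 (w : O) : 0 ** w = 0 by exact: linear0l.
by rewrite !o0 !addr0 !o0 addr0.
Qed.

Lemma embed8_generators : [/\ embed8 (oct 0 1 0 0 0 0 0 0) = s *: u,
  embed8 (oct 0 0 1 0 0 0 0 0) = v & embed8 (oct 0 0 0 0 1 0 0 0) = z].
Proof.
have o0 (w : O) : 0 ** w = 0 by exact: linear0l.
have o1 (w : O) : one ** w = w by exact: omul1l.
have e0 : embed2 (0, 0) = 0 by rewrite /embed2 /= mul0r !scale0r addr0.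
have e1 : embed2 (1, 0) = one by rewrite /embed2 /= mul0r scale0r addr0 scale1r.
have eu : embed2 (0, 1) = s *: u by rewrite /embed2 /= mul1r scale0r add0r.
have f0 : embed4 ((0, 0), (0, 0)) = 0 by rewrite /embed4 /= e0 o0 addr0.
have f1 : embed4 ((1, 0), (0, 0)) = one by rewrite /embed4 /= e0 e1 o0 addr0.
have fu : embed4 ((0, 1), (0, 0)) = s *: u by rewrite /embed4 /= e0 eu o0 addr0.
have fv : embed4 ((0, 0), (1, 0)) = v by rewrite /embed4 /= e0 e1 o1 add0r.
by rewrite /embed8 /= f0 f1 fu fv o0 o1 !addr0 add0r.
Qed.

Lemma embed8_isometry x y : odot (embed8 x) (embed8 y) = form3 x y.
Proof.
have [l8 mul8 conj8] := embed8P.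
exact: (unital_isometry l8 mul8 conj8 embed8_one).
Qed.

End Embedding.

(** * The isotopes P are models *)

Section IsotopeModel.
Variable R : realType.
Local Notation O := (octonion R).
Local Notation "x ** y" := (omul x y) (at level 40, left associativity).
Local Notation s := (Num.sqrt (3 : R)).
Local Notation Y0 := (oct 1 0 0 0 0 0 0 0 : O).
Local Notation Y1 := (oct 0 1 0 0 0 0 0 0 : O).
Local Notation Y2 := (oct 0 0 1 0 0 0 0 0 : O).
Local Notation Y3 := (oct 0 0 0 1 0 0 0 0 : O).
Local Notation Y4 := (oct 0 0 0 0 1 0 0 0 : O).
Local Notation Y5 := (oct 0 0 0 0 0 1 0 0 : O).
Local Notation Y6 := (oct 0 0 0 0 0 0 1 0 : O).
Local Notation Y7 := (oct 0 0 0 0 0 0 0 1 : O).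

Lemma omul3_generators :
  [/\ omul3 Y1 Y2 = Y3, omul3 Y1 Y4 = Y5, omul3 Y2 Y4 = Y6 & omul3 Y3 Y4 = Y7].
Proof. by split; rewrite /omul3 /cd_mul /=; apply: oct_eq; rewrite /=; ring. Qed.

Lemma linear_zero (V : lmodType R) (F : O -> V) : linear F -> F 0 = 0.
Proof.
move=> lF; apply: (addrI (F 0)).
by have := lF 1 0 0; rewrite !scale1r !addr0 => h; rewrite -h.
Qed.

Lemma lin_part_gen (V : lmodType R) (F : O -> V) : linear F -> forall x,
  F (lin_part x) = x.1.2.1 *: F Y2 + (x.2.1.1 *: F Y4 + x.2.2.1 *: F Y6).
Proof.
move=> lF x; rewrite lin_partE.
have F0 := linear_zero lF; move: F0.
have [Z0 Z0E] : exists t : O, t = 0 by exists 0.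
rewrite -[oct 0 0 0 0 0 0 0 0]/(0 : O) -Z0E.
by move: Y2 Y4 Y6 => A B C F0; rewrite !lF F0 addr0.
Qed.

Lemma sym_part_gen (V : lmodType R) (F : O -> V) : linear F -> forall x,
  F (sym_part x) = x.1.1.1 *: F Y0 + (x.1.1.2 *: F Y1 +
  (x.1.2.2 *: F Y3 + (x.2.1.2 *: F Y5 + x.2.2.2 *: F Y7))).
Proof.
move=> lF x; rewrite sym_partE.
have F0 := linear_zero lF; move: F0.
have [Z0 Z0E] : exists t : O, t = 0 by exists 0.
rewrite -[oct 0 0 0 0 0 0 0 0]/(0 : O) -Z0E.
by move: Y0 Y1 Y3 Y5 Y7 => A B C D E F0; rewrite !lF F0 addr0.
Qed.

(** The octonions are generated by u, v and z, so two homomorphisms that agree on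
these are equal. *)
Lemma generated_eq (F G : O -> O) : linear F -> linear G ->
    (forall x y, F (omul3 x y) = F x ** F y) ->
    (forall x y, G (omul3 x y) = G x ** G y) ->
    F Y0 = G Y0 -> F Y1 = G Y1 -> F Y2 = G Y2 -> F Y4 = G Y4 ->
  forall x, F x = G x.
Proof.
move=> lF lG mF mG e0 e1 e2 e4 x.
have [g3 g5 g6 g7] := omul3_generators.
have e3 : F Y3 = G Y3 by rewrite -g3 mF mG e1 e2.
have e5 : F Y5 = G Y5 by rewrite -g5 mF mG e1 e4.
have e6 : F Y6 = G Y6 by rewrite -g6 mF mG e2 e4.
have e7 : F Y7 = G Y7 by rewrite -g7 mF mG e3 e4.
have D (H : O -> O) : linear H -> H x = H (lin_part x) + H (sym_part x).
  by move=> lH; rewrite {1}[x]parts -[lin_part x]scale1r lH !scale1r.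
rewrite (D F lF) (D G lG) (lin_part_gen lF) (lin_part_gen lG) (sym_part_gen lF).
by rewrite (sym_part_gen lG) e0 e1 e2 e3 e4 e5 e6 e7.
Qed.

Lemma tau3_mul (t : R) (x y : O) : t ^+ 2 = 1 ->
  tau3 t (omul3 x y) = omul3 (tau3 t x) (tau3 t y).
Proof.
move=> /eqP; rewrite sqrf_eq1.
have [x0 [x1 [x2 [x3 [x4 [x5 [x6 [x7 ->]]]]]]]] := octP x.
have [y0 [y1 [y2 [y3 [y4 [y5 [y6 [y7 ->]]]]]]]] := octP y.
by case/orP => /eqP ->; rewrite /omul3 /cd_mul /=; apply: oct_eq; rewrite /=; field.
Qed.

Lemma tau3K (x : O) : tau3 1 (tau3 (-1) x) = x.
Proof.
have [x0 [x1 [x2 [x3 [x4 [x5 [x6 [x7 ->]]]]]]]] := octP x.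
by apply: oct_eq; rewrite /=; field.
Qed.

Variables (u v z : O) (tau sigma : 'End(O)).
Hypothesis uvz : cayley_triple u v z.
Hypotheses (tau_G2 : in_G2 tau) (tau_u : tau u = u) (tau_v : tau v = v).
Hypothesis tau_z : tau z = 2^-1 *: omul z (Num.sqrt 3 *: u - oone R).
Hypothesis sigma_W : is_reflection <<[:: v; z; omul v z]>>%VS sigma.

Variable psi : O -> O.
Hypotheses (psi_lin : linear psi)
  (psi_mul : forall x y, psi (omul3 x y) = psi x ** psi y)
  (psi_conj : forall x, psi (oconj_fun x) = oconj_fun (psi x))
  (psi0 : psi Y0 = oone R) (psi1 : psi Y1 = s *: u)
  (psi2 : psi Y2 = v) (psi4 : psi Y4 = z).

Let psiD x y : psi (x + y) = psi x + psi y.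
Proof. by have := psi_lin 1 x y; rewrite !scale1r. Qed.
Let psiZ (a : R) x : psi (a *: x) = a *: psi x.
Proof. by rewrite -[a *: x]addr0 psi_lin (linear_zero psi_lin) addr0. Qed.

(** The product u z is imaginary, as u is orthogonal to z, so conjugating it
negates it and exchanges the factors. *)
Lemma imaginary_anticommute : z ** u = - (u ** z).
Proof.
case: uvz => _ [_ uz _] [u1 _ z1] _.
have c : odot (u ** z) (oone R) = 0.
  by rewrite odot_omul_one (conj_imaginary u1) (cpNl (octonion_composition R)) uz oppr0.
rewrite -(conj_imaginary c) conj_omul (conj_imaginary z1) (conj_imaginary u1).
by rewrite omulNl omulNr opprK.
Qed.

Lemma tau_one : tau (oone R) = oone R.
Proof.
have [[_ tau_hom] [k [_ _ /lfunP tk]]] := tau_G2.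
have tkE x : tau (k x) = x by have := tk x; rewrite comp_lfunE id_lfunE.
rewrite -[LHS]omul1 -[X in _ ** X]tkE.
by rewrite -[LHS]tau_hom /= omul1l tkE.
Qed.

Lemma tau_psi (x : O) : tau (psi x) = psi (tau3 1 x).
Proof.
have [[_ tau_hom] _] := tau_G2.
have l3 := @tau3_linear R 1.
apply: (generated_eq (F := fun x => tau (psi x)) (G := fun x => psi (tau3 1 x))).
- by move=> a p q; rewrite psi_lin linearP.
- by move=> a p q; rewrite l3 psi_lin.
- by move=> p q; rewrite psi_mul; exact: tau_hom.
- by move=> p q; rewrite tau3_mul ?expr1n // psi_mul.
- rewrite psi0 tau_one -psi0; congr psi.
  by apply: oct_eq; rewrite /=; field.
- rewrite psi1 linearZ /= tau_u -psi1; congr psi.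
  by apply: oct_eq; rewrite /=; field.
- rewrite psi2 tau_v -psi2; congr psi.
  by apply: oct_eq; rewrite /=; field.
- have [_ g5 _ _] := omul3_generators.
  have -> : tau3 1 Y4 = (- 2^-1) *: Y4 + (- 2^-1) *: Y5.
    by rewrite [_ *: Y4]octZ [_ *: Y5]octZ octD; apply: oct_eq; rewrite /=; field.
  rewrite psi_lin psiZ -g5 psi_mul psi4 psi1 tau_z omulDr omulNr omul1 omulZr.
  rewrite imaginary_anticommute omulZl scalerDr !scalerN !scaleNr addrC.
  by congr (_ - _); rewrite !scalerN.
Qed.

Lemma tauV_psi (x : O) : (tau^-1)%VF (psi x) = psi (tau3 (-1) x).
Proof.
have [_ [k [_ /lfunP kt _]]] := tau_G2.
have ktE y : k (tau y) = y by have := kt y; rewrite comp_lfunE id_lfunE.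
have ker0 : lker tau == 0%VS by apply/lker0P; exact: can_inj ktE.
by rewrite -{1}[x]tau3K -tau_psi lker0_lfunK.
Qed.

Hypothesis psi_iso : forall x y, odot (psi x) (psi y) = form3 x y.

Lemma sigma_psi (x : O) : sigma (psi x) = psi (sig3 (-1) x).
Proof.
have [_ _ g6 _] := omul3_generators.
have [sW sWc] := sigma_W.
have psi6 : psi Y6 = v ** z by rewrite -g6 psi_mul psi2 psi4.
have linW (t : O) : psi (lin_part t) \in <<[:: v; z; v ** z]>>%VS.
  rewrite (lin_part_gen psi_lin) psi2 psi4 psi6.
  by rewrite !memvD // memvZ // memv_span // !inE eqxx ?orbT.
have sym_perp w : w \in <<[:: v; z; v ** z]>>%VS -> odot (psi (sym_part x)) w = 0.
  move=> /mem_span3[[[k1 k2] k3] /= ->]; rewrite -addrA.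
  have -> : k1 *: v + (k2 *: z + k3 *: (v ** z)) = psi (lin_part (oct 0 0 k1 0 k2 0 k3 0)).
    by rewrite (lin_part_gen psi_lin) psi2 psi4 psi6.
  by rewrite psi_iso /form3 /=; ring.
have -> : sig3 (-1) x = -1 *: lin_part x + sym_part x.
  have [x0 [x1 [x2 [x3 [x4 [x5 [x6 [x7 ->]]]]]]]] := octP x.
  by rewrite oct_linear; apply: oct_eq; rewrite /=; ring.
rewrite psi_lin {1}[x]parts psiD linearD /= (sW _ (linW _)).
by rewrite (sWc _ sym_perp) scaleN1r.
Qed.

Lemma sigma_pow_psi n (x : O) : lfun_pow sigma n (psi x) = psi (sig3 ((-1) ^+ n) x).
Proof.
elim: n x => [|n IHn] x.
  rewrite expr0 /lfun_pow /= id_lfunE; congr psi.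
  have [x0 [x1 [x2 [x3 [x4 [x5 [x6 [x7 ->]]]]]]]] := octP x.
  by apply: oct_eq; rewrite /=; ring.
rewrite /lfun_pow iterS comp_lfunE -/(lfun_pow sigma n) IHn sigma_psi; congr psi.
have [x0 [x1 [x2 [x3 [x4 [x5 [x6 [x7 ->]]]]]]]] := octP x.
by rewrite exprS; apply: oct_eq; rewrite /=; ring.
Qed.

(** In the coordinates psi, tau and its inverse become tau3 1 and tau3 (-1), and
sigma becomes sig3 (-1); this turns the product of the isotope into model_mul. *)
Lemma isotope_P_model (i j : 'Z_2) (g := (-1) ^+ (1 - i)%N) (g' := (-1) ^+ (1 - j)%N) :
  exists h k, @algebra_iso R (model g g') (isotope_P tau sigma i j) h k.
Proof.
have [h hE] := linear_lfun psi_lin.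
have hom : alg_hom (h : 'Hom(model g g', isotope_P tau sigma i j)).
  move=> x y; rewrite !hE /=.
  rewrite /isotope_mul !comp_lfunE /=.
  rewrite !sigma_pow_psi tau_psi tauV_psi.
  have cE (t : O) : oconj R t = oconj_fun t by rewrite (lfunE (@oconj_fun R)).
  by rewrite !cE -!psi_conj -psi_mul.
have inj : injective h.
  move=> x y; rewrite !hE => e; apply/eqP; rewrite -subr_eq0; apply/eqP.
  have cM := @model_composition R 1 1 (expr1n _ _) (expr1n _ _).
  apply: (cp_eq0 cM); rewrite -psi_iso.
  have -> : psi (x - y) = 0.
    by rewrite -scaleN1r addrC psi_lin e scaleN1r addNr.
  by rewrite (cp0l (octonion_composition R)).
have [k hk] := inj_iso hom inj (erefl _).
by exists h, k.
Qed.

End IsotopeModel.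

Lemma isotope_P_iso_model (R : realType) (u v z : octonion R)
    (tau sigma : 'End(octonion R)) (i j : 'Z_2) :
    cayley_triple u v z -> in_G2 tau -> tau u = u -> tau v = v ->
    tau z = 2^-1 *: omul z (Num.sqrt 3 *: u - oone R) ->
    is_reflection <<[:: v; z; omul v z]>>%VS sigma ->
  exists h k, @algebra_iso R (model ((-1) ^+ (1 - i)%N) ((-1) ^+ (1 - j)%N))
    (isotope_P tau sigma i j) h k.
Proof.
move=> uvz tau_G2 tau_u tau_v tau_z sigma_W.
have [lin mul cj] := embed8P uvz.
have [e1 e2 e4] := embed8_generators u v z.
exact: (isotope_P_model uvz tau_G2 tau_u tau_v tau_z sigma_W lin mul cj
  (embed8_one u v z) e1 e2 e4 (embed8_isometry uvz)).
Qed.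

(** * Determinants *)

Section Determinants.
Variable R : realType.
Import passmx.

Lemma lfun_det_eigenbasis (V : vectType R) (s : seq V) (d : nat -> R)
    (f : 'End(V)) :
  basis_of {:V} s -> (forall i, (i < size s)%N -> f s`_i = d i *: s`_i) ->
  lfun_det f = \prod_(0 <= i < size s) d i.
Proof.
move=> bs fs; have sz : size s == \dim {:V} by rewrite (@size_basis _ _ _ _ (in_tuple s) bs).
pose e : (\dim {:V}).-tuple V := Tuple sz.
have be : basis_of {:V} e by [].
have -> : lfun_det f = \det (mxof e e f).
  rewrite -(lfun_det_conj (h := \1%VF) (k := \1%VF) f) //; last first.
    by move=> x; rewrite !id_lfunE.
  rewrite /lfun_det (mxof_comp _ _ be) (mxof_comp _ _ be).
  rewrite mulmxA; apply: det_conj => //; apply: mxof_cancel => //; first exact: vbasisP.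
  by move=> x; rewrite !id_lfunE.
have -> : mxof e e f = diag_mx (\row_i d i).
  apply/row_matrixP => i; rewrite rowE mul_mxof vecof_delta /=.
  rewrite fs ?(eqP sz) // linearZ /= (rVofE be) row_diag_mx mxE.
  by [].
rewrite det_diag (eqP sz) big_mkord.
by apply: eq_bigr => i _; rewrite mxE.
Qed.

Lemma lfun_det_scalar (V : vectType R) (a : R) :
  lfun_det (a *: \1 : 'End(V))%VF = a ^+ \dim {:V}.
Proof.
rewrite (@lfun_det_eigenbasis _ (vbasis {:V}) (fun=> a)) ?vbasisP //.
  by rewrite size_tuple big_mkord prodr_const card_ord.
by move=> i _; rewrite scale_lfunE id_lfunE.
Qed.

Lemma lfun_det_scale (V : vectType R) (a : R) (f : 'End(V)) :
  lfun_det (a *: f) = a ^+ \dim {:V} * lfun_det f.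
Proof.
rewrite -lfun_det_scalar -lfun_det_comp; congr lfun_det.
by apply/lfunP => x; rewrite comp_lfunE !scale_lfunE id_lfunE.
Qed.

(** For r = sqrt n the square completes to (f + r)^2 = 2 (a + r) f, where
a + r > 0; so det f has the sign of a square. It is nonzero because
f (2 a - f) = n. *)
Lemma quadratic_det_gt0 (V : vectType R) (f : 'End(V)) (a n : R) :
    a ^+ 2 < n -> (forall x, f (f x) = (2 * a) *: f x - n *: x) ->
  0 < lfun_det f.
Proof.
move=> an ff; have n0 : 0 < n by apply: le_lt_trans an; exact: sqr_ge0.
pose r := Num.sqrt n.
have r2 : r * r = n by rewrite -expr2 sqr_sqrtr // ltW.
have r0 : 0 < r by rewrite sqrtr_gt0.
have ar : 0 < a + r.
  have : `|a| < r by rewrite -sqrtr_sqr ltr_sqrt.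
  by rewrite ltr_norml => /andP[h _]; rewrite -ltrBlDr sub0r.
have unit : lfun_det f * lfun_det ((2 * a) *: \1 - f)%VF = n ^+ \dim {:V}.
  rewrite -lfun_det_comp -lfun_det_scalar; congr lfun_det; apply/lfunP => x.
  rewrite comp_lfunE !add_lfunE opp_lfunE !scale_lfunE !id_lfunE linearB linearZ /= ff.
  by rewrite opprB addrC subrK.
have det0 : lfun_det f != 0.
  apply/eqP => e; move: unit; rewrite e mul0r => /esym/eqP.
  by rewrite expf_eq0 (gt_eqF n0) andbF.
have sq : lfun_det (f + r *: \1)%VF ^+ 2 = (2 * (a + r)) ^+ \dim {:V} * lfun_det f.
  rewrite expr2 -lfun_det_comp -lfun_det_scale; congr lfun_det; apply/lfunP => x.
  rewrite comp_lfunE !add_lfunE !scale_lfunE !id_lfunE linearD linearZ /= ff.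
  have -> : 2 * (a + r) = 2 * a + (r + r) by ring.
  rewrite scalerDr scalerA r2 !scalerDl [r *: f x + n *: x]addrC addrACA.
  by rewrite subrK.
have : 0 <= (2 * (a + r)) ^+ \dim {:V} * lfun_det f by rewrite -sq sqr_ge0.
by rewrite pmulr_rge0 ?exprn_gt0 ?mulr_gt0 // lt_def det0.
Qed.

End Determinants.

(** * Double signs of the models *)

Section ModelSigns.
Variable R : realType.
Local Notation O := (octonion R).
Local Notation conj := (@oconj_fun R).

Definition real_part (c : O) : R := c.1.1.1.

(** Each octonion is a root of its quadratic polynomial, and by alternativity so
are its left and right multiplications. *)
Lemma omul3_left_quadratic (c x : O) :
  omul3 c (omul3 c x) = (2 * real_part c) *: omul3 c x - form3 c c *: x.
Proof.
have [c0 [c1 [c2 [c3 [c4 [c5 [c6 [c7 ->]]]]]]]] := octP c.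
have [x0 [x1 [x2 [x3 [x4 [x5 [x6 [x7 ->]]]]]]]] := octP x.
rewrite -[RHS]/(_ + _) -scaleNr /omul3 /cd_mul /form3 /real_part /=.
by apply: oct_eq; rewrite /= /GRing.scale /=; ring.
Qed.

Lemma omul3_right_quadratic (c x : O) :
  omul3 (omul3 x c) c = (2 * real_part c) *: omul3 x c - form3 c c *: x.
Proof.
have [c0 [c1 [c2 [c3 [c4 [c5 [c6 [c7 ->]]]]]]]] := octP c.
have [x0 [x1 [x2 [x3 [x4 [x5 [x6 [x7 ->]]]]]]]] := octP x.
rewrite -[RHS]/(_ + _) -scaleNr /omul3 /cd_mul /form3 /real_part /=.
by apply: oct_eq; rewrite /= /GRing.scale /=; ring.
Qed.

(** For c outside the real line the quadratic polynomial has no real root; a real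
c acts as a scalar, on a space of even dimension. *)
Lemma quadratic_mul_det_gt0 (c : O) (f : 'End(O)) : c != 0 ->
    (forall x, f (f x) = (2 * real_part c) *: f x - form3 c c *: x) ->
    (forall r x, c = oct r 0 0 0 0 0 0 0 -> f x = r *: x) ->
  0 < lfun_det f.
Proof.
move=> c0 fq fr.
have [lt|ge] := ltP (real_part c ^+ 2) (form3 c c).
  exact: quadratic_det_gt0 lt fq.
have [r cE] : exists r, c = oct r 0 0 0 0 0 0 0.
  exists (real_part c); move: ge; rewrite /form3 /real_part.
  have [x0 [x1 [x2 [x3 [x4 [x5 [x6 [x7 ->]]]]]]]] := octP c.
  rewrite /= expr2 => ge; have sq (t : R) : 0 <= t * t by rewrite -expr2 sqr_ge0.
  have z (t : R) : t * t <= 0 -> t = 0.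
    by move=> t0; apply/eqP; rewrite -sqrf_eq0 expr2 eq_le t0 sq.
  have h1 := sq x1; have h2 := sq x2; have h3 := sq x3; have h4 := sq x4.
  have h5 := sq x5; have h6 := sq x6; have h7 := sq x7.
  by apply: oct_eq => //; apply: z; lra.
have -> : f = r *: \1%VF.
  by apply/lfunP => x; rewrite (fr r x cE) scale_lfunE id_lfunE.
rewrite lfun_det_scalar (dim_octonion R).
have r0 : r != 0 by apply/eqP => r0; move/eqP: c0; apply; rewrite cE r0.
by rewrite exprn_even_gt0 // r0.
Qed.

Definition octonion_basis : seq O :=
  [:: oct 1 0 0 0 0 0 0 0; oct 0 1 0 0 0 0 0 0;
      oct 0 0 1 0 0 0 0 0; oct 0 0 0 1 0 0 0 0;
      oct 0 0 0 0 1 0 0 0; oct 0 0 0 0 0 1 0 0;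
      oct 0 0 0 0 0 0 1 0; oct 0 0 0 0 0 0 0 1].

Lemma octonion_basisP : basis_of {:O} octonion_basis.
Proof.
rewrite basisEdim (dim_octonion R) leqnn andbT; apply/subvP => x _.
have m i (k : R) : (i < 8)%N -> k *: octonion_basis`_i \in <<octonion_basis>>%VS.
  by move=> i8; apply/memvZ/memv_span/mem_nth.
have e : x = lin_part x + sym_part x by exact: parts.
have lid : linear (fun y : O => y) by [].
have lE := lin_part_gen lid x; have sE := sym_part_gen lid x.
rewrite e [lin_part x]lE [sym_part x]sE.
exact: (memvD (memvD (m 2%N _ isT) (memvD (m 4%N _ isT) (m 6%N _ isT)))
  (memvD (m 0%N _ isT) (memvD (m 1%N _ isT) (memvD (m 3%N _ isT)
  (memvD (m 5%N _ isT) (m 7%N _ isT)))))).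
Qed.

Lemma lfun_det_diagonal (f : 'End(O)) (d0 d1 d2 d3 d4 d5 d6 d7 : R) :
  (forall x0 x1 x2 x3 x4 x5 x6 x7, f (oct x0 x1 x2 x3 x4 x5 x6 x7) =
    oct (d0 * x0) (d1 * x1) (d2 * x2) (d3 * x3)
        (d4 * x4) (d5 * x5) (d6 * x6) (d7 * x7)) ->
  lfun_det f = d0 * d1 * d2 * d3 * d4 * d5 * d6 * d7.
Proof.
move=> fd; pose d := [:: d0; d1; d2; d3; d4; d5; d6; d7].
rewrite (lfun_det_eigenbasis octonion_basisP (d := nth 0 d)).
  by rewrite !big_nat_recr //= big_geq //= mul1r.
by case=> [|[|[|[|[|[|[|[|//]]]]]]]] _; rewrite /= fd octZ; apply: oct_eq; ring.
Qed.

Lemma det_conj_neg (f : 'End(O)) : (forall x, f x = conj x) -> lfun_det f = -1.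
Proof.
move=> fE; rewrite (@lfun_det_diagonal f 1 (-1) (-1) (-1) (-1) (-1) (-1) (-1)).
  by ring.
by move=> *; rewrite fE conj_oct; apply: oct_eq; ring.
Qed.

Lemma det_sig3 g (f : 'End(O)) : (forall x, f x = sig3 g x) -> lfun_det f = g ^+ 3.
Proof.
move=> fE; rewrite (@lfun_det_diagonal f 1 1 g 1 g 1 g 1); first by ring.
by move=> *; rewrite fE sig3E; apply: oct_eq; ring.
Qed.

(** tau3 t has order three, so its determinant is a real cube root of 1. *)
Lemma det_tau3 (t : R) (f : 'End(O)) : t ^+ 2 = 1 ->
  (forall x, f x = tau3 t x) -> 0 < lfun_det f.
Proof.
move=> t2 fE.
have e : lfun_det f * (lfun_det f * lfun_det f) = 1.
  rewrite -!lfun_det_comp -(lfun_det1 O); congr lfun_det; apply/lfunP => x.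
  rewrite !comp_lfunE id_lfunE !fE.
  have [x0 [x1 [x2 [x3 [x4 [x5 [x6 [x7 ->]]]]]]]] := octP x.
  by move: t2 => /eqP; rewrite sqrf_eq1 => /orP[] /eqP ->;
    apply: oct_eq; rewrite /=; field.
have d0 : lfun_det f != 0.
  by apply/eqP => z; move: e; rewrite z mul0r => /eqP; rewrite eq_sym oner_eq0.
have sq : 0 < lfun_det f * lfun_det f by rewrite -expr2 exprn_even_gt0.
by rewrite -(pmulr_lgt0 _ sq) e ltr01.
Qed.

(** A left multiplication of the model is one of the octonions, of positive
determinant, after the operator twisting the right factor. The signs come from
the conjugation, of determinant -1, and from sig3 g, of determinant g^3. *)
Lemma model_double_sign (g g' : R) (a : model g g') :
    g ^+ 2 = 1 -> g' ^+ 2 = 1 -> a != 0 ->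
  double_sign a = (- g, - g').
Proof.
move=> g2 g'2 a0.
have [K KE] := linear_lfun (@oconj_fun_linear R).
have [T TE] := linear_lfun (@tau3_linear R 1).
have [T' TE'] := linear_lfun (@tau3_linear R (-1)).
have [S SE] := linear_lfun (@sig3_linear R g).
have [S' SE'] := linear_lfun (@sig3_linear R g').
pose F := (K \o (T \o S'))%VF; pose G := (K \o (T' \o S))%VF.
have cM := @model_composition R g g' g2 g'2.
have t1 : (1 : R) ^+ 2 = 1 by rewrite expr1n.
have tN : (-1 : R) ^+ 2 = 1 by rewrite sqrrN expr1n.
have FE x : F x = conj (tau3 1 (sig3 g' x)) by rewrite !comp_lfunE KE TE SE'.
have GE x : G x = conj (tau3 (-1) (sig3 g x)) by rewrite !comp_lfunE KE TE' SE.
have nz (c : O) : form3 c c = form3 a a -> c != 0.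
  move=> e; apply: contra_neq a0 => c0; apply: (cp_eq0 cM); rewrite -e c0.
  exact: (cp0l cM).
have Fa : F a != 0 by apply: nz; rewrite FE form3_oconj form3_tau3 // form3_sig3.
have Ga : G a != 0 by apply: nz; rewrite GE form3_oconj form3_tau3 // form3_sig3.
have [bl br] := @omul3_bilinear R.
have [L LE] := linear_lfun (br (F a)).
have [Q QE] := linear_lfun (bl (G a)).
have sg3 (t : R) : t ^+ 2 = 1 -> Num.sg (t ^+ 3) = t.
  move=> e; rewrite exprS e mulr1; move/eqP: e; rewrite sqrf_eq1.
  by case/orP => /eqP ->; rewrite ?sgrN sgr1.
have sgF : Num.sg (lfun_det F) = - g'.
  rewrite !lfun_det_comp !sgrM (det_conj_neg KE) (det_sig3 SE') sgrN sgr1.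
  rewrite (gtr0_sg (det_tau3 t1 TE)) mul1r mulN1r; congr (- _).
  exact: sg3 g'2.
have sgG : Num.sg (lfun_det G) = - g.
  rewrite !lfun_det_comp !sgrM (det_conj_neg KE) (det_sig3 SE) sgrN sgr1.
  rewrite (gtr0_sg (det_tau3 tN TE')) mul1r mulN1r; congr (- _).
  exact: sg3 g2.
have Lpos : 0 < lfun_det L.
  apply: (quadratic_mul_det_gt0 Fa) => [x|r x FaE].
    by rewrite !LE omul3_left_quadratic.
  rewrite LE FaE; have [x0 [x1 [x2 [x3 [x4 [x5 [x6 [x7 ->]]]]]]]] := octP x.
  by rewrite /omul3 /cd_mul /=; apply: oct_eq; rewrite /= /GRing.scale /=; ring.
have Qpos : 0 < lfun_det Q.
  apply: (quadratic_mul_det_gt0 Ga) => [x|r x GaE].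
    by rewrite !QE omul3_right_quadratic.
  rewrite QE GaE; have [x0 [x1 [x2 [x3 [x4 [x5 [x6 [x7 ->]]]]]]]] := octP x.
  by rewrite /omul3 /cd_mul /=; apply: oct_eq; rewrite /= /GRing.scale /=; ring.
rewrite /double_sign; congr (_, _).
- have -> : left_mul a = (L \o G)%VF.
    by apply/lfunP => x; rewrite left_mulE comp_lfunE LE FE GE.
  by rewrite lfun_det_comp sgrM (gtr0_sg Lpos) mul1r.
- have -> : right_mul a = (Q \o F)%VF.
    by apply/lfunP => x; rewrite right_mulE comp_lfunE QE FE GE.
  by rewrite lfun_det_comp sgrM (gtr0_sg Qpos) mul1r.
Qed.

End ModelSigns.

(** * The classification *)

Section Classification.
Variable R : realType.

(** The multiplication table gives the isomorphism, and it carries the span of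
v, z, v z onto the summand U. Were both signs 1, the derivation of the Okubo
algebra that moves this span would contradict the invariance of U. *)
Lemma D35_model (A : algebra R) : cat_D35 A -> exists g g' : R,
  [/\ g ^+ 2 = 1, g' ^+ 2 = 1, g = -1 \/ g' = -1 &
      exists h k, @algebra_iso R (model g g') A h k].
Proof.
case=> [[A8 _] [U [V [[dimU irrU] [dimV irrV] UV _]]]].
have [b cpb] := cat_A8_composition A8; have [dimA _ _] := A8.
have [g [g' [e1 [e2 [e3 [d1 [d2 [d3 [p1 [p2 [p3 [q1 [q2 [q3]]]]]]]]]]]]]] :=
  D35_table cpb dimU dimV irrU irrV UV.
move=> [g2 g'2 [e1U e2U e3U] T].
have [h [hE hb hom]] := table_model cpb g2 g'2 T.
have cM := model_composition g2 g'2.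
have inj : injective h.
  move=> x y e; apply/eqP; rewrite -subr_eq0; apply/eqP; apply: (cp_eq0 cM).
  have hxy : h (x - y) = 0 by rewrite linearB /= e subrr.
  by rewrite -hb hxy (cp0l cpb).
have [k iso] : exists k, algebra_iso h k.
  by apply: inj_iso hom inj _; rewrite dimA (dim_octonion R).
exists g, g'; split=> //; last by exists h, k.
have [gN|gN] := eqVneq g (-1); [by left | right].
have {gN}g1 : g = 1.
  by move/eqP: g2; rewrite sqrf_eq1 (negPf gN) orbF => /eqP.
apply/eqP; apply: contraT => g'N.
have {g'N}g'1 : g' = 1.
  by move/eqP: g'2; rewrite sqrf_eq1 (negPf g'N) orbF => /eqP.
subst g g'.
have hU x : x \in linU 1 1 -> h x \in U.
  move=> /linUP; rewrite hE table_mapE.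
  have [x0 [x1 [x2 [x3 [x4 [x5 [x6 [x7 ->]]]]]]]] := octP x.
  case/(@oct_inj R _ _ _ _ _ _ _ _ 0 0 0 0 0 0 0 0) => [[/= -> -> _ ->] [_ -> _ ->]].
  by rewrite mulr0 !scale0r subr0 !addr0 memvZ // memvB ?memvD ?memvZ.
have UE : (h @: linU 1 1)%VS = U.
  have [_ _ dimL _] := @linU_symV R 1 1.
  apply/eqP; rewrite eqEdim (iso_dim iso) dimL dimU leqnn andbT.
  by apply/subvP => _ /memv_imgP[x xL ->]; apply: hU.
have [d dd [x xU dx]] := okubo_moves R.
have [_ _ hk _] := iso.
have : h (d x) \in U.
  have [subU _ _] := irrU.
  apply: (subvP (subU _ (iso_derivation (algebra_iso_sym iso) dd))).
  apply/memv_imgP; exists (h x); first exact: hU.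
  by rewrite !comp_lfunE /= hk.
by rewrite -UE (iso_mem iso) hk (negPf dx).
Qed.

Lemma sign_exponent (g : R) : g ^+ 2 = 1 -> exists i : 'Z_2, g = (-1) ^+ (1 - i)%N.
Proof.
move=> /eqP; rewrite sqrf_eq1 => /orP[] /eqP ->; first by exists 1; rewrite expr0.
by exists 0; rewrite expr1.
Qed.

Lemma opp_sign_exponent (i : 'Z_2) : - (-1) ^+ (1 - i)%N = (-1) ^+ i :> R.
Proof. by case: i => [[|[|//]] //= _]; rewrite ?expr1 ?expr0 ?opprK. Qed.

Lemma sign_exponent_inj (i j : 'Z_2) : (-1) ^+ i = (-1) ^+ j :> R -> i = j.
Proof.
move=> e; apply: val_inj; move: e.
have n : (-1 : R) != 1.
  by rewrite lt_eqF // (lt_trans (ltrN10 R)) ?ltr01.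
case: i => [[|[|//]] //= _]; case: j => [[|[|//]] //= _]; rewrite ?expr1 ?expr0 //.
  by move/esym/eqP; rewrite (negPf n).
by move/eqP; rewrite (negPf n).
Qed.

End Classification.

Theorem theorem5p2 (R : realType) (u v z : octonion R)
    (tau sigma : 'End(octonion R)) (i j : 'Z_2)
    (huvz : cayley_triple u v z)
    (htau : in_G2 tau) (htau_u : tau u = u) (htau_v : tau v = v)
    (htau_z : tau z = 2^-1 *: omul z (Num.sqrt 3 *: u - oone R))
    (hsigma : is_reflection <<[:: v; z; omul v z]>>%VS sigma) :
  ((i, j) != (1, 1) ->
     classifies (cat_D35_sign i j) (fun A => A = isotope_P tau sigma i j)) /\
  (forall A : algebra R, ~ cat_D35_sign 1 1 A).
Proof.
have P_model := isotope_P_iso_model i j huvz htau htau_u htau_v htau_z hsigma.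
have sq n : ((-1) ^+ n : R) ^+ 2 = 1 by rewrite sqrr_sign.
have signs (A : algebra R) (i' j' : 'Z_2) h k :
    @algebra_iso R (model ((-1) ^+ (1 - i')%N) ((-1) ^+ (1 - j')%N)) A h k ->
    forall a : A, a != 0 -> double_sign a = ((-1) ^+ i', (-1) ^+ j').
  move=> iso a a0; have [_ _ hk kk] := iso.
  rewrite -[a]kk (iso_double_sign iso) model_double_sign ?sq //.
    by rewrite !opp_sign_exponent.
  by apply: contraNneq a0 => ka; rewrite -[a]kk ka linear0.
have model_of (i' j' : 'Z_2) (A : algebra R) : cat_D35_sign i' j' A ->
    (i', j') != (1, 1) /\ exists h k,
    @algebra_iso R (model ((-1) ^+ (1 - i')%N) ((-1) ^+ (1 - j')%N)) A h k.
  move=> [D35 sgA].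
  have [g [g' [/sign_exponent[s ->] /sign_exponent[t ->] g_or iso]]] := D35_model D35.
  have [[a a0] _] : division_algebra A by case: D35 => [[[]]].
  have [h [k hk]] := iso.
  have := sgA a a0; rewrite (signs _ _ _ _ _ hk a a0).
  case=> /sign_exponent_inj <- /sign_exponent_inj <-; split=> //.
  apply/eqP => -[s1 t1]; move: g_or; rewrite s1 t1 expr0.
  have /negPf n : (1 : R) != -1.
    by rewrite gt_eqF // (lt_trans (ltrN10 R)) ?ltr01.
  by case=> /eqP; rewrite n.
split=> [ij|A /model_of[]]; last by rewrite eqxx.
have [h [k iso]] := P_model.
have D35P : cat_D35 (isotope_P tau sigma i j).
  apply: (iso_D35 iso); apply: model_D35; rewrite ?sq //.
  move: ij; clear; case: i => [[|[|//]] p]; first by left; rewrite expr1.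
  case: j => [[|[|//]] q]; first by right; rewrite expr1.
  by rewrite xpair_eqE -!val_eqE.
split.
- by move=> _ ->; split=> //; exact: signs iso.
- move=> A DA; have [_ [h' [k' iso']]] := model_of _ _ _ DA.
  exists (isotope_P tau sigma i j); split=> //.
  have [a a0] : exists a : A, a != 0 by case: DA => [[[[_ []]]]].
  apply: iso_isomorphic (algebra_iso_comp (algebra_iso_sym iso') iso).
  by exists a.
- by move=> A B -> ->.
Qed.
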